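(* Let $*$ be a star product on a Poisson manifold $(M,\{\cdot,\cdot\})$, let $\rho=\rho_0+\nu\rho_1+\dots$ be a nonvanishing formal density on $M$, and let $Q_\rho=(J_\rho^{-1})^t_\rho J_\rho$ be the corresponding modular automorphism of $*$. Then the derivation $\log Q_\rho$ of the algebra $(C^\infty(M)[[\nu]],* )$ is a deformation of the modular vector field of $(M,\{\cdot,\cdot\})$ corresponding to $\rho_0$, in the sense that for every $f\in C^\infty(M)$ $$\log Q_\rho\, f=\nu\,\mathrm{div}_{\rho_0}H_f \pmod{\nu^2}.$$ In particular, the coefficient at the first power of $\nu$ of $Q_\rho$ is the modular vector field $f\mapsto\mathrm{div}_{\rho_0}H_f$.
   Context: A star product $*$ on a Poisson manifold $(M,\{\cdot,\cdot\})$ is an associative $\nu$-linear product on $C^\infty(M)[[\nu]]$ given for $f,g\in C^\infty(M)$ by $f*g=\sum_{r\ge 0}\nu^rC_r(f,g)$, where the $C_r$ are bidifferential operators on $M$, $C_0(f,g)=fg$, $C_1(f,g)-C_1(g,f)=\{f,g\}$, and the constant $1$ is the unit. $R_f$ denotes right $*$-multiplication by $f$: $R_fg=g*f$. $\mathcal D[[\nu]]$ is the algebra of formal differential operators on $M$. A formal density $\rho=\rho_0+\nu\rho_1+\dots$ on $M$ is nonvanishing if $\rho_0$ is a nonvanishing smooth density. For such $\rho$ and $A\in\mathcal D[[\nu]]$, $A^t_\rho\in\mathcal D[[\nu]]$ is the formal transpose: $\int_M Au\cdot v\,\rho=\int_M u\cdot A^t_\rho v\,\rho$ for $u\in C^\infty(M)[[\nu]]$,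 $v\in C_c^\infty(M)[[\nu]]$. $J_\rho\in\mathcal D[[\nu]]$ is the formal differential operator with $J_\rho f=(R_f)^t_\rho1$; since $J_\rho=1\pmod\nu$, it is invertible in $\mathcal D[[\nu]]$. The operator $Q_\rho=(J_\rho^{-1})^t_\rho J_\rho$ satisfies $Q_\rho=1\pmod\nu$ and is an automorphism of the algebra $(C^\infty(M)[[\nu]],* )$; $\log Q_\rho$ is defined by the $\nu$-adically convergent logarithm series. $H_f$ is the Hamiltonian vector field on $M$, $H_fg=\{f,g\}$. The divergence $\mathrm{div}_{\rho_0}V$ of a vector field $V$ is defined by $\int_M Vu\,\rho_0=-\int_M u\,\mathrm{div}_{\rho_0}V\,\rho_0$ for $u\in C_c^\infty(M)$. *)

(* Defs.v *)
From HB Require Import structures.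
From mathcomp Require Import all_boot all_order all_algebra.
From mathcomp Require Import all_classical all_reals all_analysis.

Set Implicit Arguments.
Unset Strict Implicit.
Unset Printing Implicit Defensive.

Import Order.TTheory GRing.Theory Num.Theory.
Import numFieldNormedType.Exports.

Local Open Scope classical_set_scope.
Local Open Scope ring_scope.

(* "The x such that P x"; x0 is the value in case there is none. *)
Definition choose_such (T : Type) (x0 : T) (P : T -> Prop) : T :=
  if pselect (exists x, P x) is left exP then sval (cid exP) else x0.

(** ** Calculus on open subsets of R^n *)

(* pder [:: i1; ...; ik] g = d_ik (... (d_i1 g)). *)
Fixpoint pder (R : realType) (n : nat) (s : seq 'I_n) (g : 'rV[R]_n -> R) :
    'rV[R]_n -> R :=
  if s is i :: s' then pder s' (fun x => 'D_(delta_mx 0 i) g x) else g.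

(* For U open this is g \in C^oo(U): every iterated partial derivative of g is
   defined and (Frechet) differentiable at every point of U.  The values of g
   outside U do not matter. *)
Definition smooth_on (R : realType) (n : nat) (U : set 'rV[R]_n)
    (g : 'rV[R]_n -> R) : Prop :=
  forall (s : seq 'I_n) (x : 'rV[R]_n), U x -> differentiable (pder s g) x.

(* The integral over R^n with respect to Lebesgue measure, as an iterated
   integral; it is only used for continuous functions of compact support. *)
Fixpoint iint (R : realType) (n : nat) : ('rV[R]_n -> R) -> R :=
  match n return ('rV[R]_n -> R) -> R with
  | 0 => fun g => g 0
  | m.+1 => fun g =>
      (\int[@lebesgue_measure R]_t
         iint (fun y : 'rV[R]_m => g (row_mx (t%:M : 'rV[R]_1) y)))%R
  end.

Section SmoothOn.
Variables (R : realType) (n : nat).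
Implicit Types (U : set 'rV[R]_n) (f g : 'rV[R]_n -> R) (s : seq 'I_n).

Lemma near0_differentiable (V W : normedModType R) (h : V -> W) (x : V) :
  (\near x, h x = 0) -> differentiable h x.
Proof.
move=> h0; have hx0 : h x = 0 := nbhs_singleton h0.
have H : h \o shift x = cst (h x) + (\0 : {linear V -> W}) +o_ (0 : V) id.
  apply/eqaddoP => _/posnumP[e].
  have := h0; rewrite (near_shift 0) /= subr0 => h0'.
  near=> y.
  have -> : (h \o shift x - (cst (h x) + (\0 : {linear V -> W}))) y = 0.
    rewrite !fctE /= hx0 add0r subr0.
    exact: (near h0' y).
  by rewrite normr0 mulr_ge0.
have c0 : continuous (\0 : {linear V -> W}) by exact: cst_continuous.
apply/diff_locallyP.
have -> : ('d h x : V -> W) = (\0 : {linear V -> W}) by exact: (diff_unique c0 H).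
by split.
Unshelve. all: by end_near. Qed.

Lemma near_eq_differentiable (V W : normedModType R) (f g : V -> W) (x : V) :
  (\near x, f x = g x) -> differentiable f x -> differentiable g x.
Proof.
move=> fg df; have -> : g = f + (g - f) by rewrite addrC subrK.
apply: differentiableD => //; apply: near0_differentiable.
by apply: filterS fg => z fgz; rewrite !fctE fgz subrr.
Qed.

Lemma open_near U (P : 'rV[R]_n -> Prop) x :
  open U -> U x -> (forall y, U y -> P y) -> \near x, P x.
Proof.
move=> Uo Ux UP; have := open_nbhs_nbhs (conj Uo Ux : open_nbhs x U).
by apply: filterS.
Qed.

Lemma eq_pder U s f g : open U -> (forall x, U x -> f x = g x) ->
  forall x, U x -> pder s f x = pder s g x.
Proof.
move=> Uo; elim: s f g => [|i s IH] f g fg x Ux /=; first exact: fg.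
by apply: IH => // y Uy; apply: near_eq_derive; exact: (open_near Uo Uy fg).
Qed.

Lemma eq_pder_differentiable U s f g x : open U ->
  (forall x, U x -> f x = g x) -> U x ->
  differentiable (pder s f) x -> differentiable (pder s g) x.
Proof.
move=> Uo fg Ux; apply: near_eq_differentiable.
exact: (open_near Uo Ux (@eq_pder U s f g Uo fg)).
Qed.

Let upto (k : nat) U g := forall s x, (size s <= k)%N -> U x ->
  differentiable (pder s g) x.

Let upto0 k U g x : upto k U g -> U x -> differentiable g x.
Proof. by move=> H Ux; exact: (H [::]). Qed.

Let uptoD k U f g : open U -> upto k U f -> upto k U g -> upto k U (f + g).
Proof.
move=> Uo; elim: k f g => [|k IH] f g sf sg [|i s] x //= sk Ux;
  try by apply: differentiableD; [exact: upto0 sf Ux|exact: upto0 sg Ux].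
apply: (@eq_pder_differentiable U s
  ((fun y => 'D_(delta_mx 0 i) f y) + (fun y => 'D_(delta_mx 0 i) g y))) => //.
  move=> y Uy; rewrite fctE deriveD //; apply: diff_derivable;
    [exact: upto0 sf Uy|exact: upto0 sg Uy].
apply: IH => //.
  by move=> t y tk Uy; exact: (sf (i :: t)).
by move=> t y tk Uy; exact: (sg (i :: t)).
Qed.

Let uptoM k U f g : open U -> smooth_on U f -> smooth_on U g ->
  upto k U (f * g).
Proof.
move=> Uo; elim: k f g => [|k IH] f g sf sg [|i s] x //= sk Ux;
  try by apply: differentiableM; [exact: (sf [::])|exact: (sg [::])].
apply: (@eq_pder_differentiable U s
  ((f * (fun y => 'D_(delta_mx 0 i) g y)) +
   (g * (fun y => 'D_(delta_mx 0 i) f y)))) => //.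
  move=> y Uy; rewrite deriveM //; apply: diff_derivable;
    [exact: (sf [::])|exact: (sg [::])].
have sdf : smooth_on U (fun y => 'D_(delta_mx 0 i) f y).
  by move=> t; exact: (sf (i :: t)).
have sdg : smooth_on U (fun y => 'D_(delta_mx 0 i) g y).
  by move=> t; exact: (sg (i :: t)).
by apply: (@uptoD k U) => //; [exact: (IH f)|exact: (IH g)].
Qed.

Lemma smooth_on_cst U a : smooth_on U (cst a).
Proof.
move=> s x _; elim: s a => [|i s IH] a /=; first exact: differentiable_cst.
have -> : (fun y : 'rV[R]_n => 'D_(delta_mx 0 i) (cst a) y) = cst 0.
  by apply/funext => y; rewrite derive_cst.
exact: IH.
Qed.

Lemma smooth_onD U f g :
  open U -> smooth_on U f -> smooth_on U g -> smooth_on U (f + g).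
Proof.
move=> Uo sf sg s x Ux; apply: (@uptoD (size s) U) => //.
  by move=> t y _; exact: sf.
by move=> t y _; exact: sg.
Qed.

Lemma smooth_onM U f g :
  open U -> smooth_on U f -> smooth_on U g -> smooth_on U (f * g).
Proof. by move=> Uo sf sg s x Ux; exact: (@uptoM (size s) U). Qed.

End SmoothOn.

(** ** Smooth manifolds *)

(* A homeomorphism from an open set of T onto an open set of R^n; the two maps
   are total, and are only meaningful on these open sets. *)
Record chart (R : realType) (T : topologicalType) (n : nat) := Chart {
  cdom : set T;
  cmap : T -> 'rV[R]_n;
  cinv : 'rV[R]_n -> T;
  open_cdom : open cdom;
  open_cimg : open (cmap @` cdom);
  cmapK : forall p, cdom p -> cinv (cmap p) = p;
  cmap_continuous : forall p, cdom p -> {for p, continuous cmap};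
  cinv_continuous : forall x, (cmap @` cdom) x -> {for x, continuous cinv}
}.

Arguments open_cdom {R T n} c.
Arguments open_cimg {R T n} c.

Definition cimg (R : realType) (T : topologicalType) (n : nat)
  (c : chart R T n) : set 'rV[R]_n := cmap c @` cdom c.

(* The domain, in the coordinates c, of the transition map from c to d. *)
Definition coverlap (R : realType) (T : topologicalType) (n : nat)
  (c d : chart R T n) : set 'rV[R]_n := cmap c @` (cdom c `&` cdom d).

Definition transition (R : realType) (T : topologicalType) (n : nat)
  (c d : chart R T n) : 'rV[R]_n -> 'rV[R]_n := cmap d \o cinv c.

(* The atlas is not required to be maximal. *)
Record manifold (R : realType) (n : nat) := Manifold {
  points :> topologicalType;
  manifold_hausdorff : hausdorff_space points;
  manifold_second_countable : @second_countable points;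
  atlas : set (chart R points n);
  atlas_cover : forall p, exists2 c, atlas c & cdom c p;
  atlas_smooth : forall c d, atlas c -> atlas d -> forall i,
    smooth_on (coverlap c d) (fun x => transition c d x 0 i)
}.

Definition smooth_fun (R : realType) (n : nat) (M : manifold R n) (f : M -> R) :
  Prop := forall c, atlas c -> smooth_on (cimg c) (f \o cinv c).

Definition smooth_pred (R : realType) (n : nat) (M : manifold R n) :
  {pred M -> R} := fun f => `[< smooth_fun f >].

Arguments smooth_pred {R n} M f.

(* The algebra C^oo(M) of real-valued smooth functions. *)
Record Cinf (R : realType) (n : nat) (M : manifold R n) := MkCinf {
  Cinf_fun :> M -> R;
  CinfP : Cinf_fun \in smooth_pred M
}.

Section CinfAlgebra.
Variables (R : realType) (n : nat) (M : manifold R n).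

Lemma smooth_subring_closed : subring_closed (smooth_pred M).
Proof.
have cstS a : cst a \in smooth_pred M.
  apply/asboolP => c _; exact: (@smooth_on_cst _ _ (cimg c) a).
have mulS : {in smooth_pred M &, forall f g, f * g \in smooth_pred M}.
  move=> f g /asboolP sf /asboolP sg; apply/asboolP => c Ac.
  exact: (smooth_onM (open_cimg c) (sf c Ac) (sg c Ac)).
split => [|f g sf sg|f g sf sg]; [exact: cstS| |exact: mulS].
have /asboolP sNg := mulS _ _ (cstS (-1)) sg.
apply/asboolP => c Ac; move/asboolP: sf => sf.
have -> : f - g = f + cst (-1) * g.
  by apply/funext => p; rewrite !fctE mulN1r.
exact: (smooth_onD (open_cimg c) (sf c Ac) (sNg c Ac)).
Qed.

HB.instance Definition _ :=
  GRing.isSubringClosed.Build _ (smooth_pred M) smooth_subring_closed.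

Lemma smooth_scale_closed : GRing.scaler_closed (smooth_pred M).
Proof.
move=> a f /asboolP sf; apply/asboolP => c Ac.
exact: (smooth_onM (open_cimg c) (@smooth_on_cst _ _ _ a) (sf c Ac)).
Qed.

HB.instance Definition _ :=
  GRing.isScaleClosed.Build _ _ (smooth_pred M) smooth_scale_closed.

HB.instance Definition _ := [isSub for (@Cinf_fun R n M)].
HB.instance Definition _ := [Choice of Cinf M by <:].
HB.instance Definition _ :=
  GRing.SubChoice_isSubComPzRing.Build _ _ (Cinf M) (subringClosedP _).
HB.instance Definition _ := [SubZmodule_isSubLmodule of Cinf M by <:].

End CinfAlgebra.

Definition compactly_supported (R : realType) (n : nat) (M : manifold R n)
  (f : Cinf M) : Prop := compact (closure [set p | f p != 0]).

(** ** Differential and bidifferential operators *)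

(* The order N is uniform on M.  Partial derivatives are indexed by words in
   the coordinate directions; since they commute on smooth functions, the sum
   over words is an arbitrary sum over multi-indices of length at most N. *)
Definition diffop (R : realType) (n : nat) (M : manifold R n)
    (A : Cinf M -> Cinf M) : Prop :=
  exists N : nat, forall c, atlas c ->
  exists a : seq 'I_n -> 'rV[R]_n -> R,
    (forall s, smooth_on (cimg c) (a s)) /\
    forall (f : Cinf M) (x : 'rV[R]_n), cimg c x ->
      A f (cinv c x) =
      \sum_(k < N.+1) \sum_(s : k.-tuple 'I_n) a s x * pder s (f \o cinv c) x.

Definition bidiffop (R : realType) (n : nat) (M : manifold R n)
    (B : Cinf M -> Cinf M -> Cinf M) : Prop :=
  exists N : nat, forall c, atlas c ->
  exists a : seq 'I_n -> seq 'I_n -> 'rV[R]_n -> R,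
    (forall s t, smooth_on (cimg c) (a s t)) /\
    forall (f g : Cinf M) (x : 'rV[R]_n), cimg c x ->
      B f g (cinv c x) =
      \sum_(k < N.+1) \sum_(l < N.+1)
        \sum_(s : k.-tuple 'I_n) \sum_(t : l.-tuple 'I_n)
          a s t x * pder s (f \o cinv c) x * pder t (g \o cinv c) x.

(** ** Densities *)

(* A smooth density is given by its local coefficients, which transform by the
   absolute value of the Jacobian determinant.  Bundled with them is
   u |-> \int_M u rho on compactly supported functions, the unique linear
   functional which for u supported in a chart is the integral in coordinates
   (dint is not constrained on functions without compact support). *)
Record density (R : realType) (n : nat) (M : manifold R n) := Density {
  dcoef : chart R M n -> 'rV[R]_n -> R;
  dcoef_smooth : forall c, atlas c -> smooth_on (cimg c) (dcoef c);
  dcoef_transition : forall c d, atlas c -> atlas d ->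
    forall x, coverlap c d x ->
    dcoef c x =
    `|\det (jacobian (transition c d) x)| * dcoef d (transition c d x);
  dint : Cinf M -> R;
  dint_linear : forall (a : R) (u v : Cinf M),
    compactly_supported u -> compactly_supported v ->
    dint (a *: u + v) = a * dint u + dint v;
  dint_chart : forall c, atlas c -> forall u : Cinf M,
    compactly_supported u -> closure [set p | u p != 0] `<=` cdom c ->
    dint u =
    iint (fun x => if `[< cimg c x >] then u (cinv c x) * dcoef c x else 0)
}.

Definition nonvanishing (R : realType) (n : nat) (M : manifold R n)
  (rho : density M) : Prop :=
  forall c, atlas c -> forall x, cimg c x -> dcoef rho c x != 0.

(* div_rho V, for a vector field V seen as a derivation of C^oo(M). *)
Definition is_divergence (R : realType) (n : nat) (M : manifold R n)
    (rho : density M) (V : Cinf M -> Cinf M) (d : Cinf M) : Prop :=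
  forall u : Cinf M, compactly_supported u ->
    dint rho (V u) = - dint rho (u * d).

Definition divergence (R : realType) (n : nat) (M : manifold R n)
    (rho : density M) (V : Cinf M -> Cinf M) : Cinf M :=
  choose_such 0 (is_divergence rho V).

(** ** Formal power series in nu *)

(* fser M is C^oo(M)[[nu]]: f stands for the sum of the nu^r f_r.
   fop M consists of the nu-linear operators A_0 + nu A_1 + ... on it, given by
   their coefficients acting on C^oo(M). *)
Definition fser (R : realType) (n : nat) (M : manifold R n) : Type :=
  nat -> Cinf M.
Definition fop (R : realType) (n : nat) (M : manifold R n) : Type :=
  nat -> Cinf M -> Cinf M.

Section Formal.
Variables (R : realType) (n : nat) (M : manifold R n).
Implicit Types (f g : fser M) (A B : fop M).

Definition fconst (f : Cinf M) : fser M := fun r => if r == 0%N then f else 0.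

Definition fmul f g : fser M := fun r => \sum_(i < r.+1) f i * g (r - i)%N.

Definition fnu f : fser M :=
  fun r => if r is r'.+1 then f r' else 0.

(* f = g (mod nu^k) *)
Definition eqmod_nu (k : nat) f g : Prop := forall r, (r < k)%N -> f r = g r.

Definition fapp A f : fser M := fun r => \sum_(i < r.+1) A i (f (r - i)%N).

Definition fop_id : fop M := fun r u => if r == 0%N then u else 0.

Definition fop_sub A B : fop M := fun r u => A r u - B r u.

Definition fop_comp A B : fop M :=
  fun r u => \sum_(i < r.+1) A i (B (r - i)%N u).

Definition fop_exp A (k : nat) : fop M := iter k (fop_comp A) fop_id.

(* D[[nu]] *)
Definition formal_diffop A : Prop := forall r, diffop (A r).

Definition is_fop_inv A B : Prop :=
  [/\ formal_diffop B, fop_comp A B = fop_id & fop_comp B A = fop_id].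

Definition fop_inv A : fop M := choose_such fop_id (is_fop_inv A).

Definition nu_adic_limit (S : nat -> fop M) A : Prop :=
  forall r, exists K, forall k, (K <= k)%N -> S k r = A r.

(* Partial sums of log A = \sum_(j >= 1) (-1)^(j+1) / j (A - 1)^j. *)
Definition fop_log_partial A (k : nat) : fop M :=
  fun r u => \sum_(1 <= j < k.+1)
    ((-1) ^+ j.+1 / j%:R : R) *: fop_exp (fop_sub A fop_id) j r u.

Definition fop_log A : fop M :=
  choose_such (fun _ _ => 0 : Cinf M) (nu_adic_limit (fop_log_partial A)).

End Formal.

(** ** Formal densities and transposition *)

Definition formal_density (R : realType) (n : nat) (M : manifold R n) : Type :=
  nat -> density M.

Definition formal_nonvanishing (R : realType) (n : nat) (M : manifold R n)
  (rho : formal_density M) : Prop := nonvanishing (rho 0%N).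

(* \int_M w rho, an element of R[[nu]]. *)
Definition formal_int (R : realType) (n : nat) (M : manifold R n)
    (rho : formal_density M) (w : fser M) : nat -> R :=
  fun r => \sum_(k < r.+1) dint (rho k) (w (r - k)%N).

Definition is_transpose (R : realType) (n : nat) (M : manifold R n)
    (rho : formal_density M) (A B : fop M) : Prop :=
  formal_diffop B /\
  forall u v : fser M, (forall r, compactly_supported (v r)) ->
    formal_int rho (fmul (fapp A u) v) = formal_int rho (fmul u (fapp B v)).

Definition transpose (R : realType) (n : nat) (M : manifold R n)
    (rho : formal_density M) (A : fop M) : fop M :=
  choose_such (@fop_id R n M) (is_transpose rho A).

(** ** Poisson manifolds and star products *)

Record poisson (R : realType) (n : nat) (M : manifold R n) := Poisson {
  bracket :> Cinf M -> Cinf M -> Cinf M;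
  bracket_linear : forall (a : R) (f g h : Cinf M),
    bracket (a *: f + g) h = a *: bracket f h + bracket g h;
  bracket_antisym : forall f g, bracket f g = - bracket g f;
  bracket_leibniz : forall f g h,
    bracket f (g * h) = bracket f g * h + g * bracket f h;
  bracket_jacobi : forall f g h,
    bracket f (bracket g h) + bracket g (bracket h f) +
    bracket h (bracket f g) = 0
}.

Definition hamiltonian (R : realType) (n : nat) (M : manifold R n)
  (P : poisson M) (f : Cinf M) : Cinf M -> Cinf M := fun g => P f g.

(* The nu-bilinear extension of (f, g) |-> \sum_r nu^r C_r(f, g). *)
Definition formal_product (R : realType) (n : nat) (M : manifold R n)
    (C : nat -> Cinf M -> Cinf M -> Cinf M) (f g : fser M) : fser M :=
  fun r => \sum_(i < r.+1) \sum_(j < (r - i).+1) C i (f j) (g (r - i - j)%N).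

Record star_product (R : realType) (n : nat) (M : manifold R n)
    (P : poisson M) := StarProduct {
  scoef : nat -> Cinf M -> Cinf M -> Cinf M;
  scoef_bidiffop : forall r, bidiffop (scoef r);
  star_assoc : associative (formal_product scoef);
  scoef0 : forall f g, scoef 0%N f g = f * g;
  scoef1 : forall f g, scoef 1%N f g - scoef 1%N g f = P f g;
  star1f : left_id (fconst 1) (formal_product scoef);
  starf1 : right_id (fconst 1) (formal_product scoef)
}.

Section Modular.
Variables (R : realType) (n : nat) (M : manifold R n) (P : poisson M).
Variables (S : star_product P) (rho : formal_density M).

Definition star : fser M -> fser M -> fser M := formal_product (scoef S).

(* R_f : g |-> g * f *)
Definition star_right (f : fser M) : fop M :=
  fun r g => \sum_(i < r.+1) scoef S i g (f (r - i)%N).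

(* J_rho f = (R_f)^t_rho 1 *)
Definition is_J (J : fop M) : Prop :=
  formal_diffop J /\
  forall f : fser M,
    fapp J f = fapp (transpose rho (star_right f)) (fconst 1).

Definition J_op : fop M := choose_such (@fop_id R n M) is_J.

(* Q_rho = (J_rho^-1)^t_rho J_rho *)
Definition Q_op : fop M :=
  fop_comp (transpose rho (fop_inv J_op)) J_op.

(* D is an R-linear derivation of (C^oo(M)[[nu]], * ); an element of fop M is
   nu-linear by construction. *)
Definition star_derivation (D : fop M) : Prop :=
  (forall (a : R) (f g : fser M),
     fapp D (fun r => a *: f r + g r) =
     (fun r => a *: fapp D f r + fapp D g r)) /\
  (forall f g : fser M,
     fapp D (star f g) =
     (fun r => star (fapp D f) g r + star f (fapp D g) r)).

End Modular.

(* Main.v *)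
From HB Require Import structures.
Require Import Defs.
From mathcomp Require Import all_boot all_order all_algebra.
From mathcomp Require Import all_classical all_reals all_analysis.
From mathcomp Require Import measurable_realfun.
From mathcomp Require Import ring lra.

Set Implicit Arguments.
Unset Strict Implicit.
Unset Printing Implicit Defensive.

Import Order.TTheory GRing.Theory Num.Theory.
Import numFieldNormedType.Exports.

Local Open Scope classical_set_scope.
Local Open Scope ring_scope.

(* Write tau for integration against rho, so that tau (g * f) = tau (g . J f) when g
   has compact support.  For f and g of compact support,
     tau (Q f * g) = tau (Q f . J g) = tau (J f . J^-1 J g) = tau (g * f),
   since Q = (J^-1)^t J.  Hence
     tau (Q (f * h) * g) = tau (g * f * h) = tau (Q h * g * f) = tau (Q f * Q h * g)
   for all such g, and the pairing is nondegenerate because J is invertible, so Q is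
   multiplicative on functions of compact support, hence everywhere by locality.
   The coefficient of k in the polynomial k |-> Q^k is log Q, and extracting it from
   Q^k (f * h) = Q^k f * Q^k h gives the Leibniz rule.  At first order in nu the
   identity tau (g * f) = tau (Q f * g) says that the rho_0-integral of {f, g} is
   minus that of g . Q_1 f, that is, Q_1 f = div H_f.

   Transposes of differential operators come from integration by parts in charts;
   the local formulas agree on overlaps because they represent the same functional.
   All choice-based definitions (transpose, J, inverse, logarithm, divergence) are
   thereby shown to be choices from nonempty sets. *)

(** * Smooth functions on open sets of R^n *)

(** The functional tau only makes sense on functions of compact support, while J is defined through
    a transpose applied to 1 and Q acts on all functions. The way out is locality: differential
    operators depend only on germs, so a claim at a point is tested against functions supported near
    it, and arguments may be multiplied by a bump function equal to 1 there. J has to be a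
    differential operator in f, not merely a map. This is where bidifferentiality of the C_r enters:
    transposing g |-> C_r(g, f) in a chart produces coefficients that are themselves differential in
    f. Formal densities reduce to rho_0, because rho = H rho_0 with H = 1 (mod nu) invertible. Q - 1
    raises the order in nu, so in Q^k = \sum_j binomial(k, j) (Q - 1)^j only the terms j <= r reach
    the coefficient of nu^r, which is therefore polynomial in k. An identity between such
    polynomials needs checking only at natural k, where it is plain iteration of Q; no one-parameter
    group Q^t has to be built. *)

Definition pd (R : realType) n (i : 'I_n) (f : 'rV[R]_n -> R) : 'rV[R]_n -> R :=
  fun x => 'D_(delta_mx 0 i) f x.

Section SmoothCalculus.
Variables (R : realType) (n : nat).
Implicit Types (U V : set 'rV[R]_n) (f g : 'rV[R]_n -> R) (s : seq 'I_n).

(** Finite orders of regularity, so that closure properties can be proved by induction on the order.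
    Order 0 already asks for differentiability. *)
Definition Ck (k : nat) U f := forall s x, (size s <= k)%N -> U x ->
  differentiable (pder s f) x.

Lemma Ck_le k l U f : (k <= l)%N -> Ck l U f -> Ck k U f.
Proof. by move=> kl fl s x sk; apply: fl; exact: leq_trans kl. Qed.

Lemma smooth_onP U f : smooth_on U f <-> forall k, Ck k U f.
Proof.
by split=> [fs k s x _|fs s x]; [exact: fs|exact: (fs (size s))].
Qed.

Lemma CkS k U f : Ck k.+1 U f <->
  (forall x, U x -> differentiable f x) /\ forall i, Ck k U (pd i f).
Proof.
split=> [fk|[f0 fk] [|i s] x sk Ux].
- by split=> [x Ux|i s x sk Ux]; [exact: (fk [::])|exact: (fk (i :: s))].
- exact: f0.
- exact: (fk i s).
Qed.

Lemma Ck0 U f : Ck 0 U f <-> forall x, U x -> differentiable f x.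
Proof.
by split=> [f0 x Ux|f0 [|//] x _ Ux]; [exact: (f0 [::])|exact: f0].
Qed.

Lemma eq_Ck k U f g : open U -> (forall x, U x -> f x = g x) ->
  Ck k U f -> Ck k U g.
Proof.
by move=> Uo fg fk s x sk Ux; apply: (eq_pder_differentiable Uo fg Ux); exact: fk.
Qed.

Lemma eq_smooth_on U f g : open U -> (forall x, U x -> f x = g x) ->
  smooth_on U f -> smooth_on U g.
Proof.
by move=> Uo fg /smooth_onP fs; apply/smooth_onP => k; exact: (eq_Ck Uo fg).
Qed.

Lemma smooth_on_sub U V f : V `<=` U -> smooth_on U f -> smooth_on V f.
Proof. by move=> VU fs s x /VU; exact: fs. Qed.

Lemma smooth_on_local U f :
  (forall x, U x -> exists2 V, open V /\ V x & smooth_on V f) -> smooth_on U f.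
Proof. by move=> H s x /H[V [_ Vx]]; apply. Qed.

Lemma smooth_on_differentiable U f x : smooth_on U f -> U x -> differentiable f x.
Proof. by move=> fs; exact: (fs [::]). Qed.

Lemma smooth_on_derivable U f x v : smooth_on U f -> U x -> derivable f x v.
Proof.
by move=> fs Ux; apply: diff_derivable; exact: smooth_on_differentiable Ux.
Qed.

Lemma smooth_on_continuous U f x : smooth_on U f -> U x -> {for x, continuous f}.
Proof.
by move=> fs Ux; apply: differentiable_continuous; exact: smooth_on_differentiable Ux.
Qed.

Lemma smooth_on_pd U f i : smooth_on U f -> smooth_on U (pd i f).
Proof. by move=> fs s; exact: (fs (i :: s)). Qed.

Lemma smooth_on_pder U f s : smooth_on U f -> smooth_on U (pder s f).
Proof. by elim: s f => //= i s IH f fs; apply: IH; exact: smooth_on_pd. Qed.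

Lemma pder_cat s t f : pder (s ++ t) f = pder t (pder s f).
Proof. by elim: s f => //= i s IH f. Qed.

Lemma pder_rcons s i f : pder (rcons s i) f = pd i (pder s f).
Proof. by rewrite -cats1 pder_cat. Qed.

Lemma pdD U f g i x : smooth_on U f -> smooth_on U g -> U x ->
  pd i (f + g) x = pd i f x + pd i g x.
Proof. by move=> fs gs Ux; rewrite /pd deriveD//; exact: smooth_on_derivable Ux. Qed.

Lemma pdM U f g i x : smooth_on U f -> smooth_on U g -> U x ->
  pd i (f * g) x = f x * pd i g x + g x * pd i f x.
Proof. by move=> fs gs Ux; rewrite /pd deriveM//; exact: smooth_on_derivable Ux. Qed.

Lemma eq_pd U f g i x : open U -> (forall x, U x -> f x = g x) -> U x ->
  pd i f x = pd i g x.
Proof. by move=> Uo fg Ux; exact: (eq_pder [:: i] Uo fg). Qed.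

Lemma CkD k U f g : open U -> Ck k U f -> Ck k U g -> Ck k U (f + g).
Proof.
move=> Uo; elim: k f g => [|k IH] f g.
  by move=> /Ck0 f0 /Ck0 g0; apply/Ck0 => x Ux; apply: differentiableD; auto.
move=> /CkS[f0 fk] /CkS[g0 gk]; apply/CkS; split=> [x Ux|i].
  by apply: differentiableD; auto.
apply: (@eq_Ck _ _ (pd i f + pd i g)) => //; last exact: IH.
move=> x Ux; rewrite /pd deriveD//; apply: diff_derivable; auto.
Qed.

Lemma CkM k U f g : open U -> Ck k U f -> Ck k U g -> Ck k U (f * g).
Proof.
move=> Uo; elim: k f g => [|k IH] f g.
  by move=> /Ck0 f0 /Ck0 g0; apply/Ck0 => x Ux; apply: differentiableM; auto.
move=> fS gS; have /CkS[f0 fk] := fS; have /CkS[g0 gk] := gS.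
apply/CkS; split=> [x Ux|i]; first by apply: differentiableM; auto.
apply: (@eq_Ck _ _ (f * pd i g + g * pd i f)) => //.
  by move=> x Ux; rewrite /pd deriveM//; apply: diff_derivable; auto.
by apply: CkD => //; apply: IH => //; apply: Ck_le (leqnSn k) _.
Qed.

Lemma Ck_sum k U (I : Type) (r : seq I) (F : I -> 'rV[R]_n -> R) :
  open U -> (forall i, Ck k U (F i)) -> Ck k U (fun x => \sum_(i <- r) F i x).
Proof.
move=> Uo FU; elim: r => [|i r IH].
  under eq_fun do rewrite big_nil.
  by have /smooth_onP := smooth_on_cst (U:=U) (0 : R); exact.
by under eq_fun do rewrite big_cons; exact: (CkD Uo (FU i) IH).
Qed.

Lemma smooth_on_prod U (I : Type) (r : seq I) (F : I -> 'rV[R]_n -> R) :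
  open U -> (forall i, smooth_on U (F i)) -> smooth_on U (fun x => \prod_(i <- r) F i x).
Proof.
move=> Uo FU; elim: r => [|i r IH].
  by under eq_fun do rewrite big_nil; exact: smooth_on_cst.
by under eq_fun do rewrite big_cons; exact: (smooth_onM Uo (FU i) IH).
Qed.

Lemma smooth_onN U f : open U -> smooth_on U f -> smooth_on U (- f).
Proof.
move=> Uo fs; apply: (@eq_smooth_on _ (cst (-1) * f)) => //.
  by move=> x _; rewrite !fctE mulN1r.
by apply: smooth_onM => //; exact: smooth_on_cst.
Qed.

Lemma smooth_onB U f g : open U -> smooth_on U f -> smooth_on U g ->
  smooth_on U (f - g).
Proof. by move=> Uo fs gs; apply: smooth_onD => //; exact: smooth_onN. Qed.

(** The derivative of 1/f is - (1/f)^2 f', an expression in 1/f itself, so each order of regularity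
    of 1/f follows from the previous one. *)
Lemma smooth_onV U f : open U -> smooth_on U f -> (forall x, U x -> f x != 0) ->
  smooth_on U (fun x => (f x)^-1).
Proof.
move=> Uo fs f0; apply/smooth_onP; elim=> [|k IH].
  apply/Ck0 => x Ux; apply: differentiableV; last exact: f0.
  exact: smooth_on_differentiable Ux.
apply/CkS; split=> [x Ux|i].
  by apply: differentiableV; [exact: smooth_on_differentiable Ux|exact: f0].
pose g x := (f x)^-1.
apply: (@eq_Ck _ _ (cst (-1) * (g * g) * pd i f)) => //.
  move=> x Ux; rewrite /pd [RHS]deriveV ?f0//; last exact: smooth_on_derivable Ux.
  by rewrite !fctE /g /GRing.scale/= mulN1r expr2 invfM.
apply: CkM => //; last by have /smooth_onP := smooth_on_pd i fs; exact.
apply: CkM => //; last exact: CkM.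
by have /smooth_onP := smooth_on_cst (U:=U) (-1 : R); exact.
Qed.

(** [F k] stands for the k-th derivative of [F 0]. The induction treats all [F l] at once, since
    differentiating [F l \o f] produces [F l.+1 \o f]. *)
Lemma smooth_on_comp1 U f (D : set R) (F : nat -> R -> R) : open U ->
  smooth_on U f -> (forall x, U x -> D (f x)) ->
  (forall k t, D t -> is_derive t 1 (F k) (F k.+1 t)) ->
  smooth_on U (F 0%N \o f).
Proof.
move=> Uo fs fD FD.
have dF k x : U x -> differentiable (F k \o f) x.
  move=> Ux; apply: differentiable_comp.
    exact: smooth_on_differentiable Ux.
  by apply/derivable1_diffP; have [] := FD k _ (fD x Ux).
suff H k l : Ck k U (F l \o f) by apply/smooth_onP => k; exact: H.
elim: k l => [|k IH] l; first by apply/Ck0; exact: dF.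
apply/CkS; split=> [|i]; first exact: dF.
apply: (@eq_Ck _ _ ((F l.+1 \o f) * pd i f)) => //; last first.
  by apply: CkM => //; have /smooth_onP := smooth_on_pd i fs; exact.
move=> x Ux; have dfx := smooth_on_differentiable fs Ux.
have [dFx eFx] := FD l _ (fD x Ux); have /derivable1_diffP dFx' := dFx.
rewrite /pd deriveE; last exact: dF.
rewrite diff_comp//= fctE /=.
rewrite (@deriv1E _ _ (F l) (f x))// derive1E eFx /GRing.scale/= deriveE//.
by rewrite mulrC.
Qed.

Lemma smooth_on_coord U i : smooth_on U (fun x : 'rV[R]_n => x 0 i).
Proof.
apply/smooth_onP; case=> [|k].
  by apply/Ck0 => x _; exact: differentiable_coord.
apply/CkS; split=> [x _|j]; first exact: differentiable_coord.
have -> : pd j (fun x : 'rV[R]_n => x 0 i) = cst ((delta_mx 0 j : 'rV[R]_n) 0 i).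
  apply/funext => x; rewrite /pd deriveE; last exact: differentiable_coord.
  have lin : linear (fun x : 'rV[R]_n => x 0 i : R^o).
    by move=> a u v; rewrite !mxE.
  pose L := GRing.isLinear.Build _ _ _ _ (fun x : 'rV[R]_n => x 0 i : R^o) lin.
  pose h : {linear 'rV[R]_n -> R^o} := HB.pack (fun x : 'rV[R]_n => x 0 i : R^o) L.
  have := @diff_lin _ _ _ h x (@coord_continuous _ _ _ 0 i).
  by move=> /(congr1 (fun f => f (delta_mx 0 j))).
by have /smooth_onP := smooth_on_cst (U:=U) ((delta_mx 0 j : 'rV[R]_n) 0 i); exact.
Qed.

End SmoothCalculus.

(** * Chain rule and smoothness of compositions *)

Section Composition.
Variables (R : realType) (m n : nat).

Lemma row_differentiable (phi : 'rV[R]_n -> 'rV[R]_m) x :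
  (forall j, differentiable (fun y => phi y 0 j) x) -> differentiable phi x.
Proof.
move=> dphi.
have -> : phi = \sum_(j < m) (fun y => phi y 0 j *: (delta_mx 0 j : 'rV[R]_m)).
  apply/funext => y; rewrite fct_sumE [LHS]matrix_sum_delta.
  by rewrite big_ord1; apply: eq_bigr.
by apply: differentiable_sum => j; exact: differentiableZl.
Qed.

Lemma pd_comp (phi : 'rV[R]_n -> 'rV[R]_m) (g : 'rV[R]_m -> R) i x :
  (forall j, differentiable (fun y => phi y 0 j) x) ->
  differentiable g (phi x) ->
  pd i (g \o phi) x = \sum_(j < m) pd j g (phi x) * pd i (fun y => phi y 0 j) x.
Proof.
move=> dphi dg; have dp := row_differentiable dphi.
rewrite /pd deriveE; last exact: differentiable_comp.
rewrite diff_comp//= -(deriveE _ dp).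
rewrite [X in 'd g _ X]matrix_sum_delta big_ord1 linear_sum/=.
apply: eq_bigr => j _; rewrite linearZ/= -deriveE// mulrC; congr (_ * _).
by rewrite derive_mx ?mxE//; exact: diff_derivable.
Qed.

(** Induction on the order with g generalised: the chain rule brings in the partial derivatives of g
    composed with phi. *)
Lemma smooth_on_comp (U : set 'rV[R]_n) (V : set 'rV[R]_m)
    (phi : 'rV[R]_n -> 'rV[R]_m) (g : 'rV[R]_m -> R) :
  open U -> (forall j, smooth_on U (fun y => phi y 0 j)) ->
  (forall x, U x -> V (phi x)) -> smooth_on V g -> smooth_on U (g \o phi).
Proof.
move=> Uo phis UV gs.
have dphi x : U x -> forall j, differentiable (fun y => phi y 0 j) x.
  by move=> Ux j; exact: smooth_on_differentiable Ux.
have dcomp h : smooth_on V h -> forall x, U x -> differentiable (h \o phi) x.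
  move=> hs x Ux; apply: differentiable_comp; first exact: row_differentiable (dphi _ Ux).
  by apply: smooth_on_differentiable hs _; exact: UV.
apply/smooth_onP => k; elim: k g gs => [|k IH] g gs.
  by apply/Ck0; exact: dcomp.
apply/CkS; split=> [|i]; first exact: dcomp.
apply: (@eq_Ck _ _ _ _
    (fun x => \sum_(j < m) pd j g (phi x) * pd i (fun y => phi y 0 j) x)) => //.
  move=> x Ux; rewrite pd_comp//; first exact: dphi.
  by apply: smooth_on_differentiable gs _; exact: UV.
apply: Ck_sum => // j; apply: CkM => //.
  by apply: (IH (pd j g)); exact: smooth_on_pd.
by have /smooth_onP := smooth_on_pd i (phis j); exact.
Qed.

End Composition.

(** * Iterated integrals *)

Section OneVariable.
Variable R : realType.
Notation mu := (@lebesgue_measure R).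
Implicit Types (f g : R -> R) (B : R).

(** The explicit bound B turns an integral over the line into one over the segment [-B, B], and
    gives quantitative estimates. *)
Definition csupp1 B f := continuous f /\ forall t, B < `|t| -> f t = 0.

Lemma Rintegral_csupp1 B f : csupp1 B f ->
  (\int[mu]_t f t = \int[mu]_(t in `[-B, B]) f t)%R.
Proof.
move=> [_ f0]; rewrite [RHS]Rintegral_mkcond; apply: eq_Rintegral => t _.
rewrite patchE; case: ifPn => //; rewrite notin_setE/= in_itv/= => /negP.
by rewrite -ler_norml -ltNge => /f0.
Qed.

Lemma csupp1_integrable B f : csupp1 B f -> mu.-integrable `[-B, B] (EFin \o f).
Proof.
move=> [cf _]; apply: continuous_compact_integrable; first exact: segment_compact.
exact: continuous_subspaceT.
Qed.

Lemma csupp1_linear B a f g : csupp1 B f -> csupp1 B g ->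
  csupp1 B (fun t => a * f t + g t).
Proof.
move=> [cf f0] [cg g0]; split=> [t|t Bt]; last by rewrite f0// g0// mulr0 addr0.
apply: (@continuousD _ _ _ (fun t => a * f t) g); last exact: cg.
by apply: continuousM; [exact: cst_continuous|exact: cf].
Qed.

Lemma Rintegral_linear B a f g : csupp1 B f -> csupp1 B g ->
  (\int[mu]_t (a * f t + g t) = a * \int[mu]_t f t + \int[mu]_t g t)%R.
Proof.
move=> sf sg; rewrite (Rintegral_csupp1 (csupp1_linear a sf sg)).
rewrite (Rintegral_csupp1 sf) (Rintegral_csupp1 sg) RintegralD//.
- by rewrite RintegralZl//; exact: csupp1_integrable.
- apply: (@csupp1_integrable _ (fun t => a * f t)).
  have s0 : csupp1 B (fun=> 0) by split=> // t; exact: cst_continuous.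
  have := csupp1_linear a sf s0; congr csupp1.
  by apply/funext => t; rewrite addr0.
- exact: csupp1_integrable.
Qed.

Lemma Rintegral_bound B f M : 0 <= B -> csupp1 B f -> (forall t, `|f t| <= M) ->
  `|\int[mu]_t f t|%R <= 2 * B * M.
Proof.
move=> B0 sf fM; rewrite (Rintegral_csupp1 sf).
apply: le_trans (@le_normr_Rintegral _ _ _ mu _ _ (measurable_itv _) (csupp1_integrable sf)) _.
have -> : 2 * B * M = (\int[mu]_(t in `[-B, B]) M)%R.
  rewrite Rintegral_cst// [X in fine X]lebesgue_measure_itv/= lte_fin mulrC; congr (_ * _).
  case: ltP => /= BB; first by rewrite opprK; ring.
  by rewrite (_ : B = 0) ?mulr0//; lra.
apply: le_Rintegral => //.
- apply: continuous_compact_integrable; first exact: segment_compact.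
  apply: continuous_subspaceT => t; apply: continuous_comp; first exact: sf.1.
  exact: norm_continuous.
- apply: continuous_compact_integrable; first exact: segment_compact.
  by apply: continuous_subspaceT => t; exact: cst_continuous.
Qed.

Lemma Rintegral_derive0 B f (F : R -> R) : 0 <= B -> csupp1 B f ->
  (forall t : R, is_derive t (1 : R) F (f t)) -> (forall t, B < `|t| -> F t = 0) ->
  (\int[mu]_t f t = 0)%R.
Proof.
move=> B0 [cf f0] dF F0.
(* F is known to vanish only strictly beyond B, so the segment is enlarged to make F zero at both
   end points. *)
have sf : csupp1 (B + 1) f.
  by split=> // t Bt; apply: f0; apply: lt_trans Bt; rewrite ltrDl.
have BB : - (B + 1) < B + 1 by lra.
have cF : continuous F.
  move=> t; apply: differentiable_continuous; apply/derivable1_diffP.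
  by have [] := dF t.
rewrite (Rintegral_csupp1 sf) /Rintegral (@continuous_FTC2 _ f F)//.
- by rewrite /= !F0 ?subrr// ?normrN gtr0_norm; lra.
- exact: continuous_subspaceT.
- split=> [t _||]; first by have [] := dF t.
  + exact/cvg_at_right_filter/cF.
  + exact/cvg_at_left_filter/cF.
- by move=> t _; rewrite derive1E; have [] := dF t.
Qed.

(** A positive value [f t] would keep f above [f t / 2] on a segment of length e, hence make the
    integral positive. *)
Lemma Rintegral_ge0_eq0 B f : csupp1 B f -> (forall t, 0 <= f t) ->
  (\int[mu]_t f t = 0)%R -> forall t, f t = 0.
Proof.
move=> sf f_ge0 If t; apply/eqP; rewrite eq_le f_ge0 andbT leNgt; apply/negP => ft0.
have cf := sf.1; have := cf t => /cvgrPdist_lt/(_ (f t / 2)) -[|e /= e0 He].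
  by rewrite divr_gt0.
have fge u : u \in `[t - e / 2, t + e / 2]%R -> f t / 2 <= f u.
  rewrite in_itv/= => /andP[u1 u2].
  have := He u; rewrite /ball_/= => /(_ _); have : `|t - u| < e.
    by rewrite ltr_norml; lra.
  by move=> /[swap] /[apply]; rewrite ltr_norml; lra.
have intf : mu.-integrable setT (EFin \o f).
  have fE : EFin \o f = (EFin \o f) \_ (`[-B, B] : set R).
    rewrite restrict_EFin; congr (_ \o _); apply/funext => u.
    rewrite patchE; case: ifPn => //; rewrite notin_setE/= in_itv/= => /negP.
    by rewrite -ler_norml -ltNge => /sf.2.
  rewrite fE.
  exact: ((@integrable_mkcond _ _ R mu _ _ (measurable_itv _)).1 (csupp1_integrable sf)).
have : (0 < \int[mu]_u (f u)%:E)%E.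
  apply: (@lt_le_trans _ _ (\int[mu]_(u in `[(t - e / 2)%R, (t + e / 2)%R]) (f t / 2)%:E)%E).
    rewrite integral_cst/=; last exact: measurable_itv.
    rewrite [X in (_ * X)%E]lebesgue_measure_itv/= lte_fin ifT; last by lra.
    by rewrite -EFinD -EFinM lte_fin mulr_gt0//; lra.
  apply: (@le_trans _ _ (\int[mu]_(u in `[(t - e / 2)%R, (t + e / 2)%R]) (f u)%:E)%E).
    apply: ge0_le_integral => //=.
    - by move=> u _; rewrite lee_fin; lra.
    - by apply/measurable_EFinP; apply: measurable_funTS; exact: continuous_measurable_fun.
  apply: ge0_subset_integral => //=.
  - by apply/measurable_EFinP; exact: continuous_measurable_fun.
  - by move=> u _; rewrite lee_fin.
have fin : (\int[mu]_u (f u)%:E)%E \is a fin_num by exact: integrable_fin_num.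
by rewrite -(fineK fin) lte_fin -/(Rintegral _ _ _) If ltxx.
Qed.

End OneVariable.

Lemma row_continuous_at (R : realType) (T : topologicalType) n (phi : T -> 'rV[R]_n) x :
  (forall j, {for x, continuous (fun y => phi y 0 j)}) -> {for x, continuous phi}.
Proof.
move=> cphi; apply/cvgrPdist_le => e e0; near=> y.
rewrite /Num.Def.normr/= mx_normrE (bigmax_le _ (ltW e0))//= => -[i j] _ /=.
rewrite !mxE ord1; move: j; near: y; apply: filter_forall => j /=.
by have /cvgrPdist_le := cphi j; exact.
Unshelve. all: by end_near. Qed.

(** * Iterated integrals of continuous functions with bounded support *)

Section IteratedIntegral.
Variable R : realType.
Notation mu := (@lebesgue_measure R).
Implicit Types (B : R).

Definition csupp n B (g : 'rV[R]_n -> R) :=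
  continuous g /\ forall (x : 'rV[R]_n) i, B < `|x 0 i| -> g x = 0.

Definition slice n (t : R) (g : 'rV[R]_n.+1 -> R) : 'rV[R]_n -> R :=
  fun y => g (row_mx (t%:M : 'rV[R]_1) y).

Lemma iintS n (g : 'rV[R]_n.+1 -> R) :
  iint g = (\int[mu]_t iint (slice t g))%R.
Proof. by []. Qed.

Lemma slice_coord0 n t (y : 'rV[R]_n) : (row_mx (t%:M : 'rV[R]_1) y : 'rV_n.+1) 0 0 = t.
Proof.
have -> : (0 : 'I_n.+1) = lshift n (0 : 'I_1) by apply: val_inj.
by rewrite (row_mxEl (t%:M : 'rV[R]_1) y) !mxE.
Qed.

Lemma slice_coordS n t (y : 'rV[R]_n) i :
  (row_mx (t%:M : 'rV[R]_1) y : 'rV_n.+1) 0 (lift 0 i) = y 0 i.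
Proof.
have -> : lift 0 i = rshift 1 i by apply: val_inj.
by rewrite (row_mxEr (t%:M : 'rV[R]_1) y).
Qed.

Lemma slice_continuous2 n (t : R) (y : 'rV[R]_n) :
  {for (t, y), continuous (fun p : R * 'rV[R]_n =>
     row_mx (p.1%:M : 'rV[R]_1) p.2 : 'rV[R]_n.+1)}.
Proof.
apply: row_continuous_at => j; case: (unliftP 0 j) => [i|] ->.
  rewrite /prop_for /continuous_at/=; under eq_fun do rewrite slice_coordS.
  rewrite slice_coordS.
  apply: (@continuous_comp _ _ _ (@snd R 'rV[R]_n) (fun y : 'rV[R]_n => y 0 i) (t, y)).
    exact: cvg_snd.
  exact: coord_continuous.
rewrite /prop_for /continuous_at/=; under eq_fun do rewrite slice_coord0.
by rewrite slice_coord0; exact: cvg_fst.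
Qed.

Lemma slice_csupp n B t (g : 'rV[R]_n.+1 -> R) : csupp B g -> csupp B (slice t g).
Proof.
move=> [cg g0]; split=> [y|y i By].
  apply: (@continuous_comp _ _ _ (fun y => (t, y)) (fun p : R * 'rV[R]_n =>
     g (row_mx (p.1%:M : 'rV[R]_1) p.2)) y).
    by apply: (@cvg_pair _ _ _ (nbhs y) (nbhs t) (nbhs y) _ _ _ (fun=> t) id);
      [exact: cvg_cst|exact: cvg_id].
  apply: continuous_comp; first exact: slice_continuous2.
  exact: cg.
by apply: (g0 _ (lift 0 i)); rewrite slice_coordS.
Qed.

Lemma slice_out n B t (g : 'rV[R]_n.+1 -> R) : csupp B g -> B < `|t| ->
  slice t g = fun=> 0.
Proof. by move=> [cg g0] Bt; apply/funext => y; apply: (g0 _ 0); rewrite slice_coord0. Qed.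

Lemma box_compact n B : compact [set y : 'rV[R]_n | forall i, `|y 0 i| <= B].
Proof.
have -> : [set y : 'rV[R]_n | forall i, `|y 0 i| <= B] =
    [set y : 'rV[R]_n | forall i, `[-B, B]%classic (y ord0 i)]; last first.
  by apply: (@rV_compact R n (fun=> `[-B, B]%classic)) => i; exact: segment_compact.
by apply/seteqP; split=> y /= yB i; have := yB i; rewrite in_itv/= ler_norml.
Qed.

(** Uniformity in y comes from compactness of the box of radius B; outside that box both slices
    vanish. *)
Lemma slice_near n B t (g : 'rV[R]_n.+1 -> R) e : csupp B g -> 0 < e ->
  \forall s \near t, forall y, `|slice s g y - slice t g y| <= e.
Proof.
move=> sg e0.
have /compact_near_coveringP/(_ R (nbhs t)
  (fun s y => `|slice s g y - slice t g y| <= e) _) := @box_compact n B.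
case=> [y _|d /= d0 dP].
  have c1 : {for (t, y), continuous (fun p : R * 'rV[R]_n =>
      slice p.1 g p.2 - slice t g p.2)}.
    apply: continuousB => /=.
      apply: continuous_comp; first exact: slice_continuous2.
      exact: sg.1.
    apply: (@continuous_comp _ _ _ (@snd R 'rV[R]_n) (slice t g)); first exact: cvg_snd.
    exact: (slice_csupp t sg).1.
  have := c1; rewrite /prop_for /continuous_at/= subrr => /cvgr0Pnorm_le/(_ _ e0).
  case=> /= -[U V] /= [tU yV] UV; exists (V, U) => //= -[y' s] /= [? ?].
  exact: (UV (s, y')).
exists d => //= s /dP sP y.
have [yB|/existsNP[i /negP]] := pselect (forall i, `|y 0 i| <= B); first exact: sP.
rewrite -ltNge => By; rewrite ((slice_csupp s sg).2 _ i)// ((slice_csupp t sg).2 _ i)//.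
by rewrite subrr normr0 ltW.
Qed.

Lemma csupp_linear n B a (f g : 'rV[R]_n -> R) : csupp B f -> csupp B g ->
  csupp B (fun x => a * f x + g x).
Proof.
move=> [cf f0] [cg g0]; split=> [t|t i Bt]; last by rewrite (f0 t i)// (g0 t i)// mulr0 addr0.
apply: (@continuousD _ _ _ (fun t => a * f t) g); last exact: cg.
by apply: continuousM; [exact: cst_continuous|exact: cf].
Qed.

Lemma iint0 n : iint (fun _ : 'rV[R]_n => 0 : R) = 0.
Proof.
elim: n => //= n IH; under eq_Rintegral do rewrite IH.
by rewrite Rintegral_cst// mul0r.
Qed.

(** The three claims support each other. Linearity and the bound in dimension n.+1 integrate the
    function t |-> [iint (slice t g)], whose continuity is the third claim in dimension n; the third
    claim in dimension n.+1 follows from the other two there and from [slice_near]. *)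
Let iint_main n B : 0 <= B ->
  (forall a (f g : 'rV[R]_n -> R), csupp B f -> csupp B g ->
    iint (fun x => a * f x + g x) = a * iint f + iint g) /\
  (forall (g : 'rV[R]_n -> R) M, csupp B g -> (forall x, `|g x| <= M) ->
    `|iint g| <= (2 * B) ^+ n * M) /\
  (forall g : 'rV[R]_n.+1 -> R, csupp B g -> csupp1 B (fun t => iint (slice t g))).
Proof.
move=> B0; elim: n => [|n [IHl [IHb IHc]]].
  split=> [//|]; split=> [g M _ gM|g sg]; first by rewrite expr0 mul1r; exact: gM.
  split=> [t|t Bt]; last by rewrite (slice_out sg).
  apply/cvgrPdist_le => e e0; have := slice_near t sg e0; apply: filterS => s /=.
  by move=> /(_ 0); rewrite distrC.
have lin a (f g : 'rV[R]_n.+1 -> R) : csupp B f -> csupp B g ->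
    iint (fun x => a * f x + g x) = a * iint f + iint g.
  move=> sf sg; rewrite !iintS -(Rintegral_linear _ (IHc _ sf) (IHc _ sg)).
  by apply: eq_Rintegral => t _; rewrite -IHl//; exact: slice_csupp.
have bnd (g : 'rV[R]_n.+1 -> R) M : csupp B g -> (forall x, `|g x| <= M) ->
    `|iint g| <= (2 * B) ^+ n.+1 * M.
  move=> sg gM; rewrite iintS exprS -mulrA.
  apply: (Rintegral_bound B0 (IHc _ sg)) => t; apply: IHb.
    exact: slice_csupp.
  by move=> y; exact: gM.
split=> //; split=> // g sg; split=> [t|t Bt]; last by rewrite (slice_out sg)// iint0.
apply/cvgrPdist_le => e e0.
(* Adding 1 keeps the divisor of e positive even when B = 0. *)
pose C := (2 * B) ^+ n.+1 + 1.
have C0 : 0 < C by rewrite /C ltr_wpDl// exprn_ge0// mulr_ge0.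
have := slice_near t sg (divr_gt0 e0 C0); apply: filterS => s /= H.
have -> : iint (slice t g) - iint (slice s g) =
    - (iint (fun y => -1 * slice t g y + slice s g y)).
  by rewrite lin; [ring|exact: slice_csupp|exact: slice_csupp].
rewrite normrN; apply: (le_trans (bnd _ (e / C) _ _)).
- by apply: csupp_linear; exact: slice_csupp.
- by move=> y; rewrite mulN1r addrC; exact: H.
- rewrite mulrA ler_pdivrMr// mulrC ler_wpM2l ?(ltW e0)//.
  by rewrite /C lerDl.
Qed.

Lemma csupp_le n B C (g : 'rV[R]_n -> R) : B <= C -> csupp B g -> csupp C g.
Proof. by move=> BC [cg g0]; split=> // x i Cx; apply: (g0 x i); exact: le_lt_trans Cx. Qed.

Lemma iint_linear n B a (f g : 'rV[R]_n -> R) : csupp B f -> csupp B g ->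
  iint (fun x => a * f x + g x) = a * iint f + iint g.
Proof.
move=> sf sg; have [] := @iint_main n (Num.max B 0); first by rewrite le_max lexx orbT.
move=> + _.
have BB : B <= Num.max B 0 by rewrite le_max lexx.
by apply; [exact: csupp_le BB sf|exact: csupp_le BB sg].
Qed.


Lemma iint_bound n B (g : 'rV[R]_n -> R) M : 0 <= B -> csupp B g ->
  (forall x, `|g x| <= M) -> `|iint g| <= (2 * B) ^+ n * M.
Proof. by move=> B0; have [_ [+ _]] := @iint_main n B B0; apply. Qed.

Lemma iint_slice_csupp1 n B (g : 'rV[R]_n.+1 -> R) : 0 <= B -> csupp B g ->
  csupp1 B (fun t => iint (slice t g)).
Proof. by move=> B0; have [_ [_ +]] := @iint_main n B B0; apply. Qed.

(** The two difference quotients coincide, because phi maps the line through z in direction v to the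
    line through [phi z] in direction w. *)
Lemma affine_derive (V W : normedModType R) (f : W -> R) (phi : V -> W) z v w :
  (forall h : R, phi (h *: v + z) = h *: w + phi z) ->
  (derivable (f \o phi) z v = derivable f (phi z) w) *
  ('D_v (f \o phi) z = 'D_w f (phi z)).
Proof. by move=> H; split; rewrite ?/derivable ?/derive/=; under eq_fun do rewrite H. Qed.

Lemma slice_affineS n t (y : 'rV[R]_n) j (h : R) :
  row_mx (t%:M : 'rV[R]_1) (h *: delta_mx 0 j + y) =
  h *: delta_mx 0 (lift 0 j) + row_mx (t%:M : 'rV[R]_1) y :> 'rV[R]_n.+1.
Proof.
apply/rowP => k; case: (unliftP 0 k) => [i|] ->.
  by rewrite slice_coordS [RHS]mxE slice_coordS !mxE/= (inj_eq lift_inj).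
by rewrite slice_coord0 [RHS]mxE slice_coord0 !mxE/= mulr0 add0r.
Qed.

Lemma slice_affine0 n t (y : 'rV[R]_n) (h : R) :
  row_mx ((h *: (1 : R^o) + t)%:M : 'rV[R]_1) y =
  h *: delta_mx 0 0 + row_mx (t%:M : 'rV[R]_1) y :> 'rV[R]_n.+1.
Proof.
apply/rowP => k; case: (unliftP 0 k) => [i|] ->.
  by rewrite slice_coordS [RHS]mxE slice_coordS !mxE/= mulr0 add0r.
by rewrite slice_coord0 [RHS]mxE slice_coord0 !mxE/= mulr1 [h *: 1]mulr1.
Qed.

Lemma pd_slice n t (g : 'rV[R]_n.+1 -> R) j : pd j (slice t g) = slice t (pd (lift 0 j) g).
Proof.
apply/funext => y; rewrite /pd/slice.
by rewrite (affine_derive g (fun h => slice_affineS t y j h)).2.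
Qed.

Lemma slice_is_derive n t (y : 'rV[R]_n) (g : 'rV[R]_n.+1 -> R) :
  (forall x, differentiable g x) ->
  is_derive t (1 : R) (fun s => slice s g y) (slice t (pd 0 g) y).
Proof.
move=> dg.
have [E1 E2] := @affine_derive _ _ g (fun s => row_mx (s%:M : 'rV[R]_1) y) t 1 _
  (slice_affine0 t y).
by split; [rewrite E1; exact: diff_derivable|exact: E2].
Qed.

Lemma slice_differentiable n t (g : 'rV[R]_n.+1 -> R) :
  (forall x, differentiable g x) -> forall y, differentiable (slice t g) y.
Proof.
move=> dg y.
apply: (@differentiable_comp _ _ _ _ (fun y => row_mx (t%:M : 'rV[R]_1) y : 'rV[R]_n.+1) g) => //.
apply: row_differentiable => j; case: (unliftP 0 j) => [i|] ->.
  by under eq_fun do rewrite slice_coordS; exact: differentiable_coord.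
by under eq_fun do rewrite slice_coord0; exact: differentiable_cst.
Qed.

Lemma open_gt_coord n B (i : 'I_n) : open [set x : 'rV[R]_n | B < `|x 0 i|].
Proof.
apply: (@open_comp _ _ (fun x : 'rV[R]_n => `|x 0 i|) [set t | B < t]).
  move=> x _; apply: continuous_comp; first exact: coord_continuous.
  exact: norm_continuous.
exact: open_gt.
Qed.

Lemma pd_csupp n B (g : 'rV[R]_n -> R) i : csupp B g -> continuous (pd i g) ->
  csupp B (pd i g).
Proof.
move=> [_ g0] cdg; split=> // x j Bx.
have gE (y : 'rV[R]_n) : B < `|y 0 j| -> g y = cst 0 y by move=> By; exact: g0 By.
by rewrite (eq_pd i (@open_gt_coord n B j) gE Bx) /pd derive_cst.
Qed.

Lemma iint_sliceB n B s t (g : 'rV[R]_n.+1 -> R) : csupp B g ->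
  iint (slice s g) - iint (slice t g) = iint (fun y => slice s g y - slice t g y).
Proof.
move=> sg; have -> : iint (fun y => slice s g y - slice t g y) =
    iint (fun y => -1 * slice t g y + slice s g y).
  by congr iint; apply/funext => y; rewrite mulN1r addrC.
by rewrite (@iint_linear _ B); [rewrite mulN1r addrC|exact: slice_csupp..].
Qed.

(** Differentiation under the integral sign. By the mean value theorem the difference quotient of
    the slices is the value of [pd 0 g] on a slice near t, so by [slice_near] it is uniformly close
    to its limit, and [iint_bound] carries the estimate through the integral. *)
Lemma iint_slice_is_derive n B t (g : 'rV[R]_n.+1 -> R) : 0 <= B ->
  (forall x, differentiable g x) -> continuous (pd 0 g) -> csupp B g ->
  is_derive t (1 : R) (fun s => iint (slice s g)) (iint (slice t (pd 0 g))).
Proof.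
move=> B0 dg cdg sg; have sdg := pd_csupp sg cdg.
pose C := (2 * B) ^+ n + 1.
have C0 : 0 < C by rewrite /C ltr_wpDl// exprn_ge0// mulr_ge0.
suff H : h^-1 *: (iint (slice (h *: 1 + t) g) - iint (slice t g)) @[h --> (0 : R)^'] -->
    iint (slice t (pd 0 g)).
  split; first by apply/cvg_ex; exists (iint (slice t (pd 0 g))).
  exact/cvg_lim.
apply/cvgrPdist_le => e e0.
have [d /= d0 dP] := slice_near t sdg (divr_gt0 e0 C0).
exists d => //= h /=; rewrite sub0r normrN => hd h0.
rewrite (iint_sliceB _ _ sg).
have dquot y : `|slice (h *: 1 + t) g y - slice t g y - h * slice t (pd 0 g) y| <=
    `|h| * (e / C).
  have [c cin ->] : exists2 c, `|t - c| < d &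
      slice (h *: 1 + t) g y - slice t g y = slice c (pd 0 g) y * h.
    have cg : continuous (fun s => slice s g y).
      move=> s; apply: differentiable_continuous; apply/derivable1_diffP.
      by have [] := slice_is_derive s y dg.
    rewrite [h *: 1]mulr1; have [h_gt0|h_le0] := ltP 0 h.
      have [|||c] := @MVT_segment _ (fun s => slice s g y) (fun s => slice s (pd 0 g) y) t (h + t).
      - by rewrite lerDr ltW.
      - by move=> s _; exact: slice_is_derive.
      - exact: continuous_subspaceT.
      rewrite in_itv/= addrK => /andP[c1 c2] E; exists c => //.
      by rewrite (le_lt_trans _ hd)// (gtr0_norm h_gt0) ler_norml; lra.
    have [|||c] := @MVT_segment _ (fun s => slice s g y) (fun s => slice s (pd 0 g) y) (h + t) t.
    - by rewrite gerDr.
    - by move=> s _; exact: slice_is_derive.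
    - exact: continuous_subspaceT.
    rewrite in_itv/= => /andP[c1 c2] E; exists c.
      by rewrite (le_lt_trans _ hd)// (ler0_norm h_le0) ler_norml; lra.
    by rewrite -opprB E; ring.
  rewrite [X in X - _]mulrC -mulrBr normrM ler_wpM2l//.
  by apply: dP; rewrite /ball_/=.
have -> : iint (slice t (pd 0 g)) - h^-1 *: iint (fun y => slice (h *: 1 + t) g y - slice t g y) =
    - h^-1 * iint (fun y => - h * slice t (pd 0 g) y + (slice (h *: 1 + t) g y - slice t g y)).
  rewrite (@iint_linear _ B); last 2 first.
  - exact: slice_csupp.
  - have := csupp_linear (-1) (slice_csupp t sg) (slice_csupp (h *: 1 + t) sg).
    by congr csupp; apply/funext => y; rewrite mulN1r addrC.
  rewrite mulrDr mulrA mulrNN mulVf// mul1r; congr (_ + _).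
  by rewrite /GRing.scale/= mulNr.
rewrite normrM normrN normfV ler_pdivrMl ?normr_gt0//.
apply: (@le_trans _ _ ((2 * B) ^+ n * (`|h| * (e / C)))); last first.
  rewrite mulrCA ler_wpM2l// mulrA ler_pdivrMr// mulrC ler_wpM2l ?(ltW e0)//.
  by rewrite /C lerDl.
apply: iint_bound => //; last by move=> y; rewrite mulNr addrC; exact: dquot.
apply: csupp_linear; first exact: slice_csupp.
have := csupp_linear (-1) (slice_csupp t sg) (slice_csupp (h *: 1 + t) sg).
by congr csupp; apply/funext => y; rewrite mulN1r addrC.
Qed.

(** In the first coordinate, t |-> [iint (slice t g)] is a primitive that vanishes for large |t|.
    The other coordinates are treated inside each slice by induction. *)
Lemma iint_pd n B (g : 'rV[R]_n -> R) i : 0 <= B ->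
  (forall x, differentiable g x) -> continuous (pd i g) -> csupp B g ->
  iint (pd i g) = 0.
Proof.
move=> B0; elim: n g i => [g []//|n IH] g i dg cdg sg; rewrite iintS.
have sdg := pd_csupp sg cdg.
case: (unliftP 0 i) => [j|] ij.
  rewrite (@eq_Rintegral _ _ _ _ _ (fun=> 0)); first by rewrite Rintegral_cst// mul0r.
  move=> t _; rewrite ij -pd_slice; apply: IH.
  - exact: slice_differentiable.
  - by rewrite pd_slice -ij; exact: (slice_csupp t sdg).1.
  - exact: slice_csupp.
rewrite ij in cdg sdg *.
apply: (Rintegral_derive0 B0 (iint_slice_csupp1 B0 sdg) (F := fun t => iint (slice t g))).
- by move=> t; exact: (iint_slice_is_derive t B0).
- by move=> t Bt; rewrite (slice_out sg)// iint0.
Qed.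

Lemma iint_ge0 n (g : 'rV[R]_n -> R) : (forall x, 0 <= g x) -> 0 <= iint g.
Proof.
elim: n g => [|n IH] g g0; first exact: g0.
by rewrite iintS; apply: Rintegral_ge0 => t _; apply: IH => y; exact: g0.
Qed.

Lemma iint_eq0 n B (g : 'rV[R]_n -> R) : 0 <= B -> csupp B g ->
  (forall x, 0 <= g x) -> iint g = 0 -> forall x, g x = 0.
Proof.
move=> B0; elim: n g => [|n IH] g sg g0 Ig x.
  by rewrite (_ : x = 0) //; apply/rowP => -[].
have H := Rintegral_ge0_eq0 (iint_slice_csupp1 B0 sg)
  (fun t => iint_ge0 (fun y => g0 _)) Ig.
have := IH _ (slice_csupp (x 0 0) sg) (fun y => g0 _) (H _) (\row_j x 0 (lift 0 j)).
congr (_ = 0); congr g; apply/rowP => k; case: (unliftP 0 k) => [i|] ->.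
  by rewrite slice_coordS mxE.
by rewrite slice_coord0.
Qed.

End IteratedIntegral.

(** * Bump functions and integration by parts *)

Section FlatFunction.
Variable R : realType.
Implicit Types (p : {poly R}) (t y : R).

Lemma exprn_expRN_bound k : exists C : R, forall y, 0 <= y -> y ^+ k * expR (- y) <= C.
Proof.
case: k => [|k].
  by exists 1 => y y0; rewrite expr0 mul1r -expR0 ler_expR oppr_le0.
(* With y = (k+1) z the product is (k+1)^(k+1) (z exp(-z))^(k+1), and z <= 1 + z <= exp z. *)
exists (k.+1%:R ^+ k.+1) => y y0.
have k0 : (0 : R) < k.+1%:R by rewrite ltr0n.
have -> : y = k.+1%:R * (y / k.+1%:R) by rewrite mulrCA divff ?mulr1// gt_eqF.
set z := y / _; have z0 : 0 <= z by rewrite divr_ge0// ltW.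
rewrite exprMn -mulrN expRM_natl -mulrA ler_piMr ?exprn_ge0//.
rewrite -exprMn; apply: exprn_ile1; first by rewrite mulr_ge0// expR_ge0.
rewrite expRN ler_pdivrMr ?expR_gt0// mul1r.
by apply: le_trans (expR_ge1Dx z); rewrite lerDr.
Qed.

Lemma poly_expRN_bound p : exists C : R, forall y, 0 <= y -> `|p.[y]| * expR (- y) <= C.
Proof.
have /choice[C HC] := exprn_expRN_bound.
exists (\sum_(i < size p) `|p`_i| * C i) => y y0.
rewrite horner_coef.
apply: (@le_trans _ _ ((\sum_(i < size p) `|p`_i * y ^+ i|) * expR (- y))).
  by rewrite ler_wpM2r ?expR_ge0// ler_norm_sum.
rewrite mulr_suml ler_sum// => i _.
by rewrite normrM -mulrA ler_wpM2l// ger0_norm ?exprn_ge0//; exact: HC.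
Qed.

Lemma is_derive_comp1 (f g : R -> R) (x df dg : R) : is_derive x (1 : R) f df ->
  is_derive (f x) (1 : R) g dg -> is_derive x (1 : R) (g \o f) (dg * df).
Proof.
move=> [d1 <-] [d2 <-]; split.
  by apply/derivable1_diffP; apply: differentiable_comp; exact/derivable1_diffP.
by rewrite -derive1E derive1_comp// !derive1E.
Qed.

(** For p = 1 this is the classical exp(-1/t). The polynomial factor in 1/t makes the family closed
    under differentiation. *)
Definition flat p t : R := if 0 < t then p.[t^-1] * expR (- t^-1) else 0.

(** With y = 1/t one has dy/dt = - y^2, so p(y) exp(-y) has derivative y^2 (p - p')(y) exp(-y). *)
Definition flat_next p : {poly R} := 'X^2 * (p - p^`()).

Lemma flat_is_derive p t : is_derive t (1 : R) (flat p) (flat (flat_next p) t).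
Proof.
have [t_gt0|t_lt0|<-] := ltgtP 0 t.
- have dinv : is_derive t (1 : R) (fun s : R => s^-1) (- (t ^- 2)).
    apply: is_derive_eq.
      by apply: is_deriveV; rewrite gt_eqF.
    by rewrite /GRing.scale/= mulr1.
  have near_flat : {near t, (fun s : R => p.[s^-1] * expR (- s^-1)) =1 flat p}.
    near=> s; rewrite /flat ifT//; near: s; exact: lt_nbhsr.
  apply: (near_eq_is_derive near_flat).
  have dh : is_derive t (1 : R) (fun s : R => p.[s^-1]) (- (t ^- 2) * p^`().[t^-1]).
    have d1 : is_derive (t^-1) (1 : R) (horner p) p^`().[t^-1].
      by split; [exact: derivable_horner|rewrite -derive1E -derivE].
    by rewrite mulrC; exact: (is_derive_comp1 dinv d1).
  have de : is_derive t (1 : R) (fun s : R => expR (- s^-1)) (t ^- 2 * expR (- t^-1)).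
    have d1 : is_derive t (1 : R) (fun s : R => - s^-1) (t ^- 2).
      by apply: is_derive_eq; rewrite opprK.
    by rewrite mulrC; exact: (is_derive_comp1 d1 (is_derive_expR _)).
  apply: is_derive_eq.
  rewrite /flat t_gt0 /flat_next !hornerE /GRing.scale/= exprVn; ring.
- have near_flat : {near t, cst (0 : R) =1 flat p}.
    near=> s; rewrite /flat ifF//; apply/negbTE; rewrite -leNgt ltW//.
    by near: s; exact: lt_nbhsl.
  apply: (near_eq_is_derive near_flat).
  apply: is_derive_eq; by rewrite /flat ifF//; apply/negbTE; rewrite -leNgt ltW.
(* At t = 0 the difference quotient for h > 0 is h y^2 p(y) exp(-y) with y = 1/h; the factor after h
   is bounded, so the quotient is O(h). *)
have [C HC] := poly_expRN_bound ('X^2 * p).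
pose D := `|C| + 1.
have D0 : 0 < D by rewrite /D ltr_wpDl.
have E0 : flat (flat_next p) 0 = 0 by rewrite /flat ltxx.
suff H : h^-1 *: (flat p (h *: 1 + 0) - flat p 0) @[h --> (0 : R)^'] --> (0 : R).
  by split; [apply/cvg_ex; exists 0|rewrite E0; exact/cvg_lim].
apply/cvgrPdist_le => e e0; exists (e / D); first by rewrite /= divr_gt0.
move=> h /=; rewrite !sub0r !normrN => hd h0.
rewrite /flat ltxx subr0 addr0 [h *: 1]mulr1; case: ifPn => [h_gt0|_]; last first.
  by rewrite scaler0 normr0 ltW.
rewrite gtr0_norm// in hd.
have -> : h^-1 *: (p.[h^-1] * expR (- h^-1)) =
    h * (('X^2 * p).[h^-1] * expR (- h^-1)).
  by rewrite !hornerE /GRing.scale/=; field; rewrite gt_eqF.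
rewrite normrM gtr0_norm// normrM (gtr0_norm (expR_gt0 _)).
apply: (@le_trans _ _ (h * D)); last by rewrite -ler_pdivlMr// ltW.
rewrite ler_wpM2l ?(ltW h_gt0)//; apply: (le_trans (HC _ _)).
  by rewrite invr_ge0 ltW.
by rewrite /D (le_trans (ler_norm _))// lerDl.
Unshelve. all: by end_near. Qed.

Lemma smooth_on_flat n (U : set 'rV[R]_n) (f : 'rV[R]_n -> R) :
  open U -> smooth_on U f -> smooth_on U (fun x => flat 1 (f x)).
Proof.
move=> Uo fs.
by apply: (@smooth_on_comp1 _ _ _ _ setT (fun k => flat (iter k flat_next 1))) => // k t _;
  exact: flat_is_derive.
Qed.

Lemma flat_ge0 t : 0 <= flat 1 t.
Proof. by rewrite /flat; case: ifP => // _; rewrite hornerC mul1r expR_ge0. Qed.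

Lemma flat_gt0 t : 0 < t -> 0 < flat 1 t.
Proof. by move=> t0; rewrite /flat t0 hornerC mul1r expR_gt0. Qed.

Lemma flat_eq0 t : t <= 0 -> flat 1 t = 0.
Proof. by rewrite /flat ltNge => ->. Qed.

Definition smooth_step t := flat 1 t / (flat 1 t + flat 1 (1 - t)).

Lemma smooth_step_den t : 0 < flat 1 t + flat 1 (1 - t).
Proof.
have [t0|t0] := ltP 0 t; first by rewrite ltr_wpDr ?flat_ge0 ?flat_gt0.
by rewrite ltr_wpDl ?flat_ge0// flat_gt0// subr_gt0; lra.
Qed.

Lemma smooth_step_ge0 t : 0 <= smooth_step t.
Proof. by rewrite divr_ge0 ?flat_ge0// ltW// smooth_step_den. Qed.

Lemma smooth_step0 t : t <= 0 -> smooth_step t = 0.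
Proof. by move=> t0; rewrite /smooth_step flat_eq0// mul0r. Qed.

Lemma smooth_step1 t : 1 <= t -> smooth_step t = 1.
Proof.
move=> t1; have := smooth_step_den t; rewrite /smooth_step (@flat_eq0 (1 - t)); last by lra.
by rewrite addr0 => /lt0r_neq0 ?; rewrite divff.
Qed.

Lemma smooth_on_step n (U : set 'rV[R]_n) (f : 'rV[R]_n -> R) :
  open U -> smooth_on U f -> smooth_on U (fun x => smooth_step (f x)).
Proof.
move=> Uo fs; apply: (smooth_onM Uo (smooth_on_flat Uo fs)).
apply: smooth_onV => //; last by move=> x _; rewrite gt_eqF// smooth_step_den.
apply: (smooth_onD Uo (smooth_on_flat Uo fs)); apply: smooth_on_flat => //.
by apply: (@smooth_onB _ _ _ (cst 1)) => //; exact: smooth_on_cst.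
Qed.

End FlatFunction.

Section EuclideanBump.
Variables (R : realType) (n : nat).

Lemma euclidean_bump (a : 'rV[R]_n) (V : set 'rV[R]_n) : nbhs a V ->
  exists phi : 'rV[R]_n -> R, [/\ smooth_on setT phi, (forall x, 0 <= phi x),
    (\forall x \near a, phi x = 1) &
    exists K, [/\ compact K, K `<=` V & forall x, ~ K x -> phi x = 0]].
Proof.
(* The support of phi will lie in the box of half-width 2 r = e / 2, strictly inside the ball of
   radius e. *)
move=> /nbhs_ballP[e /= e0 eV]; pose r := e / 4.
have r0 : 0 < r by rewrite /r divr_gt0.
(* Squaring avoids the non-smooth absolute value. The argument of the step is at least 1 when the
   i-th distance is at most r, and negative when it is at least 2 r. *)
pose phi (x : 'rV[R]_n) := \prod_(i < n) smooth_step (2 - ((x 0 i - a 0 i) / r) ^+ 2).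
exists phi; split.
- apply: smooth_on_prod; first exact: openT.
  move=> i; apply: smooth_on_step; first exact: openT.
  apply: (@smooth_onB _ _ _ (cst 2)); [exact: openT|exact: smooth_on_cst|].
  have s1 : smooth_on setT (fun x : 'rV[R]_n => (x 0 i - a 0 i) / r).
    apply: (smooth_onM openT (f := (fun x : 'rV[R]_n => x 0 i - a 0 i)) (g := cst r^-1)).
      apply: (@smooth_onB _ _ _ (fun x : 'rV[R]_n => x 0 i) (cst _)); first exact: openT.
        exact: smooth_on_coord.
      exact: smooth_on_cst.
    exact: smooth_on_cst.
  exact: (smooth_onM openT s1 s1).
- by move=> x; rewrite prodr_ge0// => i _; exact: smooth_step_ge0.
- apply/nbhs_ballP; exists r => // x [_ ax].
  rewrite /phi big1// => i _; rewrite smooth_step1//.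
  have := ax 0 i; rewrite /ball/= distrC => /ltW.
  rewrite -[X in _ <= X]mul1r -(ler_pdivrMr _ _ r0).
  set z := (X in _ - X ^+ 2).
  have -> : `|x 0 i - a 0 i| / r = `|z|.
    by rewrite normrM (gtr0_norm (_ : 0 < r^-1))// invr_gt0.
  move=> z1; have : `|z| ^+ 2 <= 1 by apply: exprn_ile1.
  by rewrite real_normK ?num_real//; lra.
- exists [set x : 'rV[R]_n | forall i, `[a 0 i - 2 * r, a 0 i + 2 * r]%classic (x ord0 i)]; split.
  + by apply: (@rV_compact R n (fun i => `[a 0 i - 2 * r, a 0 i + 2 * r]%classic)) => i;
      exact: segment_compact.
  + move=> x /= Hx; apply: eV; split => // j i; rewrite ord1.
    have := Hx i; rewrite in_itv/= /ball/= => /andP[x1 x2].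
    by rewrite ltr_norml; rewrite /r in x1 x2; lra.
  + move=> x /existsNP[i] /=; rewrite in_itv/= => /negP.
    rewrite -lter_distl -ltNge => Hi.
    apply/eqP; rewrite prodf_seq_eq0; apply/hasP; exists i; first by rewrite mem_index_enum.
    rewrite /= smooth_step0// -(real_normK (num_real _)) normrM normfV (gtr0_norm r0) subr_le0.
    have h2 : 2 <= `|x 0 i - a 0 i| / r by rewrite ler_pdivlMr// ltW.
    have : 2 * 2 <= (`|x 0 i - a 0 i| / r) ^+ 2 by rewrite expr2 ler_pM.
    by lra.
Qed.

End EuclideanBump.

(** * Extension by zero and integration by parts on open sets *)

Section IntegrationByParts.
Variables (R : realType) (n : nat).
Implicit Types (U K : set 'rV[R]_n) (f g w : 'rV[R]_n -> R).

Definition ext0 U w : 'rV[R]_n -> R := fun x => if `[< U x >] then w x else 0.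

Definition vanish_off U K f := forall x, U x -> ~ K x -> f x = 0.

Lemma ext0_in U w x : U x -> ext0 U w x = w x.
Proof. by move=> Ux; rewrite /ext0 asboolT. Qed.

Lemma ext0_out U w x : ~ U x -> ext0 U w x = 0.
Proof. by move=> Ux; rewrite /ext0 asboolF. Qed.

Lemma eq_ext0 U f g : (forall x, U x -> f x = g x) -> ext0 U f = ext0 U g.
Proof.
by move=> fg; apply/funext => x; rewrite /ext0; case: ifPn => // /asboolP; exact: fg.
Qed.

Lemma row_compact_closed K : compact K -> closed K.
Proof. by move=> cK; apply: compact_closed => //; exact: norm_hausdorff. Qed.

Lemma vanish_offMl U K f g : vanish_off U K f -> vanish_off U K (f * g).
Proof. by move=> f0 x Ux Kx; rewrite fctE f0// mul0r. Qed.

Lemma vanish_offMr U K f g : vanish_off U K g -> vanish_off U K (f * g).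
Proof. by move=> f0 x Ux Kx; rewrite fctE f0// mulr0. Qed.

Lemma vanish_off_pd U K f i : open U -> compact K -> vanish_off U K f ->
  vanish_off U K (pd i f).
Proof.
move=> Uo cK f0 x Ux Kx.
have UKo : open (U `&` ~` K).
  by apply: openI => //; apply: closed_openC; exact: row_compact_closed.
have fE (y : 'rV[R]_n) : (U `&` ~` K) y -> f y = cst 0 y by move=> [Uy Ky]; exact: f0.
by rewrite (eq_pd i UKo fE) // /pd derive_cst.
Qed.

Lemma vanish_off_pder U K f s : open U -> compact K -> vanish_off U K f ->
  vanish_off U K (pder s f).
Proof.
by move=> Uo cK; elim: s f => //= i s IH f f0; apply: IH; exact: (vanish_off_pd i Uo cK f0).
Qed.

Lemma ext0_out_compact U K w x : vanish_off U K w -> ~ K x -> ext0 U w x = 0.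
Proof.
move=> w0 Kx; have [Ux|Ux] := pselect (U x); last exact: ext0_out.
by rewrite ext0_in// w0.
Qed.

(** U and the complement of the closed set K cover the space; the extension is w on the first and 0
    on the second. *)
Lemma smooth_on_ext0 U K w : open U -> compact K -> K `<=` U -> smooth_on U w ->
  vanish_off U K w -> smooth_on setT (ext0 U w).
Proof.
move=> Uo cK KU ws w0; apply: smooth_on_local => x _.
have [Ux|Ux] := pselect (U x).
  exists U => //; apply: eq_smooth_on ws => // y Uy; exact/esym/ext0_in.
have KCo : open (~` K) by apply: closed_openC; exact: row_compact_closed.
exists (~` K); first by split => // /KU.
by apply: (@eq_smooth_on _ _ _ (cst 0)) => // [y Ky|];
  [rewrite (ext0_out_compact w0)|exact: smooth_on_cst].
Qed.

Lemma ext0_csupp U K w : open U -> compact K -> K `<=` U -> smooth_on U w ->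
  vanish_off U K w -> forall C, (forall x i, K x -> `|x 0 i| <= C) -> csupp C (ext0 U w).
Proof.
move=> Uo cK KU ws w0 C KC; split.
  move=> x; apply: (@smooth_on_continuous _ _ setT) => //.
  exact: (smooth_on_ext0 Uo cK KU ws w0).
by move=> x i Cx; apply: (ext0_out_compact w0) => Kx; have := KC _ i Kx; rewrite leNgt Cx.
Qed.

Lemma compact_coord_bound K : compact K ->
  exists2 C : R, 0 <= C & forall x i, K x -> `|x 0 i| <= C.
Proof.
move=> /compact_bounded[M [_ HM]]; exists (`|M| + 1); first by rewrite addr_ge0.
move=> x i Kx.
have := HM (`|M| + 1) _ x Kx; rewrite (le_lt_trans (ler_norm M)) ?ltrDl// => /(_ isT).
apply: le_trans; rewrite [leRHS]/Num.Def.normr/= mx_normrE.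
exact: (le_bigmax _ (fun ij : 'I_1 * 'I_n => `|x ij.1 ij.2|) (0, i)).
Qed.

Lemma iint_ext0_linear U K a f g : open U -> compact K -> K `<=` U ->
  smooth_on U f -> smooth_on U g -> vanish_off U K f -> vanish_off U K g ->
  iint (ext0 U (fun x => a * f x + g x)) = a * iint (ext0 U f) + iint (ext0 U g).
Proof.
move=> Uo cK KU fs gs f0 g0; have [C C0 KC] := compact_coord_bound cK.
rewrite -(iint_linear a (ext0_csupp Uo cK KU fs f0 KC) (ext0_csupp Uo cK KU gs g0 KC)).
congr iint; apply/funext => x; rewrite /ext0; case: ifP => //.
by rewrite mulr0 addr0.
Qed.

Lemma iint_ext0_pd U K w i : open U -> compact K -> K `<=` U -> smooth_on U w ->
  vanish_off U K w -> iint (ext0 U (pd i w)) = 0.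
Proof.
move=> Uo cK KU ws w0; have [C C0 KC] := compact_coord_bound cK.
have es := smooth_on_ext0 Uo cK KU ws w0.
have -> : ext0 U (pd i w) = pd i (ext0 U w).
  apply/funext => x; have [Ux|Ux] := pselect (U x).
    by rewrite ext0_in//; apply: (eq_pd i Uo) => // y Uy; rewrite ext0_in.
  rewrite ext0_out//.
  have e0 : vanish_off setT K (ext0 U w) by move=> y _; exact: ext0_out_compact.
  by rewrite (vanish_off_pd i openT cK e0)// => /KU.
apply: (iint_pd C0).
- by move=> x; exact: (smooth_on_differentiable es).
- by move=> x; exact: (smooth_on_continuous (smooth_on_pd i es)).
- exact: (ext0_csupp Uo cK KU ws w0 KC).
Qed.

(** Compact support of one factor suffices for the boundary terms to vanish. The word is reversed
    because the derivative applied last is the first to be moved over. *)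
Lemma iint_by_parts U K f w s : open U -> compact K -> K `<=` U ->
  smooth_on U f -> smooth_on U w -> vanish_off U K f \/ vanish_off U K w ->
  iint (ext0 U (pder s f * w)) = (-1) ^+ size s * iint (ext0 U (f * pder (rev s) w)).
Proof.
move=> Uo cK KU fs ws; elim: s f fs => [|i s IH] f fs fw0 /=.
  by rewrite expr0 mul1r.
have fw0' : vanish_off U K (pd i f) \/ vanish_off U K w.
  by case: fw0 => [f0|]; [left; exact: vanish_off_pd|right].
rewrite (IH _ (smooth_on_pd i fs) fw0') exprS mulN1r mulNr -mulrN; congr (_ * _).
rewrite rev_cons pder_rcons.
set v := pder (rev s) w; have vs : smooth_on U v by exact: smooth_on_pder.
have fv0 : vanish_off U K f \/ vanish_off U K v.
  by case: fw0 => [|w0]; [left|right; exact: vanish_off_pder].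
have K1 : vanish_off U K (v * pd i f).
  case: fv0 => [f0|v0]; last exact: vanish_offMl.
  by apply: vanish_offMr; exact: vanish_off_pd.
have K2 : vanish_off U K (f * pd i v).
  case: fv0 => [f0|v0]; first exact: vanish_offMl.
  by apply: vanish_offMr; exact: vanish_off_pd.
have K3 : vanish_off U K (f * v).
  by case: fv0 => [f0|v0]; [exact: vanish_offMl|exact: vanish_offMr].
have := iint_ext0_pd i Uo cK KU (smooth_onM Uo fs vs) K3.
have -> : ext0 U (pd i (f * v)) =
    ext0 U (fun x => 1 * (f * pd i v) x + (v * pd i f) x).
  by apply: eq_ext0 => x Ux; rewrite mul1r (pdM i fs vs Ux).
rewrite (iint_ext0_linear _ Uo cK KU _ _ K2 K1); last 2 first.
- by apply: smooth_onM => //; exact: smooth_on_pd.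
- by apply: smooth_onM => //; exact: smooth_on_pd.
by rewrite mul1r addrC => /eqP; rewrite addr_eq0 mulrC => /eqP.
Qed.

Lemma iint_ext0_eq0 U K w : open U -> compact K -> K `<=` U -> smooth_on U w ->
  vanish_off U K w -> (forall x, U x -> 0 <= w x) -> iint (ext0 U w) = 0 ->
  forall x, U x -> w x = 0.
Proof.
move=> Uo cK KU ws w0 w_ge0 I0 x Ux; have [C C0 KC] := compact_coord_bound cK.
rewrite -(ext0_in w Ux).
apply: (iint_eq0 C0 (ext0_csupp Uo cK KU ws w0 KC)) => // y.
by rewrite /ext0; case: ifPn => // /asboolP; exact: w_ge0.
Qed.

End IntegrationByParts.

(** * Functions with compact support on a manifold *)

Section CinfEval.
Variables (R : realType) (n : nat) (M : manifold R n).
Implicit Types (f g : Cinf M) (p : M).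

Lemma Cinf_ext f g : (forall p, f p = g p) -> f = g.
Proof. by move=> fg; apply: val_inj; apply/funext. Qed.

Lemma CinfDE f g p : (f + g) p = f p + g p. Proof. by []. Qed.
Lemma CinfNE f p : (- f) p = - f p. Proof. by []. Qed.
Lemma CinfBE f g p : (f - g) p = f p - g p. Proof. by []. Qed.
Lemma CinfME f g p : (f * g) p = f p * g p. Proof. by []. Qed.
Lemma CinfZE a f p : (a *: f) p = a * f p. Proof. by []. Qed.
Lemma Cinf0E p : (0 : Cinf M) p = 0. Proof. by []. Qed.
Lemma Cinf1E p : (1 : Cinf M) p = 1. Proof. by []. Qed.

Lemma Cinf_sumE (I : Type) (r : seq I) (P : pred I) (F : I -> Cinf M) p :
  (\sum_(i <- r | P i) F i) p = \sum_(i <- r | P i) F i p.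
Proof.
elim: r => [|i r IH]; first by rewrite !big_nil.
by rewrite !big_cons; case: (P i); rewrite ?CinfDE IH.
Qed.

Definition CinfE := (CinfDE, CinfNE, CinfBE, CinfME, CinfZE, Cinf0E, Cinf1E).

Lemma Cinf_smooth f : smooth_fun f.
Proof. by have /asboolP := CinfP f. Qed.

Lemma Cinf_of_smooth (G : M -> R) : smooth_fun G -> exists f : Cinf M, forall p, f p = G p.
Proof.
by move=> Gs; have Gp : G \in smooth_pred M; [exact/asboolP|exists (MkCinf Gp)].
Qed.

End CinfEval.

(** * Charts, compact supports and bump functions *)

Section Charts.
Variables (R : realType) (n : nat) (M : manifold R n).
Implicit Types (f g u v z : Cinf M) (p q : M) (c d : chart R M n) (K V : set M).

Lemma manifold_compact_closed K : compact K -> closed K.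
Proof. by move=> cK; apply: compact_closed => //; exact: manifold_hausdorff. Qed.

Lemma cimg_cinv c x : cimg c x -> cdom c (cinv c x) /\ cmap c (cinv c x) = x.
Proof. by move=> [p cp <-]; rewrite cmapK. Qed.

Lemma cmap_cimg c p : cdom c p -> cimg c (cmap c p).
Proof. by move=> cp; exists p. Qed.

Lemma open_cinv c V : open V -> open (cimg c `&` cinv c @^-1` V).
Proof.
move=> Vo; rewrite openE => x [cx Vx]; apply: filterI.
  exact: open_nbhs_nbhs (conj (open_cimg c) cx).
exact: (cinv_continuous cx) (open_nbhs_nbhs (conj Vo Vx)).
Qed.

Lemma coverlapE c d : coverlap c d = cimg c `&` cinv c @^-1` (cdom d).
Proof.
apply/seteqP; split=> [x [p [cp dp] <-]|x [/cimg_cinv[cx xE] dx]].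
  by split; [exact: cmap_cimg|rewrite /= cmapK].
by exists (cinv c x).
Qed.

(** On the overlap with another chart, smoothness is transported by the transition map. A point
    outside [cdom c] lies in the complement of K, which is open because M is Hausdorff, and G
    vanishes there. *)
Lemma smooth_fun_of_chart c K (G : M -> R) : atlas c -> compact K -> K `<=` cdom c ->
  smooth_on (cimg c) (G \o cinv c) -> (forall p, ~ K p -> G p = 0) -> smooth_fun G.
Proof.
move=> Ac cK Kc Gs G0 d Ad; apply: smooth_on_local => x dx.
have [cp|cp] := pselect (cdom c (cinv d x)).
  exists (coverlap d c).
    by rewrite coverlapE; split; [apply: open_cinv; exact: open_cdom|].
  have Wo : open (coverlap d c) by rewrite coverlapE; apply: open_cinv; exact: open_cdom.
  apply: (@eq_smooth_on _ _ _ ((G \o cinv c) \o transition d c)) => //.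
    move=> y; rewrite coverlapE => -[dy cy].
    by rewrite /transition /= cmapK.
  apply: (smooth_on_comp Wo (atlas_smooth Ad Ac) _ Gs) => y.
  by rewrite coverlapE => -[dy cy]; exact: cmap_cimg.
have KCo : open (~` K) by apply: closed_openC; exact: manifold_compact_closed.
exists (cimg d `&` cinv d @^-1` (~` K)).
  by split; [exact: open_cinv|split=> // /Kc].
apply: (@eq_smooth_on _ _ _ (cst 0)); first exact: open_cinv.
  by move=> y [_ Ky]; rewrite /= G0.
exact: smooth_on_cst.
Qed.

(* The support of u is compact and contained in V; the witness K may be larger
   than the support. *)
Definition csupp_in u V := exists K, [/\ compact K, K `<=` V & forall p, ~ K p -> u p = 0].

Lemma csupp_in_sub u V W : V `<=` W -> csupp_in u V -> csupp_in u W.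
Proof. by move=> VW [K [cK KV u0]]; exists K; split=> // p /KV/VW. Qed.

Lemma csupp_in_closure u V : csupp_in u V -> closure [set p | u p != 0] `<=` V.
Proof.
move=> [K [cK KV u0]]; apply: subset_trans KV.
rewrite (closure_id K).1; last exact: manifold_compact_closed.
by apply: closureS => p /= up; apply: contrapT => /u0 E; rewrite E eqxx in up.
Qed.

Lemma csupp_in_compact u V : csupp_in u V -> compactly_supported u.
Proof.
move=> [K [cK KV u0]]; apply: (subclosed_compact _ cK); first exact: closed_closure.
by apply: csupp_in_closure; exists K; split.
Qed.

Lemma compactly_supportedP u : compactly_supported u <-> csupp_in u setT.
Proof.
split=> [cu|]; last exact: csupp_in_compact.
exists (closure [set p | u p != 0]); split=> // p Hp; apply/eqP.
by apply: contrapT => /negP up; apply: Hp; exact: subset_closure.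
Qed.

Lemma csupp_inMl u v V : csupp_in u V -> csupp_in (u * v) V.
Proof.
by move=> [K [cK KV u0]]; exists K; split=> // p Kp; rewrite CinfE u0// mul0r.
Qed.

Lemma csupp_inMr u v V : csupp_in v V -> csupp_in (u * v) V.
Proof. by rewrite mulrC; exact: csupp_inMl. Qed.

Lemma csupp_inD u v V : csupp_in u V -> csupp_in v V -> csupp_in (u + v) V.
Proof.
move=> [K [cK KV u0]] [L [cL LV v0]]; exists (K `|` L); split.
- exact: compactU.
- by rewrite subUset.
by move=> p /not_orP[Kp Lp]; rewrite CinfE u0// v0// addr0.
Qed.

Lemma csupp_inZ a u V : csupp_in u V -> csupp_in (a *: u) V.
Proof.
by move=> [K [cK KV u0]]; exists K; split=> // p Kp; rewrite CinfE u0// mulr0.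
Qed.

Lemma csupp_in0 V : csupp_in (0 : Cinf M) V.
Proof. by exists set0; split=> //; exact: compact0. Qed.

Lemma csupp_in_sum (I : Type) (r : seq I) (F : I -> Cinf M) V :
  (forall i, csupp_in (F i) V) -> csupp_in (\sum_(i <- r) F i) V.
Proof.
move=> FV; elim: r => [|i r IH]; first by rewrite big_nil; exact: csupp_in0.
by rewrite big_cons; exact: csupp_inD.
Qed.

(** Turns a function known only in coordinates into a global one: multiplied by u, it can be
    extended by zero. *)
Lemma chart_ext c u (F : 'rV[R]_n -> R) : atlas c -> csupp_in u (cdom c) ->
  smooth_on (cimg c) F ->
  exists g, (forall p, cdom c p -> g p = u p * F (cmap c p)) /\
            (forall p, u p = 0 -> g p = 0).
Proof.
move=> Ac [K [cK Kc u0]] Fs.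
pose G p := if `[< cdom c p >] then u p * F (cmap c p) else 0.
have Gs : smooth_fun G.
  apply: (smooth_fun_of_chart Ac cK Kc).
    have := smooth_onM (open_cimg c) (Cinf_smooth u Ac) Fs.
    apply: eq_smooth_on; first exact: open_cimg.
    by move=> x /cimg_cinv[cx xE]; rewrite !fctE /= /G asboolT// xE.
  by move=> p Kp; rewrite /G; case: ifP => // _; rewrite u0// mul0r.
have [g gE] := Cinf_of_smooth Gs.
exists g; split=> p; rewrite gE /G; first by move=> cp; rewrite asboolT.
by move=> ->; rewrite mul0r; case: ifP.
Qed.

Lemma smooth_bump p V : open V -> V p ->
  exists chi, [/\ csupp_in chi V, (forall q, 0 <= chi q) & \forall q \near p, chi q = 1].
Proof.
move=> Vo Vp; have [c Ac cp] := atlas_cover p.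
pose W := cimg c `&` cinv c @^-1` V.
have Wo : open W by exact: open_cinv.
have Wp : W (cmap c p) by split; [exact: cmap_cimg|rewrite /= cmapK].
have [phi [phis phi0 phi1 [L [cL LW phiL]]]] :=
  euclidean_bump (open_nbhs_nbhs (conj Wo Wp) : nbhs (cmap c p) W).
pose K := cinv c @` L.
have cK : compact K.
  apply: continuous_compact cL; apply: continuous_in_subspaceT => x /set_mem/LW[cx _].
  exact: cinv_continuous.
have Kc : K `<=` cdom c by move=> _ [x /LW[cx _] <-]; exact: (cimg_cinv cx).1.
pose G q := if `[< cdom c q >] then phi (cmap c q) else 0.
have G0 q : ~ K q -> G q = 0.
  rewrite /G; case: ifPn => // /asboolP cq Kq; apply: phiL => Lq; apply: Kq.
  by exists (cmap c q); rewrite ?cmapK.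
have Gs : smooth_fun G.
  apply: (smooth_fun_of_chart Ac cK Kc) => //.
  apply: (@eq_smooth_on _ _ _ phi); first exact: open_cimg.
    by move=> x /cimg_cinv[cx xE]; rewrite /= /G asboolT// xE.
  exact: smooth_on_sub phis.
have [chi chiE] := Cinf_of_smooth Gs.
exists chi; split.
- exists K; split=> // [q [x /LW[_ Vx] <-//]|q Kq].
  by rewrite chiE G0.
- by move=> q; rewrite chiE /G; case: ifP.
- have H := cmap_continuous cp phi1.
  near=> q; rewrite chiE /G asboolT; last first.
    by near: q; exact: open_nbhs_nbhs (conj (open_cdom c) cp).
  by near: q; exact: H.
Unshelve. all: by end_near. Qed.

Lemma compact_finite_cover K (W : M -> set M) : compact K ->
  (forall p, nbhs p (W p)) ->
  exists l : seq M, forall p, K p -> exists2 q, q \in l & W q p.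
Proof.
move=> /compact_near_coveringP cK Wp.
(* Finite lists directed by inclusion: what holds eventually along this filter holds for some finite
   list, which turns near-covering compactness into a finite subcover. *)
pose F : set_system (seq M) :=
  filter_from setT (fun l : seq M => [set l' : seq M | {subset l <= l'}]).
have FF : Filter F.
  apply: filter_from_filter; first by exists [::].
  move=> l1 l2 _ _; exists (l1 ++ l2) => // l /= H.
  by split=> x xl; apply: H; rewrite mem_cat xl ?orbT.
have := cK _ F (fun l p => exists2 q, q \in l & W q p) FF.
case=> [p _|l _ Hl]; last by exists l => p Kp; apply: (Hl l).
exists (W p, [set l : seq M | p \in l]) => /=.
  split; first exact: Wp.
  by exists [:: p] => // l; apply; rewrite inE.
by move=> [q l] /= [Wq pl]; exists p.
Qed.

(* Peels off u * chi_p for p in a finite set whose neighbourhoods {chi_p = 1}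
   cover the support of u; no partition of unity is needed. *)
Lemma csupp_ind (P : Cinf M -> Prop) : P 0 ->
  (forall u v, csupp_in u setT -> csupp_in v setT -> P u -> P v -> P (u + v)) ->
  (forall p, exists V, [/\ open V, V p & forall u, csupp_in u V -> P u]) ->
  forall u, csupp_in u setT -> P u.
Proof.
move=> P0 PD PV u [K [cK _ u0]].
have /choice[chi Hchi] p : exists chi : Cinf M, (\forall q \near p, chi q = 1) /\
    forall u, P (u * chi) /\ csupp_in (u * chi) setT.
  have [V [Vo Vp PVu]] := PV p; have [chi [chiV _ chi1]] := smooth_bump Vo Vp.
  exists chi; split=> // w; split; first by apply: PVu; exact: csupp_inMr.
  by apply: csupp_in_sub (csupp_inMr _ chiV).
have [l Hl] := compact_finite_cover (W := fun p => [set q | chi p q = 1]) cK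
  (fun p => (Hchi p).1).
have {}Hl p : u p != 0 -> exists2 q, q \in l & chi q p = 1.
  by move=> up; apply: Hl; apply: contrapT => /u0 E; rewrite E eqxx in up.
elim: l u u0 Hl => [|q l IH] u u0 Hl.
  rewrite (_ : u = 0) //; apply: Cinf_ext => p; apply/eqP; apply: contrapT.
  by move=> /negP/Hl[].
have -> : u = u * chi q + u * (1 - chi q) by rewrite mulrBr mulr1 subrKC.
apply: PD.
- exact: ((Hchi q).2 u).2.
- by exists K; split=> // p Kp; rewrite CinfE u0// mul0r.
- exact: ((Hchi q).2 u).1.
apply: IH => [p Kp|p]; first by rewrite CinfE u0// mul0r.
rewrite !CinfE mulf_eq0 negb_or => /andP[/Hl[q']]; rewrite inE => /predU1P[->|q'l].
  by move=> ->; rewrite subrr eqxx.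
by exists q'.
Qed.

End Charts.

(** * Differential operators and their transposes *)

Section LocalOperators.
Variables (R : realType) (n : nat) (U : set 'rV[R]_n).
Hypothesis Uo : open U.
Notation rfun := ('rV[R]_n -> R).
Implicit Types (f g w a : rfun) (T S : rfun -> rfun) (s : seq 'I_n) (N : nat).

(* [lop N T]: on smooth functions, T agrees over U with a differential operator of
   order at most N with smooth coefficients; lop_ext ignores values outside U. *)
Inductive lop : nat -> (rfun -> rfun) -> Prop :=
| lop_term N a s : (size s <= N)%N -> smooth_on U a ->
    lop N (fun f x => a x * pder s f x)
| lop_zero N : lop N (fun _ _ => 0)
| lop_add N T S : lop N T -> lop N S -> lop N (fun f x => T f x + S f x)
| lop_ext N T S : (forall f x, smooth_on U f -> U x -> T f x = S f x) ->
    lop N T -> lop N S.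

Lemma lop_le N N' T : (N <= N')%N -> lop N T -> lop N' T.
Proof.
move=> NN' lT; elim: lT N' NN' => {N T}.
- by move=> N a s sN as_ N' NN'; apply: lop_term => //; exact: leq_trans NN'.
- by move=> *; exact: lop_zero.
- by move=> N T S _ IHT _ IHS N' NN'; apply: lop_add; [exact: IHT|exact: IHS].
- by move=> N T S TS _ IH N' NN'; apply: (lop_ext TS); exact: IH.
Qed.

Lemma lop_smooth N T f : lop N T -> smooth_on U f -> smooth_on U (T f).
Proof.
move=> lT fs; elim: lT => {N T}.
- by move=> _ a s _ as_; apply: smooth_onM => //; exact: smooth_on_pder.
- by move=> _; exact: smooth_on_cst.
- by move=> _ T S _ IHT _ IHS; exact: (smooth_onD Uo IHT IHS).
- by move=> _ T S TS _; apply: eq_smooth_on => // x; exact: TS.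
Qed.

Lemma lop_local N T (W : set 'rV[R]_n) f g : lop N T -> open W -> W `<=` U ->
  smooth_on U f -> smooth_on U g -> (forall x, W x -> f x = g x) ->
  forall x, W x -> T f x = T g x.
Proof.
move=> lT Wo WU fs gs fg; elim: lT => {N T}.
- by move=> _ a s _ _ x Wx; rewrite (eq_pder s Wo fg).
- by [].
- by move=> _ T S _ IHT _ IHS x Wx; rewrite IHT ?IHS.
- by move=> _ T S TS _ IH x Wx; rewrite -!TS ?IH//; exact: WU.
Qed.

Lemma pder_linear s b f g x : smooth_on U f -> smooth_on U g -> U x ->
  pder s (fun y => b * f y + g y) x = b * pder s f x + pder s g x.
Proof.
elim: s f g x => //= i s IH f g x fs gs Ux.
rewrite -IH//; last 2 first.
- exact: smooth_on_pd.
- exact: smooth_on_pd.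
apply: (eq_pder s Uo) => // y Uy.
have bs : smooth_on U (cst b) by exact: smooth_on_cst.
have := pdD i (smooth_onM Uo bs fs) gs Uy; rewrite /pd => ->; congr (_ + _).
by rewrite -/(pd i _ _) (pdM i bs fs Uy) /pd derive_cst mulr0 addr0.
Qed.

Lemma lop_linear N T b f g x : lop N T -> smooth_on U f -> smooth_on U g -> U x ->
  T (fun y => b * f y + g y) x = b * T f x + T g x.
Proof.
move=> lT fs gs Ux; elim: lT => {N T}.
- by move=> _ a s _ _; rewrite pder_linear// mulrDr mulrCA.
- by move=> _; rewrite mulr0 addr0.
- by move=> _ T S _ -> _ ->; ring.
- move=> _ T S TS _; rewrite -!TS//.
  apply: (@smooth_onD _ _ _ (fun y => b * f y)) => //.
  by apply: (@smooth_onM _ _ _ (cst b)) => //; exact: smooth_on_cst.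
Qed.

Lemma lop_mul N T a : smooth_on U a -> lop N T -> lop N (fun f x => a x * T f x).
Proof.
move=> as_; elim=> {N T}.
- move=> N b s sN bs.
  apply: (@lop_ext _ (fun f x => (a * b) x * pder s f x)).
    by move=> f x _ _; rewrite fctE mulrA.
  by apply: lop_term => //; exact: smooth_onM.
- move=> N; apply: (@lop_ext _ (fun _ _ => 0)); last exact: lop_zero.
  by move=> f x _ _; rewrite mulr0.
- move=> N T S _ IHT _ IHS; apply: lop_ext (lop_add IHT IHS).
  by move=> f x _ _; rewrite mulrDr.
- by move=> N T S TS _; apply: lop_ext => f x fs Ux; rewrite TS.
Qed.

Lemma lop_pd N T i : lop N T -> lop N.+1 (fun f => pd i (T f)).
Proof.
elim=> {N T}.
- move=> N a s sN as_.
  apply: (@lop_ext _ (fun f x => a x * pder (rcons s i) f x + pd i a x * pder s f x)).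
    move=> f x fs Ux; rewrite [RHS](pdM i as_ (smooth_on_pder s fs) Ux).
    by rewrite pder_rcons; congr (_ + _); rewrite mulrC.
  apply: lop_add; apply: lop_term => //; first by rewrite size_rcons.
    exact: leqW.
  exact: smooth_on_pd.
- move=> N; apply: (@lop_ext _ (fun _ _ => 0)); last exact: lop_zero.
  by move=> f x _ _; rewrite /pd (derive_cst (0 : R)).
- move=> N T S lT IHT lS IHS; apply: lop_ext (lop_add IHT IHS) => f x fs Ux.
  exact/esym/(pdD i (lop_smooth lT fs) (lop_smooth lS fs) Ux).
- move=> N T S TS _; apply: lop_ext => f x fs Ux.
  by apply: (eq_pd i Uo) => // y Uy; exact: TS.
Qed.

Lemma lop_pder N T s : lop N T -> lop (N + size s) (fun f => pder s (T f)).
Proof.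
elim: s N T => [|i s IH] N T lT /=; first by rewrite addn0.
by rewrite addnS -addSn; exact: (IH _ (fun f => pd i (T f)) (lop_pd i lT)).
Qed.

Lemma lop_comp N N' T S : lop N T -> lop N' S -> lop (N + N') (fun f => T (S f)).
Proof.
move=> lT lS; elim: lT => {N T}.
- move=> N a s sN as_; apply: lop_mul => //.
  by apply: (lop_le _ (lop_pder s lS)); rewrite addnC leq_add2r.
- by move=> N; exact: lop_zero.
- by move=> N T1 T2 _ IH1 _ IH2; exact: lop_add.
- move=> N T1 T2 T12 _; apply: lop_ext => f x fs Ux; apply: T12 => //.
  exact: (lop_smooth lS).
Qed.

Lemma lop_id : lop 0 (fun f => f).
Proof.
apply: (@lop_ext _ (fun f x => 1 * pder [::] f x)).
  by move=> f x _ _; rewrite mul1r.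
by apply: (@lop_term 0%N (cst 1)) => //; exact: smooth_on_cst.
Qed.

Lemma lop_sum N (I : Type) (r : seq I) (F : I -> rfun -> rfun) :
  (forall i, lop N (F i)) -> lop N (fun f x => \sum_(i <- r) F i f x).
Proof.
move=> lF; elim: r => [|i r IH].
  apply: (@lop_ext _ (fun _ _ => 0)); last exact: lop_zero.
  by move=> f x _ _; rewrite big_nil.
apply: lop_ext (lop_add (lF i) IH) => f x _ _.
by rewrite big_cons.
Qed.

Definition word_op N (a : seq 'I_n -> rfun) : rfun -> rfun := fun f x =>
  \sum_(k < N.+1) \sum_(s : k.-tuple 'I_n) a s x * pder s f x.

Lemma lop_word_op N (a : seq 'I_n -> rfun) :
  (forall s, smooth_on U (a s)) -> lop N (word_op N a).
Proof.
move=> as_; apply: (@lop_sum _ _ _ (fun (k : 'I_N.+1) f x =>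
   \sum_(s : k.-tuple 'I_n) a s x * pder s f x)) => k.
apply: (@lop_sum _ _ _ (fun (s : k.-tuple 'I_n) f x => a s x * pder s f x)) => s.
by apply: lop_term => //; rewrite size_tuple -ltnS.
Qed.

(** Normal form of a [lop], which recovers the coefficients required by [diffop]. *)
Lemma lop_words N T : lop N T -> exists a : seq 'I_n -> rfun,
  (forall s, smooth_on U (a s)) /\
  forall f x, smooth_on U f -> U x -> T f x = word_op N a f x.
Proof.
elim=> {N T}.
- move=> N a s sN as_; exists (fun t => if t == s then a else cst 0).
  split=> [t|f x fs Ux]; first by case: eqP => // _; exact: smooth_on_cst.
  have sN' : (size s < N.+1)%N by [].
  rewrite /word_op (bigD1 (Ordinal sN'))//= (bigD1 (in_tuple s))//= eqxx.
  rewrite !big1 ?addr0// => [k ks|t ts].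
    apply: big1 => t _; case: eqP => [ts|_]; last by rewrite mul0r.
    by case/eqP: ks; apply: val_inj => /=; rewrite -ts size_tuple.
  case: eqP => [E|_]; last by rewrite mul0r.
  by case/eqP: ts; apply: val_inj.
- move=> N; exists (fun _ => cst 0); split=> [s|f x _ _]; first exact: smooth_on_cst.
  by rewrite /word_op big1// => k _; rewrite big1// => s _; rewrite mul0r.
- move=> N T S _ [a [as_ aT]] _ [b [bs bS]]; exists (fun s => a s + b s).
  split=> [s|f x fs Ux]; first exact: smooth_onD.
  rewrite aT// bS// -big_split; apply: eq_bigr => k _.
  by rewrite -big_split; apply: eq_bigr => s _; rewrite fctE mulrDl.
- move=> N T S TS _ [a [as_ aT]]; exists a; split=> // f x fs Ux.
  by rewrite -TS// aT.
Qed.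

Definition support_preserving T := forall f, smooth_on U f ->
  smooth_on U (T f) /\
  forall K, compact K -> vanish_off U K f -> vanish_off U K (T f).

Lemma lop_support N T : lop N T -> support_preserving T.
Proof.
move=> lT f fs; split=> [|K cK f0 x Ux Kx]; first exact: (lop_smooth lT).
have WO : open (U `&` ~` K).
  by apply: openI => //; apply: closed_openC; exact: row_compact_closed.
(* Off K, f and f + f agree; locality and linearity then give T f + T f = T f there, so T f
   vanishes. *)
have T0 : T (fun y => 1 * f y + f y) x = 1 * T f x + T f x by exact: (lop_linear 1 lT).
have s2 : smooth_on U (fun y => 1 * f y + f y).
  apply: (@smooth_onD _ _ _ (fun y => 1 * f y)) => //.
  by apply: (@smooth_onM _ _ _ (cst 1)) => //; exact: smooth_on_cst.
have : T (fun y => 1 * f y + f y) x = T f x.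
  apply: (lop_local lT WO (@subIsetl _ _ _) s2 fs) => // y [Uy Ky].
  by rewrite f0// mulr0 addr0.
by rewrite T0 mul1r => /eqP; rewrite -subr_eq0 addrK => /eqP.
Qed.

(** The formal transpose for Lebesgue measure on U. Preservation of supports is part of it because
    splitting the integral of a sum, as in [adjoint_on_add], requires both integrands to vanish off
    K. *)
Definition adjoint_on T S := [/\ support_preserving T, support_preserving S &
  forall K f w, compact K -> K `<=` U -> smooth_on U f -> smooth_on U w ->
    vanish_off U K f \/ vanish_off U K w ->
    iint (ext0 U (T f * w)) = iint (ext0 U (f * S w))].

Lemma adjoint_on_term a s : smooth_on U a ->
  adjoint_on (fun f x => a x * pder s f x)
             (fun w x => (-1) ^+ size s * pder (rev s) (a * w) x).
Proof.
move=> as_; split.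
- by apply: (@lop_support (size s)); exact: lop_term.
- apply: (@lop_support (0 + size (rev s))).
  apply: (@lop_mul _ _ (cst ((-1) ^+ size s))); first exact: smooth_on_cst.
  by apply: lop_pder; exact: (lop_mul as_ lop_id).
move=> K f w cK KU fs ws fw0.
have -> : ext0 U ((fun x => a x * pder s f x) * w) = ext0 U (pder s f * (a * w)).
  by apply: eq_ext0 => x _; rewrite !fctE; ring.
have aws : smooth_on U (a * w) by exact: smooth_onM.
have fw0' : vanish_off U K f \/ vanish_off U K (a * w).
  by case: fw0; [left|right; exact: vanish_offMr].
rewrite (iint_by_parts s Uo cK KU fs aws fw0').
set v := pder (rev s) (a * w).
have vs : smooth_on U v by exact: smooth_on_pder.
have fvs : smooth_on U (f * v) by exact: smooth_onM.
have fv0 : vanish_off U K (f * v).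
  case: fw0' => [f0|aw0]; first exact: vanish_offMl.
  by apply: vanish_offMr; exact: vanish_off_pder.
have s0 : smooth_on U (fun=> 0 : R) by exact: smooth_on_cst.
have v0 : vanish_off U K (fun=> 0) by [].
have := iint_ext0_linear ((-1) ^+ size s) Uo cK KU fvs s0 fv0 v0.
have -> : ext0 U (fun=> 0 : R) = fun=> 0.
  by apply/funext => x; rewrite /ext0; case: ifP.
rewrite iint0 addr0 => <-; congr iint; apply: eq_ext0 => x _.
by rewrite !fctE addr0 mulrCA.
Qed.

Lemma adjoint_on_zero : adjoint_on (fun _ _ => 0) (fun _ _ => 0).
Proof.
have H := @lop_support 0 _ (lop_zero 0).
split=> // K f w _ _ _ _ _; congr iint; apply: eq_ext0 => x _.
by rewrite !fctE mul0r mulr0.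
Qed.

Lemma support_preserving_add T S : support_preserving T -> support_preserving S ->
  support_preserving (fun f x => T f x + S f x).
Proof.
move=> HT HS f fs; have [Ts T0] := HT f fs; have [Ss S0] := HS f fs.
split=> [|K cK f0 x Ux Kx]; first exact: (smooth_onD Uo Ts Ss).
by rewrite (T0 K)// (S0 K)// addr0.
Qed.

Lemma adjoint_on_add T T' S S' : adjoint_on T T' -> adjoint_on S S' ->
  adjoint_on (fun f x => T f x + S f x) (fun f x => T' f x + S' f x).
Proof.
move=> [HT HT' IT] [HS HS' IS]; split; [exact: support_preserving_add..|].
move=> K f w cK KU fs ws fw0.
have [Ts T0] := HT f fs; have [Ss S0] := HS f fs.
have [Ts' T0'] := HT' w ws; have [Ss' S0'] := HS' w ws.
have -> : ext0 U ((fun x => T f x + S f x) * w) =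
    ext0 U (fun x => 1 * (T f * w) x + (S f * w) x).
  by apply: eq_ext0 => x _; rewrite !fctE; ring.
have -> : ext0 U (f * (fun x => T' w x + S' w x)) =
    ext0 U (fun x => 1 * (f * T' w) x + (f * S' w) x).
  by apply: eq_ext0 => x _; rewrite !fctE; ring.
have smM g h : smooth_on U g -> smooth_on U h -> smooth_on U (g * h).
  exact: smooth_onM.
rewrite !(iint_ext0_linear _ Uo cK KU); do ?exact: smM.
- by rewrite (IT K)// (IS K).
- by case: fw0 => [f0|w0]; [exact: vanish_offMl|apply: vanish_offMr; exact: T0'].
- by case: fw0 => [f0|w0]; [exact: vanish_offMl|apply: vanish_offMr; exact: S0'].
- by case: fw0 => [f0|w0]; [apply: vanish_offMl; exact: T0|exact: vanish_offMr].
- by case: fw0 => [f0|w0]; [apply: vanish_offMl; exact: S0|exact: vanish_offMr].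
Qed.

Lemma adjoint_on_sum (I : Type) (r : seq I) (T S : I -> rfun -> rfun) :
  (forall i, adjoint_on (T i) (S i)) ->
  adjoint_on (fun f x => \sum_(i <- r) T i f x) (fun f x => \sum_(i <- r) S i f x).
Proof.
move=> TS; elim: r => [|i r IH].
  have E : (fun (f : rfun) (x : 'rV[R]_n) => 0) = (fun f x => \sum_(i <- [::]) T i f x).
    by apply/funext => f; apply/funext => x; rewrite big_nil.
  have E' : (fun (f : rfun) (x : 'rV[R]_n) => 0) = (fun f x => \sum_(i <- [::]) S i f x).
    by apply/funext => f; apply/funext => x; rewrite big_nil.
  by rewrite -E -E'; exact: adjoint_on_zero.
have E F : (fun (f : rfun) x => \sum_(i <- i :: r) F i f x) =
    (fun f x => F i f x + \sum_(i <- r) F i f x) :> (rfun -> rfun).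
  by apply/funext => f; apply/funext => x; rewrite big_cons.
by rewrite !E; exact: adjoint_on_add.
Qed.

Definition word_adj N (a : seq 'I_n -> rfun) : rfun -> rfun := fun w x =>
  \sum_(k < N.+1) \sum_(s : k.-tuple 'I_n) (-1) ^+ size s * pder (rev s) (a s * w) x.

Lemma adjoint_on_words N (a : seq 'I_n -> rfun) : (forall s, smooth_on U (a s)) ->
  adjoint_on (word_op N a) (word_adj N a).
Proof.
move=> as_; apply: (@adjoint_on_sum _ _ (fun (k : 'I_N.+1) f x =>
   \sum_(s : k.-tuple 'I_n) a s x * pder s f x)) => k.
apply: (@adjoint_on_sum _ _ (fun (s : k.-tuple 'I_n) f x => a s x * pder s f x)) => s.
exact: adjoint_on_term.
Qed.

Lemma lop_word_adj N (a : seq 'I_n -> rfun) :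
  (forall s, smooth_on U (a s)) -> lop N (word_adj N a).
Proof.
move=> as_; apply: (@lop_sum _ _ _ (fun (k : 'I_N.+1) w x =>
   \sum_(s : k.-tuple 'I_n) (-1) ^+ size s * pder (rev s) (a s * w) x)) => k.
apply: (@lop_sum _ _ _ (fun (s : k.-tuple 'I_n) w x =>
   (-1) ^+ size s * pder (rev s) (a s * w) x)) => s.
apply: (@lop_mul _ _ (cst ((-1) ^+ size s))); first exact: smooth_on_cst.
have := lop_pder (rev s) (lop_mul (as_ s) lop_id); apply: lop_le.
by rewrite size_rev size_tuple add0n -ltnS.
Qed.

End LocalOperators.

(** * Integration against a density *)

Section Densities.
Variables (R : realType) (n : nat) (M : manifold R n).
Implicit Types (f g u v z w : Cinf M) (p q : M) (c d : chart R M n) (V : set M)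
  (rho : density M).

Lemma csupp_inT u V : csupp_in u V -> csupp_in u setT.
Proof. by apply: csupp_in_sub. Qed.

Lemma dint_lin rho a u v : csupp_in u setT -> csupp_in v setT ->
  dint rho (a *: u + v) = a * dint rho u + dint rho v.
Proof. by move=> /csupp_in_compact cu /csupp_in_compact cv; exact: dint_linear. Qed.

Lemma dintD rho u v : csupp_in u setT -> csupp_in v setT ->
  dint rho (u + v) = dint rho u + dint rho v.
Proof. by move=> cu cv; have := dint_lin rho 1 cu cv; rewrite scale1r mul1r. Qed.

Lemma dint0 rho : dint rho 0 = 0.
Proof.
have c0 := csupp_in0 (M := M) setT.
by have := dintD rho c0 c0; rewrite addr0 => /esym/eqP; rewrite -subr_eq0 addrK => /eqP.
Qed.

Lemma dintZ rho a u : csupp_in u setT -> dint rho (a *: u) = a * dint rho u.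
Proof.
by move=> cu; rewrite -[a *: u]addr0 dint_lin ?dint0 ?addr0//; exact: csupp_in0.
Qed.

Lemma dintN rho u : csupp_in u setT -> dint rho (- u) = - dint rho u.
Proof. by move=> cu; rewrite -scaleN1r dintZ// mulN1r. Qed.

Lemma dintB rho u v : csupp_in u setT -> csupp_in v setT ->
  dint rho (u - v) = dint rho u - dint rho v.
Proof.
by move=> cu cv; rewrite dintD ?dintN// -scaleN1r; exact: csupp_inZ.
Qed.

Lemma dint_sum rho (I : Type) (r : seq I) (F : I -> Cinf M) :
  (forall i, csupp_in (F i) setT) ->
  dint rho (\sum_(i <- r) F i) = \sum_(i <- r) dint rho (F i).
Proof.
move=> cF; elim: r => [|i r IH]; first by rewrite !big_nil dint0.
by rewrite !big_cons dintD ?IH//; exact: csupp_in_sum.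
Qed.

Lemma dint_chartE rho c u : atlas c -> csupp_in u (cdom c) ->
  dint rho u = iint (ext0 (cimg c) ((u \o cinv c) * dcoef rho c)).
Proof.
move=> Ac cu; rewrite (dint_chart rho Ac (csupp_in_compact cu))//.
exact: csupp_in_closure.
Qed.

Lemma csupp_in_chart c u : csupp_in u (cdom c) -> exists K : set 'rV[R]_n,
  [/\ compact K, K `<=` cimg c & vanish_off (cimg c) K (u \o cinv c)].
Proof.
move=> [L [cL Lc u0]]; exists (cmap c @` L); split.
- apply: continuous_compact cL; apply: continuous_in_subspaceT => x /set_mem/Lc cx.
  exact: cmap_continuous.
- by move=> _ [p /Lc cp <-]; exact: cmap_cimg.
- move=> x cx Lx; have [cp xE] := cimg_cinv cx; rewrite /= u0// => Lp; apply: Lx.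
  by exists (cinv c x).
Qed.

(* Testing against u = chi z rho_c, with chi a bump function supported in a chart
   c, turns the integrand into a square, whatever the sign of rho. *)
Lemma dint_nondegenerate rho z p V : nonvanishing rho -> open V -> V p ->
  (forall u, csupp_in u V -> dint rho (u * z) = 0) -> z p = 0.
Proof.
move=> nv Vo Vp H; have [c Ac cp] := atlas_cover p.
have VCo : open (V `&` cdom c) by apply: openI => //; exact: open_cdom.
have [chi [chiV chi0 chi1]] := smooth_bump VCo (conj Vp cp).
have chic : csupp_in chi (cdom c) by apply: csupp_in_sub chiV => q [].
have [y [yE _]] := chart_ext Ac chic (dcoef_smooth rho Ac).
have uV : csupp_in (chi * z * y) V.
  by apply: csupp_in_sub (csupp_inMl y (csupp_inMl z chiV)) => q [].
have uc : csupp_in (chi * z * y * z) (cdom c) by do 3!apply: csupp_inMl.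
have [K [cK KU w0]] := csupp_in_chart uc.
have := H _ uV; rewrite (dint_chartE rho Ac uc).
set w := (_ \o _) * _ => I0.
have wE x : cimg c x -> w x = (chi (cinv c x) * z (cinv c x) * dcoef rho c x) ^+ 2.
  move=> cx; have [cq xE] := cimg_cinv cx.
  rewrite (_ : w x = (chi * z * y * z) (cinv c x) * dcoef rho c x)//.
  by rewrite !CinfE yE// xE; ring.
have x0 := iint_ext0_eq0 (open_cimg c) cK KU
  (smooth_onM (open_cimg c) (Cinf_smooth _ Ac) (dcoef_smooth rho Ac))
  (vanish_offMl _ w0) _ I0.
have {x0} := x0 _ (cmap c p) (cmap_cimg cp).
rewrite -/w wE ?cmapK//; last exact: cmap_cimg.
rewrite (nbhs_singleton chi1) mul1r => x0.
have /eqP : (z p * dcoef rho c (cmap c p)) ^+ 2 = 0.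
  by apply: x0 => x cx; rewrite -/w wE// sqr_ge0.
rewrite sqrf_eq0 mulf_eq0 (negbTE (nv _ Ac _ (cmap_cimg cp))) orbF.
by move=> /eqP.
Qed.

(** The Jacobian factors cancel in the quotient of the two coefficients, so the quotient is a
    function on M. They are nonzero because the coefficient of rho0 is a multiple of them and does
    not vanish. *)
Lemma density_ratio (rho0 rho : density M) : nonvanishing rho0 ->
  exists h : Cinf M, forall w, csupp_in w setT -> dint rho w = dint rho0 (h * w).
Proof.
move=> nv.
have /choice[cc Hcc] p : exists c : chart R M n, atlas c /\ cdom c p.
  by have [c Ac cp] := atlas_cover p; exists c.
pose H p := dcoef rho (cc p) (cmap (cc p) p) / dcoef rho0 (cc p) (cmap (cc p) p).
have HE c p : atlas c -> cdom c p ->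
    H p = dcoef rho c (cmap c p) / dcoef rho0 c (cmap c p).
  move=> Ac cp; have [Ad dp] := Hcc p; rewrite /H; set d := cc p in Ad dp *.
  have ovl : coverlap c d (cmap c p).
    by rewrite coverlapE; split; [exact: cmap_cimg|rewrite /= cmapK].
  have tr : transition c d (cmap c p) = cmap d p by rewrite /transition /= cmapK.
  have := nv _ Ac _ (cmap_cimg cp).
  rewrite !(dcoef_transition _ Ac Ad ovl) tr mulf_eq0 negb_or => /andP[det0 _].
  by rewrite -mulf_div divff// mul1r.
have Hs : smooth_fun H.
  move=> c Ac; have := smooth_onM (open_cimg c) (dcoef_smooth rho Ac)
    (smooth_onV (open_cimg c) (dcoef_smooth rho0 Ac) (nv _ Ac)).
  apply: eq_smooth_on; first exact: open_cimg.
  by move=> x cx; have [cp xE] := cimg_cinv cx; rewrite /= (HE c)// xE.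
have [h hE] := Cinf_of_smooth Hs.
exists h; apply: csupp_ind.
- by rewrite mulr0 !dint0.
- by move=> u v cu cv IHu IHv; rewrite mulrDr !dintD ?IHu ?IHv//; exact: csupp_inMr.
move=> p; have [c Ac cp] := atlas_cover p; exists (cdom c); split=> //.
  exact: open_cdom.
move=> u cu; rewrite (dint_chartE _ Ac cu) (dint_chartE _ Ac (csupp_inMr h cu)).
congr iint; apply: eq_ext0 => x cx; have [cq xE] := cimg_cinv cx.
rewrite (_ : (_ * _) x = (h * u) (cinv c x) * dcoef rho0 c x)//.
rewrite CinfE hE (HE c)// xE mulrAC divfK//; last exact: (nv _ Ac).
by rewrite mulrC.
Qed.

End Densities.

(** * Differential operators on the manifold *)

Section DiffOps.
Variables (R : realType) (n : nat) (M : manifold R n).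
Implicit Types (f g h u v : Cinf M) (p q : M) (c d : chart R M n) (V : set M)
  (A B : Cinf M -> Cinf M).

Definition local_rep c A (T : ('rV[R]_n -> R) -> 'rV[R]_n -> R) :=
  forall f x, cimg c x -> A f (cinv c x) = T (f \o cinv c) x.

(** Gives access to the closure properties of [lop], in particular composition, without handling
    coefficients. *)
Lemma diffopP A : diffop A <->
  exists N, forall c, atlas c -> exists2 T, lop (cimg c) N T & local_rep c A T.
Proof.
split=> [[N HN]|[N HN]]; exists N => c Ac.
  have [a [as_ aA]] := HN c Ac; exists (word_op N a) => //.
  exact: lop_word_op.
have [T lT TA] := HN c Ac; have [a [as_ aT]] := lop_words (open_cimg c) lT.
by exists a; split=> // f x cx; rewrite TA// aT//; exact: Cinf_smooth.
Qed.

Lemma diffop_id : diffop (@id (Cinf M)).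
Proof.
by apply/diffopP; exists 0%N => c Ac; exists (fun F => F) => //; exact: lop_id.
Qed.

Lemma diffop0 : diffop (fun _ : Cinf M => 0).
Proof.
by apply/diffopP; exists 0%N => c Ac; exists (fun _ _ => 0) => //; exact: lop_zero.
Qed.

Lemma diffopD A B : diffop A -> diffop B -> diffop (fun f => A f + B f).
Proof.
move=> /diffopP[N HA] /diffopP[N' HB]; apply/diffopP; exists (maxn N N') => c Ac.
have [T lT TA] := HA c Ac; have [S lS SB] := HB c Ac.
exists (fun F x => T F x + S F x).
  by apply: lop_add; [apply: lop_le lT; exact: leq_maxl|apply: lop_le lS; exact: leq_maxr].
by move=> f x cx; rewrite CinfE TA// SB.
Qed.

Lemma diffopM h A : diffop A -> diffop (fun f => h * A f).
Proof.
move=> /diffopP[N HA]; apply/diffopP; exists N => c Ac.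
have [T lT TA] := HA c Ac; exists (fun F x => (h \o cinv c) x * T F x).
  by apply: lop_mul => //; [exact: open_cimg|exact: Cinf_smooth].
by move=> f x cx; rewrite CinfE TA.
Qed.

Lemma diffop_comp A B : diffop A -> diffop B -> diffop (fun f => A (B f)).
Proof.
move=> /diffopP[N HA] /diffopP[N' HB]; apply/diffopP; exists (N + N')%N => c Ac.
have [T lT TA] := HA c Ac; have [S lS SB] := HB c Ac.
exists (fun F => T (S F)); first exact: (lop_comp (open_cimg c) lT lS).
move=> f x cx; rewrite TA//.
apply: (lop_local (W := cimg c) lT) => //; [exact: open_cimg|exact: Cinf_smooth| |].
  by apply: (lop_smooth _ lS); [exact: open_cimg|exact: Cinf_smooth].
by move=> y cy; rewrite /= SB.
Qed.

Lemma diffop_sum (I : Type) (r : seq I) (F : I -> Cinf M -> Cinf M) :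
  (forall i, diffop (F i)) -> diffop (fun f => \sum_(i <- r) F i f).
Proof.
move=> dF; elim: r => [|i r IH].
  by under eq_fun do rewrite big_nil; exact: diffop0.
by under eq_fun do rewrite big_cons; exact: diffopD.
Qed.

Lemma diffop_linear A a f g : diffop A -> A (a *: f + g) = a *: A f + A g.
Proof.
move=> /diffopP[N HA]; apply: Cinf_ext => p; have [c Ac cp] := atlas_cover p.
have [T lT TA] := HA c Ac; have cx := cmap_cimg cp.
rewrite !CinfE -(cmapK cp) !TA//.
exact: (lop_linear (open_cimg c) a lT (Cinf_smooth f Ac) (Cinf_smooth g Ac)).
Qed.

Lemma diffop_zero A : diffop A -> A 0 = 0.
Proof.
by move=> /(diffop_linear (-1) 0 0); rewrite scaler0 addr0 scaleN1r addNr.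
Qed.

Lemma diffop_near A f g p : diffop A -> (\forall q \near p, f q = g q) -> A f p = A g p.
Proof.
move=> /diffopP[N HA] fg; have [c Ac cp] := atlas_cover p.
have [T lT TA] := HA c Ac; have cx := cmap_cimg cp.
have [V [Vo Vp] VE] : exists2 V, open_nbhs p V & V `<=` [set q | f q = g q].
  have fg' : nbhs p [set q | f q = g q] by exact: fg.
  by rewrite nbhsE in fg'.
have Wo : open (cimg c `&` cinv c @^-1` V) by exact: open_cinv.
rewrite -(cmapK cp) !TA//.
apply: (lop_local lT Wo _ (Cinf_smooth f Ac) (Cinf_smooth g Ac)).
- by move=> x [].
- by move=> x [cx' Vx]; exact: VE.
- by split=> //=; rewrite cmapK.
Qed.

Lemma diffop_near_eq A f g p : diffop A -> (\forall q \near p, f q = g q) ->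
  \forall q \near p, A f q = A g q.
Proof.
move=> dA fg; apply: filterS (nbhs_interior fg) => q; exact: diffop_near.
Qed.

Lemma diffop_csupp A u V : diffop A -> csupp_in u V -> csupp_in (A u) V.
Proof.
move=> dA [K [cK KV u0]]; exists K; split=> // p Kp.
have -> : A u p = A 0 p.
  apply: diffop_near => //.
  have KCo : open (~` K) by apply: closed_openC; exact: manifold_compact_closed.
  apply: filterS (open_nbhs_nbhs (conj KCo Kp)) => q Kq.
  by rewrite u0.
by rewrite diffop_zero.
Qed.

End DiffOps.

(** * Transposes with respect to a density *)

Section Transposition.
Variables (R : realType) (n : nat) (M : manifold R n) (rho : density M).
Hypothesis nv : nonvanishing rho.
Implicit Types (f g h u v : Cinf M) (p q : M) (c d : chart R M n)
  (A B : Cinf M -> Cinf M) (T S : ('rV[R]_n -> R) -> 'rV[R]_n -> R).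

(** In the chart the density is rho_c dx, so transposing with respect to it conjugates the Lebesgue
    adjoint S by multiplication by rho_c. *)
Definition chart_transpose c S v : 'rV[R]_n -> R := fun x =>
  (dcoef rho c x)^-1 * S (dcoef rho c * (v \o cinv c)) x.

Lemma density_pull_smooth c v : atlas c ->
  smooth_on (cimg c) (dcoef rho c * (v \o cinv c)).
Proof.
move=> Ac; apply: smooth_onM; [exact: open_cimg|exact: dcoef_smooth|exact: Cinf_smooth].
Qed.

Lemma chart_transpose_smooth c T S v : atlas c -> adjoint_on (cimg c) T S ->
  smooth_on (cimg c) (chart_transpose c S v).
Proof.
move=> Ac [_ HS _]; apply: smooth_onM; first exact: open_cimg.
  by apply: smooth_onV; [exact: open_cimg|exact: dcoef_smooth|exact: nv].
by have [] := HS _ (density_pull_smooth v Ac).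
Qed.

(** The global function g replaces u times the transpose of v, so that the lemma applies before the
    transpose is known to exist globally, namely in [chart_transpose_glue]. *)
Lemma dint_chart_transpose c A T S u v g : diffop A -> atlas c ->
  local_rep c A T -> adjoint_on (cimg c) T S ->
  csupp_in u (cdom c) \/ csupp_in v (cdom c) -> csupp_in g (cdom c) ->
  (forall q, cdom c q -> g q = u q * chart_transpose c S v (cmap c q)) ->
  dint rho (A u * v) = dint rho g.
Proof.
move=> dA Ac AT [HT HS IT] uv cg gE.
have cAuv : csupp_in (A u * v) (cdom c).
  by case: uv => [cu|cv]; [apply: csupp_inMl; exact: diffop_csupp|exact: csupp_inMr].
rewrite (dint_chartE rho Ac cAuv) (dint_chartE rho Ac cg).
have [K [cK KU uv0]] : exists K : set 'rV[R]_n, [/\ compact K, K `<=` cimg c &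
    vanish_off (cimg c) K (u \o cinv c) \/
    vanish_off (cimg c) K (dcoef rho c * (v \o cinv c))].
  case: uv => [cu|cv].
    by have [K [cK KU u0]] := csupp_in_chart cu; exists K; split=> //; left.
  have [K [cK KU v0]] := csupp_in_chart cv; exists K; split=> //; right.
  exact: vanish_offMr.
have -> : ext0 (cimg c) ((A u * v \o cinv c) * dcoef rho c) =
    ext0 (cimg c) (T (u \o cinv c) * (dcoef rho c * (v \o cinv c))).
  apply: eq_ext0 => x cx.
  rewrite (_ : (_ * _) x = (A u * v) (cinv c x) * dcoef rho c x)//.
  rewrite CinfE AT// [RHS](_ : _ = T (u \o cinv c) x * (dcoef rho c x * v (cinv c x)))//.
  by rewrite mulrAC mulrA.
rewrite (IT K)//; last 2 first.
- exact: Cinf_smooth.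
- exact: density_pull_smooth.
congr iint; apply: eq_ext0 => x cx; have [cq xE] := cimg_cinv cx.
rewrite [RHS](_ : _ = g (cinv c x) * dcoef rho c x)// gE// xE /chart_transpose.
rewrite [LHS](_ : _ = u (cinv c x) * S (dcoef rho c * (v \o cinv c)) x)//.
by field; exact: (nv Ac).
Qed.

(* For u supported in the overlap, the integral of A u * v computed in either chart
   shows that the two expressions define the same functional of u. *)
Lemma chart_transpose_glue c d A T S T' S' v p : diffop A -> atlas c -> atlas d ->
  local_rep c A T -> adjoint_on (cimg c) T S ->
  local_rep d A T' -> adjoint_on (cimg d) T' S' -> cdom c p -> cdom d p ->
  chart_transpose c S v (cmap c p) = chart_transpose d S' v (cmap d p).
Proof.
move=> dA Ac Ad AT TS AT' TS' cp dp.
have VO : open (cdom c `&` cdom d) by apply: openI; exact: open_cdom.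
have [chi [chiV _ chi1]] := smooth_bump VO (conj cp dp).
have chic : csupp_in chi (cdom c) by apply: csupp_in_sub chiV => q [].
have chid : csupp_in chi (cdom d) by apply: csupp_in_sub chiV => q [].
have [g [gE g0]] := chart_ext Ac chic (chart_transpose_smooth v Ac TS).
have [h [hE h0]] := chart_ext Ad chid (chart_transpose_smooth v Ad TS').
have gV : csupp_in g (cdom c).
  by have [K [cK KV chi0]] := chic; exists K; split=> // q /chi0/g0.
have hV : csupp_in h (cdom d).
  by have [K [cK KV chi0]] := chid; exists K; split=> // q /chi0/h0.
have Z : (g - h) p = 0.
  apply: (dint_nondegenerate nv VO (conj cp dp)) => u uV.
  rewrite mulrBr dintB; last 2 first.
  - exact/csupp_inT/(csupp_inMl _ uV).
  - exact/csupp_inT/(csupp_inMl _ uV).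
  have E1 : dint rho (A (u * chi) * v) = dint rho (u * g).
    apply: (dint_chart_transpose dA Ac AT TS).
    - by left; exact: csupp_inMr.
    - exact: csupp_inMr.
    - by move=> q cq; rewrite !CinfE gE// mulrA.
  have E2 : dint rho (A (u * chi) * v) = dint rho (u * h).
    apply: (dint_chart_transpose dA Ad AT' TS').
    - by left; exact: csupp_inMr.
    - exact: csupp_inMr.
    - by move=> q cq; rewrite !CinfE hE// mulrA.
  by rewrite -E1 -E2 subrr.
move: Z; rewrite !CinfE gE// hE// (nbhs_singleton chi1) !mul1r.
by move=> /eqP; rewrite subr_eq0 => /eqP.
Qed.

(** The second clause allows B to be computed from any local adjoint; [bidiffop_transpose] uses it
    to follow how a transpose depends on a parameter. *)
Lemma diffop_transpose A : diffop A -> exists B, [/\ diffop B,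
  (forall c T S, atlas c -> local_rep c A T -> adjoint_on (cimg c) T S ->
    forall v x, cimg c x -> B v (cinv c x) = chart_transpose c S v x) &
  (forall u v, csupp_in u setT \/ csupp_in v setT ->
    dint rho (A u * v) = dint rho (u * B v))].
Proof.
move=> dA; have [N HN] := dA.
have /choice[cc Hcc] p : exists c : chart R M n, atlas c /\ cdom c p.
  by have [c Ac cp] := atlas_cover p; exists c.
have HN' c : exists a : seq 'I_n -> 'rV[R]_n -> R, atlas c ->
    (forall s, smooth_on (cimg c) (a s)) /\ local_rep c A (word_op N a).
  have [Ac|] := pselect (atlas c); last by exists (fun _ => cst 0).
  by have [a Ha] := HN c Ac; exists a.
have [a Ha] := choice HN'.
have adj c : atlas c -> adjoint_on (cimg c) (word_op N (a c)) (word_adj N (a c)).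
  by move=> Ac; apply: adjoint_on_words; [exact: open_cimg|exact: (Ha c Ac).1].
(* A chart is chosen at every point; by [chart_transpose_glue] any other chart and local adjoint
   give the same value, hence smoothness. *)
pose G v p := chart_transpose (cc p) (word_adj N (a (cc p))) v (cmap (cc p) p).
have GE c T S v p : atlas c -> local_rep c A T -> adjoint_on (cimg c) T S ->
    cdom c p -> G v p = chart_transpose c S v (cmap c p).
  move=> Ac AT TS cp; have [Ad dp] := Hcc p.
  exact: (chart_transpose_glue v dA Ad Ac (Ha _ Ad).2 (adj _ Ad) AT TS dp cp).
have /choice[B HB] v : exists Bv : Cinf M, forall p, Bv p = G v p.
  apply: Cinf_of_smooth => c Ac.
  apply: eq_smooth_on (chart_transpose_smooth v Ac (adj c Ac)); first exact: open_cimg.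
  move=> x cx; have [cq xE] := cimg_cinv cx.
  by rewrite /= (GE _ _ _ _ _ Ac (Ha _ Ac).2 (adj _ Ac) cq) xE.
have BE c T S : atlas c -> local_rep c A T -> adjoint_on (cimg c) T S ->
    forall v x, cimg c x -> B v (cinv c x) = chart_transpose c S v x.
  move=> Ac AT TS v x cx; have [cq xE] := cimg_cinv cx.
  by rewrite HB (GE _ _ _ _ _ Ac AT TS cq) xE.
have dB : diffop B.
  apply/diffopP; exists (N + 0)%N => c Ac.
  exists (fun F x => (dcoef rho c x)^-1 * word_adj N (a c) (dcoef rho c * F) x).
    apply: lop_mul; first exact: open_cimg.
      by apply: smooth_onV; [exact: open_cimg|exact: dcoef_smooth|exact: nv].
    have H1 := lop_word_adj (open_cimg c) N (Ha c Ac).1.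
    have H2 := lop_mul (open_cimg c) (dcoef_smooth rho Ac) (lop_id (cimg c)).
    exact: (lop_comp (open_cimg c) H1 H2).
  by move=> v x cx; rewrite (BE c _ _ Ac (Ha c Ac).2 (adj c Ac)).
have loc u v c : atlas c -> csupp_in u (cdom c) \/ csupp_in v (cdom c) ->
    dint rho (A u * v) = dint rho (u * B v).
  move=> Ac uv; apply: (dint_chart_transpose dA Ac (Ha c Ac).2 (adj c Ac) uv).
    by case: uv => [cu|cv]; [exact: csupp_inMl|apply: csupp_inMr; exact: diffop_csupp].
  move=> q cq; rewrite CinfE; congr (_ * _).
  by rewrite -{1}(cmapK cq) (BE c _ _ Ac (Ha c Ac).2 (adj c Ac))//; exact: cmap_cimg.
have linE D f g : diffop D -> D (f + g) = D f + D g.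
  by move=> dD; have := diffop_linear 1 f g dD; rewrite !scale1r.
exists B; split=> // u v [cu|cv].
- move: u cu; apply: csupp_ind.
  + by rewrite (diffop_zero dA) !mul0r.
  + move=> u w cu cw IHu IHw; rewrite (linE A)// !mulrDl !dintD ?IHu ?IHw//;
      apply: csupp_inMl => //; exact: diffop_csupp.
  + move=> p; have [c Ac cp] := atlas_cover p; exists (cdom c); split=> //.
      exact: open_cdom.
    by move=> u cu; apply: (loc _ _ c) => //; left.
- move: v cv; apply: csupp_ind.
  + by rewrite (diffop_zero dB) !mulr0.
  + move=> v w cv cw IHv IHw; rewrite (linE B)// !mulrDr !dintD ?IHv ?IHw//;
      apply: csupp_inMr => //; exact: diffop_csupp.
  + move=> p; have [c Ac cp] := atlas_cover p; exists (cdom c); split=> //.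
      exact: open_cdom.
    by move=> v cv; apply: (loc _ _ c) => //; right.
Qed.

End Transposition.

(** * Bidifferential operators and their partial transposes *)

Section BidifferentialOperators.
Variables (R : realType) (n : nat) (M : manifold R n).
Implicit Types (f g h u v : Cinf M) (p q : M) (c d : chart R M n)
  (B : Cinf M -> Cinf M -> Cinf M).

(** Grouping the terms by the derivatives of f presents [B f g] as a differential operator in f
    whose coefficients are differential operators in g. *)
Lemma bidiffop_words B : bidiffop B -> exists N, forall c, atlas c ->
  exists a : seq 'I_n -> seq 'I_n -> 'rV[R]_n -> R,
    (forall s t, smooth_on (cimg c) (a s t)) /\
    forall f g x, cimg c x -> B f g (cinv c x) =
      word_op N (fun s => word_op N (a s) (g \o cinv c)) (f \o cinv c) x.
Proof.
move=> [N HN]; exists N => c Ac; have [a [as_ aB]] := HN c Ac.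
exists a; split=> // f g x cx; rewrite aB//; apply: eq_bigr => k _.
rewrite exchange_big/=; apply: eq_bigr => s _.
rewrite /word_op mulr_suml; apply: eq_bigr => l _.
rewrite mulr_suml; apply: eq_bigr => t _.
by rewrite mulrAC.
Qed.

Lemma word_op_smooth N U (a : seq 'I_n -> 'rV[R]_n -> R) F : open U ->
  (forall s, smooth_on U (a s)) -> smooth_on U F -> smooth_on U (word_op N a F).
Proof. by move=> Uo as_; apply: (lop_smooth Uo (lop_word_op N as_)). Qed.

Lemma bidiffopl B g : bidiffop B -> diffop (fun f => B f g).
Proof.
move=> /bidiffop_words[N HN]; apply/diffopP; exists N => c Ac.
have [a [as_ aB]] := HN c Ac.
exists (word_op N (fun s => word_op N (a s) (g \o cinv c))); last by move=> f x; exact: aB.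
apply: lop_word_op.
by move=> s; apply: word_op_smooth => //; [exact: open_cimg|exact: Cinf_smooth].
Qed.

Lemma bidiffopC B : bidiffop B -> bidiffop (fun f g => B g f).
Proof.
move=> [N HN]; exists N => c Ac; have [a [as_ aB]] := HN c Ac.
exists (fun s t => a t s); split=> // f g x cx; rewrite aB// exchange_big/=.
apply: eq_bigr => k _; apply: eq_bigr => l _.
rewrite exchange_big/=; apply: eq_bigr => s _; apply: eq_bigr => t _.
by rewrite mulrAC.
Qed.

Lemma bidiffopr B f : bidiffop B -> diffop (B f).
Proof. by move=> /bidiffopC; exact: bidiffopl. Qed.

(* Transposing [g |-> B g f] and applying the result to [h] is again a
   differential operator in [f]. *)
Lemma bidiffop_transpose (rho : density M) B h : nonvanishing rho -> bidiffop B ->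
  exists2 K, diffop K &
    forall f g, csupp_in g setT -> dint rho (B g f * h) = dint rho (g * K f).
Proof.
move=> nv bB; have [N HN] := bidiffop_words bB.
have /choice[K HK] f : exists Kf : Cinf M,
    (forall c T S, atlas c -> local_rep c (fun g => B g f) T -> adjoint_on (cimg c) T S ->
       forall x, cimg c x -> Kf (cinv c x) = chart_transpose rho c S h x) /\
    (forall g, csupp_in g setT -> dint rho (B g f * h) = dint rho (g * Kf)).
  have [Bt [_ BtE Btint]] := diffop_transpose nv (bidiffopl f bB).
  exists (Bt h); split=> [c T S Ac BT TS x|g cg]; first exact: (BtE c T S).
  by apply: Btint; left.
exists K; last by move=> f g; exact: (HK f).2.
apply/diffopP; exists (N + N)%N => c Ac; have [a [as_ aB]] := HN c Ac.
have aas f s : smooth_on (cimg c) (word_op N (a s) (f \o cinv c)).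
  by apply: word_op_smooth => //; [exact: open_cimg|exact: Cinf_smooth].
exists (fun F => (fun x => (dcoef rho c x)^-1 *
    word_adj N (fun s => word_op N (a s) F) (dcoef rho c * (h \o cinv c)) x)).
  apply: lop_mul; first exact: open_cimg.
    by apply: smooth_onV; [exact: open_cimg|exact: dcoef_smooth|exact: nv].
  apply: (@lop_sum _ _ _ _ _ _ (fun (k : 'I_N.+1) F x => \sum_(s : k.-tuple 'I_n)
    (-1) ^+ size s * pder (rev s) (word_op N (a s) F * (dcoef rho c * (h \o cinv c))) x)) => k.
  apply: (@lop_sum _ _ _ _ _ _ (fun (s : k.-tuple 'I_n) F x =>
    (-1) ^+ size s * pder (rev s) (word_op N (a s) F * (dcoef rho c * (h \o cinv c))) x)) => s.
  apply: (@lop_mul _ _ _ (open_cimg c) _ _ (cst ((-1) ^+ size s))); first exact: smooth_on_cst.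
  have l1 : lop (cimg c) N (fun F => word_op N (a s) F * (dcoef rho c * (h \o cinv c))).
    apply: lop_ext (lop_mul (open_cimg c) (density_pull_smooth rho h Ac)
      (lop_word_op N (as_ s))) => F x _ _.
    by rewrite mulrC.
  apply: lop_le (lop_pder (open_cimg c) (rev s) l1).
  by rewrite leq_add2l size_rev size_tuple -ltnS.
move=> f x cx; apply: ((HK f).1 c _ _ Ac _ _ x cx).
  by move=> g y cy; exact: aB.
by apply: adjoint_on_words => //; exact: open_cimg.
Qed.

End BidifferentialOperators.

(** * Formal operators *)

Section TriangularSums.
Variable V : nmodType.

(** Both sides run over i + j + k = r; on the right, m is i + j. *)
Lemma triangle_assoc (F : nat -> nat -> nat -> V) r :
  \sum_(i < r.+1) \sum_(j < (r - i).+1) F i j (r - i - j)%N =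
  \sum_(m < r.+1) \sum_(i < m.+1) F i (m - i)%N (r - m)%N.
Proof.
elim: r F => [|r IH] F; first by rewrite !big_ord1.
rewrite big_ord_recl /= (eq_bigr (fun i : 'I_r.+1 =>
  \sum_(j < (r - i).+1) F i.+1 j (r - i - j)%N)); last by move=> i _; rewrite /bump subSS.
rewrite (IH (fun i => F i.+1)) !subn0.
rewrite [RHS](eq_bigr (fun m : 'I_r.+2 => F 0%N m (r.+1 - m)%N +
  \sum_(i < m) F i.+1 (m - i.+1)%N (r.+1 - m)%N)); last first.
  by move=> m _; rewrite big_ord_recl /= subn0.
rewrite big_split /=; congr (_ + _).
rewrite [RHS]big_ord_recl /= big_ord0 add0r; apply: eq_bigr => m _.
by rewrite /bump /= add1n subSS; apply: eq_bigr => i _; rewrite subSS.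
Qed.

Lemma rev_sum (F : nat -> nat -> V) r :
  \sum_(i < r.+1) F i (r - i)%N = \sum_(i < r.+1) F (r - i)%N i.
Proof.
rewrite (reindex_inj rev_ord_inj) /=; apply: eq_bigr => i _.
by rewrite subSS subKn// -ltnS.
Qed.

Lemma triangle_swap (F : nat -> nat -> V) r :
  \sum_(i < r.+1) \sum_(j < (r - i).+1) F i j =
  \sum_(j < r.+1) \sum_(i < (r - j).+1) F i j.
Proof.
rewrite (triangle_assoc (fun i j _ => F i j)) (triangle_assoc (fun j i _ => F i j)).
by apply: eq_bigr => m _; rewrite (rev_sum (fun i j => F i j)).
Qed.

End TriangularSums.

Lemma choose_suchP (T : Type) (x0 : T) (P : T -> Prop) :
  (exists x, P x) -> P (choose_such x0 P).
Proof. by rewrite /choose_such => exP; case: pselect => // e; case: (cid e). Qed.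

(** * Composition, locality and inversion of formal operators *)

Section FormalAlgebra.
Variables (R : realType) (n : nat) (M : manifold R n).
Implicit Types (f g h u v w : fser M) (A B C : fop M) (x y : Cinf M) (p : M).

Lemma diffop_add (D : Cinf M -> Cinf M) x y : diffop D -> D (x + y) = D x + D y.
Proof. by move=> dD; have := diffop_linear 1 x y dD; rewrite !scale1r. Qed.

Lemma diffop_bigsum (D : Cinf M -> Cinf M) (I : Type) (r : seq I) (F : I -> Cinf M) :
  diffop D -> D (\sum_(i <- r) F i) = \sum_(i <- r) D (F i).
Proof.
move=> dD; elim: r => [|i r IH]; first by rewrite !big_nil diffop_zero.
by rewrite !big_cons (diffop_add _ _ dD) IH.
Qed.

Lemma fapp_comp A B f : formal_diffop A ->
  fapp (fop_comp A B) f = fapp A (fapp B f).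
Proof.
move=> dA; apply/funext => r; rewrite /fapp /fop_comp.
rewrite -(triangle_assoc (fun i j k => A i (B j (f k)))).
by apply: eq_bigr => i _; rewrite diffop_bigsum.
Qed.

Lemma fop_compA A B C : formal_diffop A ->
  fop_comp A (fop_comp B C) = fop_comp (fop_comp A B) C.
Proof.
move=> dA; apply/funext => r; apply/funext => x; rewrite /fop_comp.
rewrite -(triangle_assoc (fun i j k => A i (B j (C k x)))).
by apply: eq_bigr => i _; rewrite diffop_bigsum.
Qed.

Lemma fapp_id f : fapp (@fop_id R n M) f = f.
Proof.
apply/funext => r; rewrite /fapp big_ord_recl /= subn0 big1 ?addr0// => i _.
Qed.

Lemma fop_comp1 A : formal_diffop A -> fop_comp A (@fop_id R n M) = A.
Proof.
move=> dA; apply/funext => r; apply/funext => x; rewrite /fop_comp.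
rewrite (rev_sum (fun i j => A i (fop_id j x))) big_ord_recl /= subn0.
by rewrite big1 ?addr0// => i _; rewrite /fop_id /= diffop_zero.
Qed.

Lemma fop_1comp A : fop_comp (@fop_id R n M) A = A.
Proof.
apply/funext => r; apply/funext => x; rewrite /fop_comp big_ord_recl /= subn0.
by rewrite big1 ?addr0.
Qed.

Lemma fapp_const A x r : formal_diffop A -> fapp A (fconst x) r = A r x.
Proof.
move=> dA; rewrite /fapp (rev_sum (fun i j => A i (fconst x j))).
rewrite big_ord_recl /= subn0 big1 ?addr0// => i _.
by rewrite /fconst /= diffop_zero.
Qed.

Lemma formal_diffop_id : formal_diffop (@fop_id R n M).
Proof.
case=> [|r]; first exact: diffop_id.
exact: diffop0.
Qed.

Lemma formal_diffop_comp A B : formal_diffop A -> formal_diffop B ->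
  formal_diffop (fop_comp A B).
Proof.
move=> dA dB r.
by apply: (@diffop_sum _ _ _ _ _ (fun (i : 'I_r.+1) x => A i (B (r - i)%N x))) => i;
  exact: diffop_comp.
Qed.

Lemma formal_diffop_csupp A f V : formal_diffop A -> (forall r, csupp_in (f r) V) ->
  forall r, csupp_in (fapp A f r) V.
Proof.
by move=> dA fV r; apply: csupp_in_sum => i; exact: diffop_csupp.
Qed.

(** Equality of germs order by order: the neighbourhood may shrink with r. *)
Definition near_eq p f g := forall r, \forall q \near p, f r q = g r q.

Lemma near_eq_at p f g r : near_eq p f g -> f r p = g r p.
Proof. by move=> fg; exact: nbhs_singleton (fg r). Qed.

Lemma near_sum (I : Type) (r : seq I) (F G : I -> Cinf M) p :
  (forall i, \forall q \near p, F i q = G i q) ->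
  \forall q \near p, (\sum_(i <- r) F i) q = (\sum_(i <- r) G i) q.
Proof.
move=> FG; elim: r => [|i r IH].
  by apply: nearW => q; rewrite !big_nil.
near=> q; rewrite !big_cons !CinfE; congr (_ + _); first by near: q; exact: FG.
by near: q; exact: IH.
Unshelve. all: by end_near. Qed.

Lemma fapp_near A f g p : formal_diffop A -> near_eq p f g ->
  near_eq p (fapp A f) (fapp A g).
Proof.
move=> dA fg r; apply: (@near_sum _ _ (fun i : 'I_r.+1 => A i (f (r - i)%N))
  (fun i : 'I_r.+1 => A i (g (r - i)%N))) => i.
exact: diffop_near_eq.
Qed.

(** Multiplication seen as an operator, so that [fop_inverse] also inverts series with leading
    coefficient 1. *)
Definition mulop h : fop M := fun r x => h r * x.

Lemma fapp_mulop h f : fapp (mulop h) f = fmul h f.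
Proof. by []. Qed.

Lemma formal_diffop_mulop h : formal_diffop (mulop h).
Proof. by move=> r; exact: (diffopM (h r) (@diffop_id R n M)). Qed.

Lemma fmulC f g : fmul f g = fmul g f.
Proof.
apply/funext => r; rewrite /fmul (rev_sum (fun i j => f i * g j)).
by apply: eq_bigr => i _; rewrite mulrC.
Qed.

Lemma fmulA f g h : fmul f (fmul g h) = fmul (fmul f g) h.
Proof.
apply/funext => r; rewrite /fmul.
rewrite [RHS](eq_bigr (fun m : 'I_r.+1 =>
  \sum_(i < m.+1) f i * g (m - i)%N * h (r - m)%N)); last first.
  by move=> m _; rewrite mulr_suml.
rewrite -(triangle_assoc (fun i j k => f i * g j * h k)).
apply: eq_bigr => i _; rewrite mulr_sumr.
by apply: eq_bigr => j _; rewrite mulrA.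
Qed.

Lemma fmulCA f g h : fmul f (fmul g h) = fmul g (fmul f h).
Proof. by rewrite fmulA (fmulC f g) -fmulA. Qed.

Lemma fmul_constl x f r : fmul (fconst x) f r = x * f r.
Proof.
by rewrite /fmul big_ord_recl /= subn0 big1 ?addr0// => i _; rewrite /fconst /= mul0r.
Qed.

Lemma fmul_csuppl f g V : (forall r, csupp_in (f r) V) -> forall r, csupp_in (fmul f g r) V.
Proof. by move=> fV r; apply: csupp_in_sum => i; exact: csupp_inMl. Qed.

Lemma fmul_csuppr f g V : (forall r, csupp_in (g r) V) -> forall r, csupp_in (fmul f g r) V.
Proof. by rewrite fmulC; exact: fmul_csuppl. Qed.

(** Solves A B = 1 order by order, B_(r+1) being minus the sum of the A_(i+1) B_(r-i). The argument
    k is fuel for this recursion, and the value no longer depends on it once k >= r. *)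
Fixpoint inv_approx A (k r : nat) (x : Cinf M) : Cinf M :=
  match k, r with
  | k'.+1, r'.+1 => - \sum_(i < r'.+1) A i.+1 (inv_approx A k' (r' - i)%N x)
  | _, _ => if r == 0%N then x else 0
  end.

Lemma inv_approx_stable A k l r : (r <= k)%N -> (r <= l)%N ->
  inv_approx A k r = inv_approx A l r.
Proof.
elim: k l r => [|k IH] [|l] [|r] //= rk rl; apply/funext => x; congr (- _).
by apply: eq_bigr => i _; rewrite (IH l)// (leq_trans (leq_subr _ _)).
Qed.

Lemma inv_approx_diffop A k r : formal_diffop A -> diffop (inv_approx A k r).
Proof.
move=> dA; elim: k r => [|k IH] [|r] /=; try exact: diffop_id; first exact: diffop0.
have H := @diffop_sum _ _ _ _ (index_enum 'I_r.+1)
  (fun i x => A i.+1 (inv_approx A k (r - i)%N x)) (fun i => diffop_comp (dA i.+1) (IH (r - i)%N)).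
have := diffopM (-1) H; congr diffop; apply/funext => x.
by rewrite mulN1r.
Qed.

Lemma fop_right_inverse A : formal_diffop A -> A 0%N = id ->
  exists B, [/\ formal_diffop B, B 0%N = id & fop_comp A B = @fop_id R n M].
Proof.
move=> dA A0; exists (fun r => inv_approx A r r); split=> //.
  by move=> r; exact: inv_approx_diffop.
apply/funext => -[|r]; apply/funext => x; rewrite /fop_comp.
  by rewrite big_ord1 A0.
rewrite big_ord_recl /= A0 addrC.
apply/eqP; rewrite subr_eq0; apply/eqP; apply: eq_bigr => i _.
by rewrite /bump /= add1n subSS (@inv_approx_stable A _ r)// leq_subr.
Qed.

Lemma fop_inverse A : formal_diffop A -> A 0%N = id -> exists B, is_fop_inv A B.
Proof.
move=> dA A0; have [B [dB B0 AB]] := fop_right_inverse dA A0.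
have [C [dC C0 BC]] := fop_right_inverse dB B0.
exists B; split=> //.
(* The right inverse B has itself a right inverse C, and A = A B C = C. *)
have -> : A = C; last by [].
by rewrite -[A]fop_comp1// -BC fop_compA// AB fop_1comp.
Qed.

End FormalAlgebra.

(** * The modular automorphism *)

Section FormalTranspose.
Variables (R : realType) (n : nat) (M : manifold R n) (rho : formal_density M).
Hypothesis nv : formal_nonvanishing rho.
Implicit Types (f g h u v w : fser M) (A B C : fop M) (x y : Cinf M) (p : M).

Definition fcsupp V f := forall r, csupp_in (f r) V.

Lemma fcsuppT f V : fcsupp V f -> fcsupp setT f.
Proof. by move=> fV r; apply: csupp_inT (fV r). Qed.

(* [H k] is the smooth function rho_k / rho_0. *)
Lemma formal_density_ratio : exists2 H : fser M, H 0%N = 1 &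
  forall w, fcsupp setT w -> forall r,
    formal_int rho w r = dint (rho 0%N) (fmul H w r).
Proof.
have /choice[H HE] k : exists h : Cinf M, (k = 0%N -> h = 1) /\
    forall x, csupp_in x setT -> dint (rho k) x = dint (rho 0%N) (h * x).
  case: k => [|k]; first by exists 1; split=> // x _; rewrite mul1r.
  by have [h Hh] := density_ratio (rho k.+1) nv; exists h.
exists H; first exact: (HE 0%N).1.
move=> w cw r; rewrite /formal_int /fmul dint_sum; last by move=> i; exact: csupp_inMr.
by apply: eq_bigr => k _; exact: (HE k).2.
Qed.

(* With rho = H rho_0 and t the transposition for rho_0, the transpose of A for rho
   is H^-1 A^t H. *)
Lemma formal_transpose A : formal_diffop A -> exists B, is_transpose rho A B.
Proof.
move=> dA; have [H H0 HE] := formal_density_ratio.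
have /choice[At HAt] r : exists D, diffop D /\ forall x y,
    csupp_in x setT \/ csupp_in y setT ->
    dint (rho 0%N) (A r x * y) = dint (rho 0%N) (x * D y).
  by have [D [dD _ DE]] := diffop_transpose nv (dA r); exists D.
have dAt : formal_diffop At by move=> r; exact: (HAt r).1.
have [Hi [dHi HHi _]] : exists Hi, is_fop_inv (mulop H) Hi.
  apply: fop_inverse; first exact: formal_diffop_mulop.
  by apply/funext => x; rewrite /mulop H0 mul1r.
have dmH := formal_diffop_mulop H.
have dB : formal_diffop (fop_comp Hi (fop_comp At (mulop H))).
  by do !apply: formal_diffop_comp.
exists (fop_comp Hi (fop_comp At (mulop H))); split=> // u v /[dup] + cv.
move=> /(_ _)/compactly_supportedP cv'.
have {}cv : fcsupp setT v by move=> r; apply/compactly_supportedP.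
apply/funext => r; rewrite HE; last exact: fmul_csuppr.
rewrite HE; last by apply: fmul_csuppr; exact: formal_diffop_csupp.
rewrite fmulCA [in RHS]fmulCA -[fmul H (fapp _ _)]fapp_mulop -fapp_comp//.
rewrite fop_compA// HHi fop_1comp fapp_comp// fapp_mulop.
have : fcsupp setT (fmul H v) by exact: fmul_csuppr.
move: (fmul H v) => w cw.
rewrite /fmul /fapp.
rewrite (eq_bigr (fun m : 'I_r.+1 => \sum_(i < m.+1) A i (u (m - i)%N) * w (r - m)%N));
  last by move=> m _; rewrite mulr_suml.
rewrite -(triangle_assoc (fun i j k => A i (u j) * w k)).
rewrite [in RHS](eq_bigr (fun i : 'I_r.+1 =>
  \sum_(j < (r - i).+1) u i * At j (w (r - i - j)%N))); last first.
  by move=> i _; rewrite mulr_sumr.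
rewrite (triangle_swap (fun i j => u i * At j (w (r - i - j)%N))).
rewrite !dint_sum; last 2 first.
- by move=> i; apply: csupp_in_sum => j; apply: csupp_inMr; exact: diffop_csupp.
- by move=> i; apply: csupp_in_sum => j; apply: csupp_inMr.
apply: eq_bigr => i _; rewrite !dint_sum; last 2 first.
- by move=> j; apply: csupp_inMr; exact: diffop_csupp.
- by move=> j; apply: csupp_inMr.
by apply: eq_bigr => j _; rewrite (HAt i).2; [rewrite subnAC|right].
Qed.

Lemma transposeP A : formal_diffop A -> is_transpose rho A (transpose rho A).
Proof. by move=> dA; apply: choose_suchP; exact: formal_transpose. Qed.

(** Testing against series constant in nu gives H f = H g at p, with H = rho / rho_0. As H has
    leading coefficient 1, this system is triangular in the order r. *)
Lemma formal_nondegenerate V p f g : open V -> V p ->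
  (forall u, fcsupp V u -> formal_int rho (fmul u f) = formal_int rho (fmul u g)) ->
  forall r, f r p = g r p.
Proof.
move=> Vo Vp H; have [h h0 hE] := formal_density_ratio.
have E r : (fmul h f r) p = (fmul h g r) p.
  apply/eqP; rewrite -subr_eq0 -CinfBE; apply/eqP.
  apply: (dint_nondegenerate nv Vo Vp) => x xV.
  have cx : fcsupp V (fconst x).
    by case=> [|k] //; exact: csupp_in0.
  have := congr1 (fun F => F r) (H _ cx).
  have cxT := fcsuppT cx.
  rewrite !hE; [|exact: fmul_csuppl..].
  rewrite fmulCA [in RHS]fmulCA !fmul_constl => E.
  rewrite mulrBr dintB; [|exact/csupp_inT/(csupp_inMl _ xV)..].
  by rewrite E subrr.
move=> r; elim/ltn_ind: r => r IH.
have fmulE k : fmul h k r = k r + \sum_(i < r) h i.+1 * k (r - i.+1)%N.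
  by rewrite /fmul big_ord_recl /= subn0 h0 mul1r.
have := E r; rewrite !fmulE !CinfDE !Cinf_sumE.
rewrite (eq_bigr (fun i : 'I_r => (h i.+1 * g (r - i.+1)%N) p)); first by move=> /addIr.
move=> i _; rewrite !CinfME IH//.
by case: (r) i => [[]//|k] i; rewrite subSS ltnS leq_subr.
Qed.

Lemma formal_nondegenerateT f g :
  (forall u, fcsupp setT u -> formal_int rho (fmul u f) = formal_int rho (fmul u g)) ->
  f = g.
Proof.
move=> H; apply/funext => r; apply: Cinf_ext => p.
exact: (formal_nondegenerate openT I H).
Qed.

End FormalTranspose.

(** * The operators J and Q, and the first-order term of Q *)

Section ModularAutomorphism.
Variables (R : realType) (n : nat) (M : manifold R n) (P : poisson M).
Variables (S : star_product P) (rho : formal_density M).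
Hypothesis nv : formal_nonvanishing rho.
Implicit Types (f g h u v w : fser M) (A B C : fop M) (x y : Cinf M) (p : M).
Local Notation tau := (formal_int rho).
Local Notation "f ** g" := (star S f g) (at level 40, left associativity).

Lemma starA f g h : f ** (g ** h) = f ** g ** h.
Proof. exact: star_assoc. Qed.

Lemma star_right_diffop f : formal_diffop (star_right S f).
Proof.
move=> r; apply: (@diffop_sum _ _ _ _ _
  (fun (i : 'I_r.+1) x => scoef S i x (f (r - i)%N))) => i.
exact: bidiffopl (scoef_bidiffop S i).
Qed.

Lemma star_rightE f g : fapp (star_right S f) g = g ** f.
Proof.
apply/funext => r; rewrite /fapp /star_right /star /formal_product.
rewrite -(triangle_assoc (fun i l j => scoef S i (g j) (f l))).
apply: eq_bigr => i _.
by rewrite (rev_sum (fun l j => scoef S i (g j) (f l))).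
Qed.

Lemma star_csuppl f g V : fcsupp V f -> fcsupp V (f ** g).
Proof.
move=> fV r; apply: csupp_in_sum => i; apply: csupp_in_sum => j.
exact: diffop_csupp (bidiffopl (g (r - i - j)%N) (scoef_bidiffop S i)) (fV j).
Qed.

Lemma star_near f f' g g' p : near_eq p f f' -> near_eq p g g' ->
  near_eq p (f ** g) (f' ** g').
Proof.
move=> ff gg r.
apply: (@near_sum _ _ _ _ _ (fun i : 'I_r.+1 =>
    \sum_(j < (r - i).+1) scoef S i (f j) (g (r - i - j)%N))
  (fun i : 'I_r.+1 => \sum_(j < (r - i).+1) scoef S i (f' j) (g' (r - i - j)%N))) => i.
apply: (@near_sum _ _ _ _ _ (fun j : 'I_(r - i).+1 => scoef S i (f j) (g (r - i - j)%N))
  (fun j : 'I_(r - i).+1 => scoef S i (f' j) (g' (r - i - j)%N))) => j.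
have bS := scoef_bidiffop S i.
have := diffop_near_eq (bidiffopl (g (r - i - j)%N) bS) (ff j).
have := diffop_near_eq (bidiffopr (f' j) bS) (gg (r - i - j)%N).
by apply: filterS2 => q /= -> ->.
Qed.

(** Let K_(i,k) f be the transpose of g |-> C_i(g, f) for rho_0, applied to H_k. Then the
    rho_0-integral of H times the star product of g and f is that of g . L f, with L_m the sum of
    the K_(m-k,k), and J = H^-1 L does the job. *)
Lemma ex_J_formula : exists2 J, formal_diffop J &
  forall f g, fcsupp setT g -> tau (g ** f) = tau (fmul g (fapp J f)).
Proof.
have [H H0 HE] := formal_density_ratio nv.
have HK (ik : nat * nat) : exists K, diffop K /\ forall x y, csupp_in y setT ->
    dint (rho 0%N) (scoef S ik.1 y x * H ik.2) = dint (rho 0%N) (y * K x).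
  by have [K dK KE] := bidiffop_transpose (H ik.2) nv (scoef_bidiffop S ik.1); exists K.
have [K {}HK] := choice HK.
pose L : fop M := fun m x => \sum_(k < m.+1) K ((m - k)%N, k : nat) x.
have dL : formal_diffop L.
  by move=> m; apply: (@diffop_sum _ _ _ _ _ (fun (k : 'I_m.+1) x => K ((m - k)%N, k : nat) x))
    => k; exact: (HK _).1.
have [Hi [dHi HHi _]] : exists Hi, is_fop_inv (mulop H) Hi.
  apply: fop_inverse; first exact: formal_diffop_mulop.
  by apply/funext => x; rewrite /mulop H0 mul1r.
exists (fop_comp Hi L); first exact: formal_diffop_comp.
move=> f g cg; apply/funext => r; rewrite HE; last exact: star_csuppl.
rewrite HE; last exact: fmul_csuppl.
rewrite fmulCA -[fmul H (fapp _ _)]fapp_mulop -fapp_comp; last exact: formal_diffop_mulop.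
rewrite fop_compA; last exact: formal_diffop_mulop.
rewrite HHi fop_1comp.
pose X k i j := dint (rho 0%N) (g j * K (i, k) (f (r - k - i - j)%N)).
(* [X k i j] collects the contribution of H_k, C_i and g_j; the index of f is what remains of r. The
   next step moves j outermost, to match the product of g with L f. *)
transitivity (\sum_(k < r.+1) \sum_(i < (r - k).+1) \sum_(j < (r - k - i).+1) X k i j).
  have cS i (y x : Cinf M) : csupp_in y setT -> csupp_in (scoef S i y x) setT.
    by move=> cy; exact: diffop_csupp (bidiffopl x (scoef_bidiffop S i)) cy.
  rewrite /fmul dint_sum; last by move=> k; apply: csupp_inMr; exact: star_csuppl.
  apply: eq_bigr => k _; rewrite /star /formal_product mulr_sumr dint_sum; last first.
    by move=> i; apply: csupp_inMr; apply: csupp_in_sum => j; exact: cS.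
  apply: eq_bigr => i _; rewrite mulr_sumr dint_sum; last first.
    by move=> j; apply: csupp_inMr; exact: cS.
  by apply: eq_bigr => j _; rewrite mulrC (HK (i : nat, k : nat)).2.
transitivity (\sum_(j < r.+1) \sum_(k < (r - j).+1) \sum_(i < (r - j - k).+1) X k i j).
  rewrite -(triangle_swap (fun k j => \sum_(i < (r - j - k).+1) X k i j)).
  apply: eq_bigr => k _; rewrite (triangle_swap (X k)); apply: eq_bigr => j _.
  by rewrite subnAC.
rewrite /fmul dint_sum; last by move=> j; exact: csupp_inMl.
apply: eq_bigr => j _; rewrite /fapp /L.
rewrite -(triangle_assoc (fun k i l => K (i, k) (f l))).
rewrite mulr_sumr dint_sum; last by move=> k; exact: csupp_inMl.
apply: eq_bigr => k _; rewrite mulr_sumr dint_sum; last by move=> i; exact: csupp_inMl.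
apply: eq_bigr => i _; rewrite /X.
have -> // : (r - k - i - j = r - j - k - i)%N.
by rewrite (subnAC (r - k)%N) (subnAC r k).
Qed.

(** The constant 1 need not have compact support, so the transpose of R_f is applied to a bump
    function chi instead. This changes nothing when tested against u supported where chi = 1, by
    locality. *)
Lemma J_opP : formal_diffop (J_op S rho) /\
  forall f g, fcsupp setT g -> tau (g ** f) = tau (fmul g (fapp (J_op S rho) f)).
Proof.
have [J' dJ' J'E] := ex_J_formula.
have J'_transpose f : fapp J' f = fapp (transpose rho (star_right S f)) (fconst 1).
  apply/funext => r; apply: Cinf_ext => p.
  have [chi [chiT _ chi1]] := smooth_bump (p := p) openT I.
  have [V [Vo Vp] VE] : exists2 V, open_nbhs p V & V `<=` [set q | chi q = 1].
    have fg' : nbhs p [set q | chi q = 1] by exact: chi1.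
    by rewrite nbhsE in fg'.
  have [dT TE] := transposeP nv (star_right_diffop f).
  apply: (formal_nondegenerate nv Vo Vp) => u uV.
  rewrite -J'E; last exact: fcsuppT uV.
  have cchi k : compactly_supported (fconst chi k).
    by apply/compactly_supportedP; case: k => [|k] //; exact: csupp_in0.
  have /= := TE u (fconst chi) cchi.
  rewrite star_rightE.
  have -> : fmul (u ** f) (fconst chi) = u ** f.
    apply/funext => k; rewrite fmulC fmul_constl; apply: Cinf_ext => q; rewrite CinfE.
    have [K [_ KV u0]] := star_csuppl f uV k.
    have [/KV/VE|/u0 ->] := pselect (K q); last by rewrite mulr0.
    by move=> /= ->; rewrite mul1r.
  move=> ->; congr formal_int; apply/funext => k; apply: eq_bigr => i _.
  apply: Cinf_ext => q; rewrite !CinfE.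
  have [K [_ KV u0]] := uV i.
  have [Kq|/u0 ->] := pselect (K q); last by rewrite !mul0r.
  congr (_ * _); apply: near_eq_at; apply: fapp_near => // -[|l]; last exact: nearW.
  by apply: filterS (open_nbhs_nbhs (conj Vo (KV _ Kq))) => q' /VE.
have [dJ JE] : is_J S rho (J_op S rho).
  by apply: choose_suchP; exists J'; split.
by split=> // f g cg; rewrite JE -J'_transpose; exact: J'E.
Qed.

Let J := J_op S rho.
Let Ji := fop_inv J.
Let K := transpose rho Ji.
Let Q := Q_op S rho.

Let dJ : formal_diffop J. Proof. exact: J_opP.1. Qed.

Let JE f g : fcsupp setT g -> tau (g ** f) = tau (fmul g (fapp J f)).
Proof. exact: J_opP.2. Qed.

(** At order 0 the defining relation of J compares the rho_0-integrals of y x and y . J_0 x. *)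
Lemma J_op0 : J 0%N = id.
Proof.
apply/funext => x; apply: Cinf_ext => p; apply/eqP; rewrite -subr_eq0 -CinfBE; apply/eqP.
apply: (dint_nondegenerate nv openT) => // y cy.
have cy' : fcsupp setT (fconst y) by case=> [|k] //; exact: csupp_in0.
have := congr1 (fun F => F 0%N) (JE (fconst x) cy').
rewrite /formal_int !big_ord1 /star /formal_product !big_ord1 /fmul big_ord1 /=.
rewrite fapp_const// scoef0 => E.
by rewrite mulrBr dintB ?E ?subrr//; exact: csupp_inMl.
Qed.

Lemma Ji_inv : is_fop_inv J Ji.
Proof. by apply: choose_suchP; apply: fop_inverse; [exact: dJ|exact: J_op0]. Qed.

Let dJi : formal_diffop Ji. Proof. by have [] := Ji_inv. Qed.

Let dK : formal_diffop K. Proof. by have [] := transposeP nv dJi. Qed.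

Lemma Q_diffop : formal_diffop Q.
Proof. exact: formal_diffop_comp. Qed.

Lemma JiK f : fapp Ji (fapp J f) = f.
Proof. by rewrite -fapp_comp//; have [_ _ ->] := Ji_inv; rewrite fapp_id. Qed.

Lemma JKi f : fapp J (fapp Ji f) = f.
Proof. by rewrite -fapp_comp//; have [_ -> _] := Ji_inv; rewrite fapp_id. Qed.

Lemma modular_trace f g : fcsupp setT f -> fcsupp setT g ->
  tau (g ** f) = tau (fapp Q f ** g).
Proof.
move=> cf cg; have cQf : fcsupp setT (fapp Q f).
  by apply: formal_diffop_csupp => //; exact: Q_diffop.
rewrite (JE _ cQf) (JE _ cg) fmulC [in RHS]fmulC /Q /Q_op fapp_comp//.
have [_ <-] := transposeP nv dJi; first by rewrite JiK fmulC.
move=> r; apply/compactly_supportedP; exact: formal_diffop_csupp.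
Qed.

Lemma trace_nondegenerate f f' : fcsupp setT f -> fcsupp setT f' ->
  (forall g, fcsupp setT g -> tau (f ** g) = tau (f' ** g)) -> f = f'.
Proof.
move=> cf cf' H; apply: (formal_nondegenerateT nv) => u cu.
(* Choosing g = J^-1 u turns the star pairing with g into the pointwise pairing with u. *)
have cJi : fcsupp setT (fapp Ji u) by exact: formal_diffop_csupp.
by have := H _ cJi; rewrite (JE _ cf) (JE _ cf') JKi fmulC [in RHS]fmulC.
Qed.

Lemma Q_star_csupp f g : fcsupp setT f -> fcsupp setT g ->
  fapp Q (f ** g) = fapp Q f ** fapp Q g.
Proof.
move=> cf cg.
have cQ h : fcsupp setT h -> fcsupp setT (fapp Q h).
  by move=> ch; apply: formal_diffop_csupp => //; exact: Q_diffop.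
apply: trace_nondegenerate => [||h ch].
- by apply: cQ; exact: star_csuppl.
- by apply: star_csuppl; exact: cQ.
rewrite -modular_trace//; last exact: star_csuppl.
rewrite starA modular_trace//; last exact: star_csuppl.
rewrite starA modular_trace//; last by apply: star_csuppl; exact: cQ.
by rewrite starA.
Qed.

Lemma cutoff p f : exists2 f', fcsupp setT f' & near_eq p f f'.
Proof.
have [chi [chiT _ chi1]] := smooth_bump (p := p) openT I.
exists (fmul (fconst chi) f).
  by apply: fmul_csuppl => -[|k] //; exact: csupp_in0.
move=> r; apply: filterS chi1 => q chiq.
by rewrite fmul_constl CinfE chiq mul1r.
Qed.

Theorem Q_star f g : fapp Q (f ** g) = fapp Q f ** fapp Q g.
Proof.
apply/funext => r; apply: Cinf_ext => p.
have [f' cf' ff'] := cutoff p f; have [g' cg' gg'] := cutoff p g.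
rewrite (near_eq_at r (fapp_near Q_diffop (star_near ff' gg'))) Q_star_csupp//.
by apply/esym/near_eq_at/star_near; apply: fapp_near => //; exact: Q_diffop.
Qed.

(** At order 0 the star product is commutative, so [modular_trace] forces Q_0 y = y for compactly
    supported y; locality extends this to all functions. *)
Lemma Q_op0 : Q 0%N = id.
Proof.
apply/funext => x; apply: Cinf_ext => p.
have [chi [chiT _ chi1]] := smooth_bump (p := p) openT I.
have -> : Q 0%N x p = Q 0%N (chi * x) p.
  apply: diffop_near; first exact: Q_diffop.
  by apply: filterS chi1 => q chiq; rewrite CinfE chiq mul1r.
transitivity ((chi * x) p); last by rewrite CinfE (nbhs_singleton chi1) mul1r.
have cx : csupp_in (chi * x) setT by exact: csupp_inMl.
move: (chi * x) cx => y cy.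
apply/eqP; rewrite -subr_eq0 -CinfBE; apply/eqP.
apply: (dint_nondegenerate nv openT) => // z cz.
have cy' : fcsupp setT (fconst y) by case=> [|k] //; exact: csupp_in0.
have cz' : fcsupp setT (fconst z) by case=> [|k] //; exact: csupp_in0.
have := congr1 (fun F => F 0%N) (modular_trace cy' cz').
rewrite /formal_int !big_ord1 /star /formal_product !big_ord1 /=.
rewrite (fapp_const _ _ Q_diffop) !scoef0 => E.
by rewrite mulrBr dintB; [rewrite E mulrC subrr|exact: csupp_inMl..].
Qed.

(* The coefficient of nu in [modular_trace]. *)
Lemma Q_op1_csupp x y : csupp_in x setT -> csupp_in y setT ->
  dint (rho 0%N) (P x y) = - dint (rho 0%N) (y * Q 1%N x).
Proof.
move=> cx cy.
have cx' : fcsupp setT (fconst x) by case=> [|k] //; exact: csupp_in0.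
have cy' : fcsupp setT (fconst y) by case=> [|k] //; exact: csupp_in0.
have := congr1 (fun F => F 1%N) (modular_trace cx' cy').
rewrite /formal_int !big_ord_recl !big_ord0 /= /star /formal_product.
rewrite !big_ord_recl !big_ord0 !addr0 /= /bump /= !(fapp_const _ _ Q_diffop) Q_op0.
rewrite /fconst /= !scoef0 !(mulr0, mul0r, add0r) (mulrC y x) => /addIr.
have cC z z' : csupp_in z setT -> csupp_in (scoef S 1%N z z') setT.
  by move=> cz; exact: diffop_csupp (bidiffopl z' (scoef_bidiffop S 1)) cz.
have cQy : csupp_in (Q 1%N x * y) setT by exact: csupp_inMr.
rewrite (dintD _ cQy (cC x y cx)) -(scoef1 S) (dintB _ (cC x y cx) (cC y x cy)) => ->.
by rewrite mulrC opprD addrCA subrr addr0.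
Qed.

(* Near the support of u, x may be replaced by the compactly supported chi * x. *)
Lemma Q_op1_divergence x : is_divergence (rho 0%N) (hamiltonian P x) (Q 1%N x).
Proof.
move=> u /compactly_supportedP; rewrite /hamiltonian.
have PE y z : P y z = scoef S 1%N y z - scoef S 1%N z y by rewrite (scoef1 S).
have dP y : diffop (P y).
  have bS := scoef_bidiffop S 1.
  have := diffopD (bidiffopr y bS) (diffopM (-1) (bidiffopl y bS)).
  by congr diffop; apply/funext => z; rewrite PE mulN1r.
move: u; apply: csupp_ind.
- by rewrite (diffop_zero (dP x)) mul0r dint0 oppr0.
- move=> u v cu cv IHu IHv; rewrite (diffop_add _ _ (dP x)) mulrDl.
  rewrite (dintD _ (diffop_csupp (dP x) cu) (diffop_csupp (dP x) cv)) IHu IHv.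
  by rewrite dintD ?opprD//; exact: csupp_inMl.
move=> p; have [chi [chiT _ chi1]] := smooth_bump (p := p) openT I.
have [V [Vo Vp] VE] : exists2 V, open_nbhs p V & V `<=` [set q | chi q = 1].
  have fg' : nbhs p [set q | chi q = 1] by exact: chi1.
  by rewrite nbhsE in fg'.
exists V; split=> // u uV.
have cx : csupp_in (chi * x) setT by exact: csupp_inMl.
have [K' [cK' KV u0]] := uV.
have xE q : K' q -> \forall q' \near q, x q' = (chi * x) q'.
  move=> Kq; apply: filterS (open_nbhs_nbhs (conj Vo (KV _ Kq))) => q' /VE chiq.
  by rewrite CinfE (chiq : chi q' = 1) mul1r.
have -> : P x u = P (chi * x) u.
  have Pu0 y q : ~ K' q -> P y u q = 0.
    have uK : csupp_in u K' by exists K'; split.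
    by have [L [_ LK Pu0]] := diffop_csupp (dP y) uK => Kq; apply: Pu0 => /LK.
  apply: Cinf_ext => q; have [Kq|Kq] := pselect (K' q); last by rewrite !Pu0.
  rewrite !PE !CinfE; congr (_ - _).
    exact: (diffop_near (bidiffopl u (scoef_bidiffop S 1)) (xE q Kq)).
  exact: (diffop_near (bidiffopr u (scoef_bidiffop S 1)) (xE q Kq)).
rewrite (Q_op1_csupp cx (csupp_inT uV)); congr (- dint _ _).
apply: Cinf_ext => q; rewrite !CinfE; have [Kq|/u0 ->] := pselect (K' q).
  by congr (_ * _); apply/esym/(diffop_near (Q_diffop 1) (xE q Kq)).
by rewrite !mul0r.
Qed.

(** [divergence] is a choice, so being a divergence is not enough; uniqueness comes from
    nondegeneracy of the rho_0-pairing. *)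
Lemma Q_op1 x : Q 1%N x = divergence (rho 0%N) (hamiltonian P x).
Proof.
have H : is_divergence (rho 0%N) (hamiltonian P x)
    (divergence (rho 0%N) (hamiltonian P x)).
  by apply: choose_suchP; exists (Q 1%N x); exact: Q_op1_divergence.
apply: Cinf_ext => p; apply/eqP; rewrite -subr_eq0 -CinfBE; apply/eqP.
apply: (dint_nondegenerate nv openT) => // u cu.
rewrite mulrBr dintB; [|exact: csupp_inMl..].
have /compactly_supportedP cu' := cu.
have := H u cu'; rewrite (Q_op1_divergence x cu') => /oppr_inj ->.
by rewrite subrr.
Qed.

End ModularAutomorphism.

(** * The logarithm *)

Section BinomialPolynomials.
Variable R : numFieldType.

Definition binom_poly (j : nat) : {poly R} :=
  (j`!%:R)^-1 *: \prod_(i < j) ('X - i%:R%:P).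

Lemma binom_polyE j k : (binom_poly j).[k%:R] = 'C(k, j)%:R.
Proof.
have j0 : (j`!%:R : R) != 0 by rewrite pnatr_eq0 -lt0n fact_gt0.
apply: (mulfI j0); rewrite hornerZ mulVKf// -natrM mulnC bin_ffact.
elim: j {j0} => [|j IH]; first by rewrite big_ord0 hornerC ffactn0.
rewrite big_ord_recr hornerM IH hornerXsubC ffactnSr natrM.
have [jk|kj] := leqP j k; first by rewrite natrB.
by rewrite ffact_small// !mul0r.
Qed.

Lemma binom_poly_coef0 j : (binom_poly j)`_0 = (j == 0%N)%:R.
Proof.
rewrite -horner_coef0 -[0](mulr0n 1) binom_polyE bin0n.
by [].
Qed.

(** These are the coefficients of log (1 + z): the coefficient of k in (1 + z)^k, taken in front of
    z^(j+1). *)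
Lemma binom_poly_coef1 j : (binom_poly j.+1)`_1 = (-1) ^+ j / j.+1%:R.
Proof.
rewrite coefZ big_ord_recl /= subr0 coefXM /= -horner_coef0 horner_prod.
rewrite (eq_bigr (fun i : 'I_j => -1 * i.+1%:R)); last first.
  by move=> i _; rewrite hornerXsubC sub0r mulN1r.
rewrite big_split /= prodr_const card_ord.
have -> : \prod_(i < j) (i.+1%:R : R) = j`!%:R.
  by rewrite -natr_prod fact_prod big_add1 big_mkord.
rewrite factS natrM invfM mulrCA -[in LHS](mulrA (j.+1%:R)^-1) mulVf ?mulr1//.
Qed.

Lemma poly_eq_on_nat (p q : {poly R}) : (forall k : nat, p.[k%:R] = q.[k%:R]) -> p = q.
Proof.
move=> pq; apply/eqP; rewrite -subr_eq0; apply/eqP; set d := p - q.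
apply: (@roots_geq_poly_eq0 _ _ [seq (k%:R : R) | k <- iota 0 (size d)]).
- by apply/allP => _ /mapP[k _ ->]; rewrite rootE /d hornerD hornerN pq subrr.
- by rewrite map_inj_uniq ?iota_uniq// => i j /eqP; rewrite eqr_nat => /eqP.
- by rewrite size_map size_iota.
Qed.

End BinomialPolynomials.

(** * The logarithm of an automorphism equal to 1 modulo nu *)

Section Logarithm.
Variables (R : realType) (n : nat) (M : manifold R n) (P : poisson M).
Variables (S : star_product P) (Q : fop M).
Hypotheses (dQ : formal_diffop Q) (Q0 : Q 0%N = id).
Implicit Types (f g : fser M) (x : Cinf M).

Let N := fop_sub Q (@fop_id R n M).

Lemma formal_diffop_sub (A B : fop M) : formal_diffop A -> formal_diffop B ->
  formal_diffop (fop_sub A B).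
Proof.
move=> dA dB r; have := diffopD (dA r) (diffopM (-1) (dB r)).
by congr diffop; apply/funext => x; rewrite mulN1r.
Qed.

Let dN : formal_diffop N.
Proof. by apply: formal_diffop_sub => //; exact: formal_diffop_id. Qed.

Lemma fop_exp_diffop (A : fop M) k : formal_diffop A -> formal_diffop (fop_exp A k).
Proof.
move=> dA; elim: k => [|k IH]; first exact: formal_diffop_id.
exact: (formal_diffop_comp dA IH).
Qed.

(** N has no term of order 0, so each factor N raises the order in nu by at least one. *)
Lemma fop_exp_small k r x : (r < k)%N -> fop_exp N k r x = 0.
Proof.
elim: k r => [//|k IH] r rk.
rewrite [LHS](_ : _ = \sum_(i < r.+1) N i (fop_exp N k (r - i)%N x))//.
apply: big1 => -[[|i] ir] _ /=; first by rewrite /N /fop_sub Q0 subrr.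
rewrite IH ?diffop_zero//.
by move: rk ir; case: r => // r rk ir; rewrite subSS (leq_ltn_trans (leq_subr _ _)).
Qed.

Lemma fop_log_partial_stable k r : (r <= k)%N ->
  fop_log_partial Q k r = fop_log_partial Q r r.
Proof.
move=> rk; apply/funext => x; rewrite /fop_log_partial.
rewrite (@big_cat_nat _ _ _ r.+1)//= [X in _ + X]big1_seq ?addr0// => j.
by rewrite mem_index_iota => /and3P[_ rj _]; rewrite fop_exp_small// scaler0.
Qed.

Lemma fop_logE k r : (r <= k)%N -> fop_log Q r = fop_log_partial Q k r.
Proof.
move=> rk; have H : nu_adic_limit (fop_log_partial Q) (fop_log Q).
  apply: choose_suchP; exists (fun r => fop_log_partial Q r r) => r'.
  by exists r' => k' ?; exact: fop_log_partial_stable.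
have [K HK] := H r; rewrite -(HK (maxn K k)) ?leq_maxl//.
rewrite fop_log_partial_stable ?(leq_trans rk) ?leq_maxr//.
by rewrite -(fop_log_partial_stable rk).
Qed.

Lemma fop_log_diffop : formal_diffop (fop_log Q).
Proof.
move=> r; rewrite (fop_logE (leqnn r)).
apply: (@diffop_sum _ _ _ _ _
  (fun j x => ((-1) ^+ j.+1 / j%:R : R) *: fop_exp N j r x)) => j.
have := diffopM (((-1) ^+ j.+1 / j%:R : R) *: (1 : Cinf M)) (fop_exp_diffop j dN r).
congr diffop; apply/funext => x; apply: Cinf_ext => p.
by rewrite CinfME !CinfZE Cinf1E mulr1.
Qed.

Lemma fop_log0 x : fop_log Q 0%N x = 0.
Proof. by rewrite (fop_logE (leqnn 0)) /fop_log_partial big_geq. Qed.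

Lemma fop_log1 x : fop_log Q 1%N x = Q 1%N x.
Proof.
rewrite (fop_logE (leqnn 1)) /fop_log_partial big_nat1 sqrrN expr1n divr1 scale1r.
have -> : fop_exp N 1 = N by exact: fop_comp1.
by rewrite /N /fop_sub /fop_id /= subr0.
Qed.

Let Npow j f := fapp (fop_exp N j) f.

(* [expansion B s f r] is the coefficient of nu^r in \sum_(j < B) s_j (Q - 1)^j f. *)
Definition expansion B (s : nat -> R) f : fser M :=
  fun r => \sum_(j < B) s j *: Npow j f r.

Lemma Npow0 f : Npow 0 f = f. Proof. exact: fapp_id. Qed.

Lemma NpowS j f : Npow j.+1 f = fapp N (Npow j f).
Proof. exact: fapp_comp. Qed.

Lemma Npow_small j f r : (r < j)%N -> Npow j f r = 0.
Proof.
move=> rj; apply: big1 => -[i ir] _ /=; rewrite fop_exp_small//.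
exact: leq_ltn_trans rj.
Qed.

Lemma fapp_Q f r : fapp Q f r = f r + fapp N f r.
Proof.
rewrite -[f r in RHS](congr1 (fun h => h r) (fapp_id f)) /fapp -big_split /=.
by apply: eq_bigr => i _; rewrite /N /fop_sub addrC subrK.
Qed.

(** The binomial expansion of (1 + N)^k, proved by Pascal's rule. The cut at B > r loses nothing at
    order r and is independent of k, which makes the result polynomial in k. *)
Lemma iter_Q B k f r : (r < B)%N ->
  iter k (fapp Q) f r = expansion B (fun j => 'C(k, j)%:R) f r.
Proof.
case: B => // B; elim: k r => [|k IH] r rB.
  rewrite /expansion big_ord_recl /= bin0 scale1r Npow0 big1 ?addr0// => i _.
  by rewrite bin0n /= scale0r.
rewrite iterS fapp_Q IH//.
have -> : fapp N (iter k (fapp Q) f) r = \sum_(j < B.+1) 'C(k, j)%:R *: Npow j.+1 f r.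
  transitivity (\sum_(i < r.+1) \sum_(j < B.+1) 'C(k, j)%:R *: N i (Npow j f (r - i)%N)).
    apply: eq_bigr => i _; rewrite IH; last exact: leq_ltn_trans (leq_subr _ _) rB.
    rewrite diffop_bigsum//; apply: eq_bigr => j _.
    have := diffop_linear ('C(k, j)%:R) (Npow j f (r - i)%N) 0 (dN i).
    by rewrite !addr0 diffop_zero// addr0.
  rewrite exchange_big /=; apply: eq_bigr => j _.
  by rewrite -scaler_sumr NpowS.
rewrite /expansion [X in X + _]big_ord_recl [RHS]big_ord_recl /= !bin0 -addrA; congr (_ + _).
rewrite big_ord_recr /= [Npow B.+1 f r]Npow_small// scaler0 addr0 -big_split /=.
by apply: eq_bigr => i _; rewrite /bump /= add1n binS natrD scalerDl addrC.
Qed.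

Lemma fop_log_expansion B f r : (r < B)%N ->
  fapp (fop_log Q) f r = expansion B (fun j => (binom_poly R j)`_1) f r.
Proof.
case: B => // B rB.
rewrite /expansion big_ord_recl /= [(binom_poly R 0)`_1](_ : _ = 0); last first.
  by rewrite coefZ big_ord0 coefC mulr0.
rewrite scale0r add0r.
transitivity (\sum_(i < r.+1) \sum_(j < B) ((-1) ^+ j / j.+1%:R : R) *:
    fop_exp N j.+1 i (f (r - i)%N)).
  apply: eq_bigr => -[i ir] _ /=; rewrite (@fop_logE B); last first.
    exact: leq_trans ir rB.
  rewrite /fop_log_partial big_add1 big_mkord; apply: eq_bigr => j _.
  by rewrite !exprS mulrA mulrNN mulr1 mul1r.
rewrite exchange_big /=; apply: eq_bigr => j _.
by rewrite binom_poly_coef1 scaler_sumr.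
Qed.

(** The identity is the constant term in k of Q^k. In this form it can be compared termwise with the
    expansion of log Q. *)
Lemma expansion_delta B f r : (r < B)%N ->
  f r = expansion B (fun j => (binom_poly R j)`_0) f r.
Proof.
case: B => // B rB; rewrite /expansion big_ord_recl /= binom_poly_coef0 /= scale1r Npow0.
by rewrite big1 ?addr0// => i _; rewrite binom_poly_coef0 /= scale0r.
Qed.

Lemma star_low f f' g g' r : (forall j, (j <= r)%N -> f j = f' j) ->
  (forall j, (j <= r)%N -> g j = g' j) -> star S f g r = star S f' g' r.
Proof.
move=> ff gg; apply: eq_bigr => i _; apply: eq_bigr => -[j jr] _ /=.
by rewrite ff ?gg// ?(leq_trans (leq_subr _ _)) ?leq_subr// (leq_trans _ (leq_subr i r)).
Qed.

Let term f g r p (i j a b : nat) : R :=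
  scoef S i (Npow a f j) (Npow b g (r - i - j)%N) p.

Lemma star_expansion B s t f g r p :
  star S (expansion B s f) (expansion B t g) r p =
  \sum_(i < r.+1) \sum_(j < (r - i).+1) \sum_(a < B) \sum_(b < B)
    s a * t b * term f g r p i j a b.
Proof.
rewrite Cinf_sumE; apply: eq_bigr => i _; rewrite Cinf_sumE; apply: eq_bigr => j _.
have bS := scoef_bidiffop S i; set y := expansion B t g _.
have scal (D : Cinf M -> Cinf M) c x : diffop D -> D (c *: x) = c *: D x.
  by move=> dD; have := diffop_linear c x 0 dD; rewrite !addr0 diffop_zero// addr0.
rewrite (diffop_bigsum _ _ (bidiffopl y bS)) Cinf_sumE; apply: eq_bigr => a _.
rewrite (scal (fun z => scoef S i z y) _ _ (bidiffopl y bS)) CinfE /y.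
rewrite (diffop_bigsum _ _ (bidiffopr _ bS)) Cinf_sumE mulr_sumr; apply: eq_bigr => b _.
by rewrite (scal _ _ _ (bidiffopr _ bS)) CinfE mulrA.
Qed.

Hypothesis Q_mult : forall f g, fapp Q (star S f g) = star S (fapp Q f) (fapp Q g).

(* Both sides of Q^k (f * g) = Q^k f * Q^k g are polynomial in k, coefficient by
   coefficient, and log Q is the coefficient of k in Q^k. *)
Lemma fop_log_leibniz f g : fapp (fop_log Q) (star S f g) =
  (fun r => star S (fapp (fop_log Q) f) g r + star S f (fapp (fop_log Q) g) r).
Proof.
apply/funext => r; apply: Cinf_ext => p; rewrite CinfE.
have itQ k : iter k (fapp Q) (star S f g) = star S (iter k (fapp Q) f) (iter k (fapp Q) g).
  by elim: k => //= k ->; rewrite Q_mult.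
pose F := \sum_(j < r.+1) Npow j (star S f g) r p *: binom_poly R j.
pose G := \sum_(i < r.+1) \sum_(j < (r - i).+1) \sum_(a < r.+1) \sum_(b < r.+1)
  term f g r p i j a b *: (binom_poly R a * binom_poly R b).
have FG : F = G.
  apply: poly_eq_on_nat => k.
  transitivity (iter k (fapp Q) (star S f g) r p).
    rewrite (@iter_Q r.+1)// Cinf_sumE horner_sum; apply: eq_bigr => j _.
    by rewrite hornerZ binom_polyE CinfE mulrC.
  rewrite itQ (star_low (f' := expansion r.+1 (fun j => 'C(k, j)%:R) f)
    (g' := expansion r.+1 (fun j => 'C(k, j)%:R) g)); last 2 first.
  - by move=> j jr; exact: iter_Q.
  - by move=> j jr; exact: iter_Q.
  rewrite star_expansion horner_sum; apply: eq_bigr => i _.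
  rewrite horner_sum; apply: eq_bigr => j _; rewrite horner_sum; apply: eq_bigr => a _.
  rewrite horner_sum; apply: eq_bigr => b _.
  by rewrite hornerZ hornerM !binom_polyE mulrC.
have -> : fapp (fop_log Q) (star S f g) r p = F`_1.
  rewrite (@fop_log_expansion r.+1)// Cinf_sumE coef_sum; apply: eq_bigr => j _.
  by rewrite [RHS]coefZ CinfZE mulrC.
rewrite FG.
rewrite (star_low (f := fapp (fop_log Q) f) (g := g)
  (f' := expansion r.+1 (fun j => (binom_poly R j)`_1) f)
  (g' := expansion r.+1 (fun j => (binom_poly R j)`_0) g)); last 2 first.
- by move=> j jr; exact: fop_log_expansion.
- by move=> j jr; exact: expansion_delta.
rewrite (star_low (f := f) (g := fapp (fop_log Q) g)
  (f' := expansion r.+1 (fun j => (binom_poly R j)`_0) f)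
  (g' := expansion r.+1 (fun j => (binom_poly R j)`_1) g)); last 2 first.
- by move=> j jr; exact: expansion_delta.
- by move=> j jr; exact: fop_log_expansion.
rewrite !star_expansion -big_split coef_sum; apply: eq_bigr => i _.
rewrite -big_split coef_sum; apply: eq_bigr => j _.
rewrite -big_split coef_sum; apply: eq_bigr => a _.
rewrite -big_split coef_sum; apply: eq_bigr => b _.
(* The coefficient of degree 1 of a product p q is p_0 q_1 + p_1 q_0: this is the Leibniz rule. *)
rewrite [LHS]coefZ coefM !big_ord_recl big_ord0 /= addr0 /bump /= mulrC -mulrDl.
by rewrite addrC.
Qed.

Lemma star_derivation_log : star_derivation S (fop_log Q).
Proof.
split; last exact: fop_log_leibniz.
move=> a f g; apply/funext => r; rewrite /fapp scaler_sumr -big_split /=.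
by apply: eq_bigr => i _; rewrite (diffop_linear _ _ _ (fop_log_diffop i)).
Qed.

End Logarithm.

Theorem mainTheorem4 (R : realType) (n : nat) (M : manifold R n)
    (P : poisson M) (S : star_product P) (rho : formal_density M)
    (hrho : formal_nonvanishing rho) :
  star_derivation S (fop_log (Q_op S rho)) /\
  (forall f : Cinf M,
     eqmod_nu 2 (fapp (fop_log (Q_op S rho)) (fconst f))
                (fnu (fconst (divergence (rho 0%N) (hamiltonian P f))))) /\
  (forall f : Cinf M,
     Q_op S rho 1%N f = divergence (rho 0%N) (hamiltonian P f)).
Proof.
have dQ := Q_diffop S hrho; have Q0 := Q_op0 S hrho.
split; last split.
- by apply: star_derivation_log => // f g; exact: Q_star.
- move=> f [|[|//]] _; rewrite fapp_const; try exact: fop_log_diffop.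
    by rewrite fop_log0.
  by rewrite fop_log1// (Q_op1 S hrho).
- by move=> f; exact: Q_op1.
Qed.
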